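(* Let $A\subseteq\mathbb{R}$ and $I\subseteq[1,2]$ be compact intervals, and let $g:A\times I\to\mathbb{R}$ be nondegenerate away from the origin and satisfy the cinematic curvature condition with constant $\kappa$. For $a\in A$ let $\Gamma_a=\{(X,g(a,|X|))\in\mathbb{R}^2\times\mathbb{R}:|X|\in I'\}$, where $I'$ is the compact interval with the same right endpoint as $I$ and length $|I|/2$. (a) If $g$ is elliptic, then there is a constant $C$ depending only on $|I|$, $\|g\|_{\mathrm{reg}}$, $\inf_{A\times I}|g_t|$, $\lambda_1$ and $\kappa$ such that for all $a,\bar a\in A$, $$\sup_{\tau\in\mathbb{R}^3}\big|(\Gamma_a(\delta)+\tau)\cap\Gamma_{\bar a}(\delta)\big|\le C\,\frac{\delta^2}{\delta+|\bar a-a|}\qquad\text{for all }\delta\in(0,1).$$ (b) If $g$ is hyperbolic, and if (i) $(g_{tta},g_{ttt})$ exists everywhere on $A\times I$ and (ii) the family of maps $\{t\mapsto(g_{tta}(a,t),g_{ttt}(a,t))\}_{a\in A}$ is equicontinuous, then there is a constant $C$ depending only on $|I|$, $\|g\|_{\mathrm{reg}}$, $\inf_{A\times I}|g_t|$, $\lambda_1$, $\kappa$ and the uniform modulus of continuity of $t\mapsto(g_{tta},g_{ttt})$ such that for all $a,\bar a\in A$, $$\sup_{\tau\in\mathbb{R}^3}\big|(\Gamma_a(\delta)+\tau)\cap\Gamma_{\bar a}(\delta)\big|\le C\,\frac{\delta^2|\log\delta|}{\delta+|\bar a-a|}\qquad\text{for all }\delta\in(0,1/2).$$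
   Context: Subscripts denote partial derivatives of $g(a,t)$. For a function $g$ on $A\times I$ put $\|g\|_\infty=\sup_{A\times I}|g|$, $\|g\|_{\mathrm{Lip}}=\sup_{(\bar a,\bar t)\neq(a,t)\in A\times I}\frac{|g(\bar a,\bar t)-g(a,t)|}{|\bar a-a|+|\bar t-t|}$, and $\|g\|_{\mathrm{reg}}=\|g_t\|_\infty+\|g_t\|_{\mathrm{Lip}}+\|g_{tt}\|_{\mathrm{Lip}}$ (finiteness includes the existence of $g_t,g_{tt}$ on $A\times I$). Given compact intervals $A\subseteq\mathbb{R}$, $I\subseteq[1,2]$, $g:A\times I\to\mathbb{R}$ is nondegenerate away from the origin if (a) $\|g\|_{\mathrm{reg}}<\infty$; and (b) $g_t(a,t)\ne0$ for all $(a,t)\in A\times I$ and $\lambda_1:=\inf_{t\in I}\inf_{\bar a\ne a\in A}\frac{|g_t(\bar a,t)-g_t(a,t)|}{|\bar a-a|}>0$. A function $g:A\times I\to\mathbb{R}$ with $\|g\|_{\mathrm{reg}}<\infty$ satisfies the cinematic curvature condition if $$\kappa:=\inf_{(\bar a,\bar t)\ne(a,t)\in A\times I}\frac{|g_t(\bar a,\bar t)-g_t(a,t)|+|g_{tt}(\bar a,\bar t)-g_{tt}(a,t)|}{|\bar a-a|+|\bar t-t|}>0;$$ furthermore it is called elliptic (resp. hyperbolic) if for all $\bar a\neq a$ in $A$ and $\bar t>t$ in $I$, $$D\cdot\big(g_t(\bar a,t)-g_t(a,t)\big)\cdot g_t(a,t)>0\ (\text{resp. }<0),$$ where $$D=\det\begin{pmatrix}g_t(\bar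 a,\bar t)-g_t(\bar a,t)&g_t(\bar a,t)-g_t(a,t)\\ g_{tt}(\bar a,\bar t)-g_{tt}(\bar a,t)&g_{tt}(\bar a,t)-g_{tt}(a,t)\end{pmatrix}.$$ For $E\subseteq\mathbb{R}^3$, $E(\delta)=\{x+y:x\in E,\ |y|<\delta\}$ and $|E|$ denotes Lebesgue measure; $|I|$ is the length of $I$. *)

(* Defs.v *)
From HB Require Import structures.
From mathcomp Require Export all_boot all_order all_algebra.
From mathcomp Require Export all_classical all_reals all_analysis.

Set Implicit Arguments.
Unset Strict Implicit.
Unset Printing Implicit Defensive.

Import Order.TTheory GRing.Theory Num.Theory.
Import numFieldNormedType.Exports.

Local Open Scope classical_set_scope.
Local Open Scope ring_scope.

Section Defs.
Context {R : realType}.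

(** The library's derivative needs a two-sided neighbourhood and its norm on
    products is the max norm, so one-sided derivatives at endpoints and
    Euclidean lengths are defined here.  A function on [A x I] is represented by
    a total [g : R -> R -> R]; nothing below depends on its values elsewhere. *)

Definition quotient (f : R -> R) (x y : R) : R := (f y - f x) / (y - x).

Definition derivable_in (D : set R) (f : R -> R) (x : R) : Prop :=
  cvg (quotient f x y @[y --> within D x^']).

(** Meaningful when [derivable_in D f x] holds and [x] is a limit point of [D]. *)
Definition derivative_in (D : set R) (f : R -> R) (x : R) : R :=
  lim (quotient f x y @[y --> within D x^']).

Definition norm2 (p : R * R) : R := Num.sqrt (p.1 ^+ 2 + p.2 ^+ 2).

Definition norm3 (p : R * R * R) : R :=
  Num.sqrt (p.1.1 ^+ 2 + p.1.2 ^+ 2 + p.2 ^+ 2).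

Definition volume : set (R * R * R) -> \bar R :=
  (((@lebesgue_measure R) \x (@lebesgue_measure R)) \x (@lebesgue_measure R))%E.

(** [E(delta)] *)
Definition nbhd (E : set (R * R * R)) (delta : R) : set (R * R * R) :=
  [set x + y | x in E & y in [set y | norm3 y < delta]].

Definition translate (E : set (R * R * R)) (tau : R * R * R) :
  set (R * R * R) := [set x + tau | x in E].

Section OnRectangle.
Variables A I : set R.

Definition d_t (g : R -> R -> R) (a t : R) : R := derivative_in I (g a) t.
Definition d_a (g : R -> R -> R) (a t : R) : R :=
  derivative_in A (fun b => g b t) a.

Definition has_d_t (g : R -> R -> R) : Prop :=
  forall a t, A a -> I t -> derivable_in I (g a) t.
Definition has_d_a (g : R -> R -> R) : Prop :=
  forall a t, A a -> I t -> derivable_in A (fun b => g b t) a.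

Definition norm_infty (h : R -> R -> R) : \bar R :=
  ereal_sup [set (`|h p.1 p.2|)%:E | p in A `*` I].

Definition distinct_pairs : set ((R * R) * (R * R)) :=
  [set pq | [/\ (A `*` I) pq.1, (A `*` I) pq.2 & pq.1 <> pq.2]].

Definition norm_Lip (h : R -> R -> R) : \bar R :=
  ereal_sup [set (`|h pq.2.1 pq.2.2 - h pq.1.1 pq.1.2| /
                  (`|pq.2.1 - pq.1.1| + `|pq.2.2 - pq.1.2|))%:E
            | pq in distinct_pairs].

Definition norm_reg (g : R -> R -> R) : \bar R :=
  (norm_infty (d_t g) + norm_Lip (d_t g) + norm_Lip (d_t (d_t g)))%E.

Definition reg_finite (g : R -> R -> R) : Prop :=
  [/\ has_d_t g, has_d_t (d_t g) & (norm_reg g < +oo)%E].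

Definition inf_abs_d_t (g : R -> R -> R) : \bar R :=
  ereal_inf [set (`|d_t g p.1 p.2|)%:E | p in A `*` I].

Definition lambda1 (g : R -> R -> R) : \bar R :=
  ereal_inf [set ereal_inf
      [set (`|d_t g p.2 t - d_t g p.1 t| / `|p.2 - p.1|)%:E
      | p in [set p | [/\ A p.1, A p.2 & p.1 <> p.2]]]
    | t in I].

Definition nondegenerate (g : R -> R -> R) : Prop :=
  [/\ reg_finite g,
      (forall a t, A a -> I t -> d_t g a t != 0) &
      (0 < lambda1 g)%E].

Definition kappa (g : R -> R -> R) : \bar R :=
  ereal_inf [set ((`|d_t g pq.2.1 pq.2.2 - d_t g pq.1.1 pq.1.2| +
                   `|d_t (d_t g) pq.2.1 pq.2.2 - d_t (d_t g) pq.1.1 pq.1.2|) /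
                  (`|pq.2.1 - pq.1.1| + `|pq.2.2 - pq.1.2|))%:E
            | pq in distinct_pairs].

Definition cinematic (g : R -> R -> R) : Prop :=
  reg_finite g /\ (0 < kappa g)%E.

Definition curvature_det (g : R -> R -> R) (a abar t tbar : R) : R :=
  let gt := d_t g in
  let gtt := d_t (d_t g) in
  \det (\matrix_(i < 2, j < 2)
     (if i == 0
      then if j == 0 then gt abar tbar - gt abar t
                     else gt abar t - gt a t
      else if j == 0 then gtt abar tbar - gtt abar t
                     else gtt abar t - gtt a t)).

Definition elliptic (g : R -> R -> R) : Prop :=
  forall a abar t tbar, A a -> A abar -> abar <> a -> I t -> I tbar ->
    t < tbar ->
    0 < curvature_det g a abar t tbar *
        (d_t g abar t - d_t g a t) * d_t g a t.

Definition hyperbolic (g : R -> R -> R) : Prop :=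
  forall a abar t tbar, A a -> A abar -> abar <> a -> I t -> I tbar ->
    t < tbar ->
    curvature_det g a abar t tbar *
        (d_t g abar t - d_t g a t) * d_t g a t < 0.

(** [t |-> (g_tta(a,t), g_ttt(a,t))] *)
Definition third_derivs (g : R -> R -> R) (a t : R) : R * R :=
  (d_a (d_t (d_t g)) a t, d_t (d_t (d_t g)) a t).

Definition has_third_derivs (g : R -> R -> R) : Prop :=
  has_d_a (d_t (d_t g)) /\ has_d_t (d_t (d_t g)).

Definition third_derivs_equicontinuous (g : R -> R -> R) : Prop :=
  forall t, I t -> forall eps, 0 < eps -> exists2 eta, 0 < eta &
    forall a s, A a -> I s -> `|s - t| < eta ->
      norm2 (third_derivs g a s - third_derivs g a t) < eps.

Definition third_derivs_modulus (g : R -> R -> R) (h : R) : \bar R :=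
  ereal_sup [set (norm2 (third_derivs g p.1 p.2.2 - third_derivs g p.1 p.2.1))%:E
            | p in [set p : R * (R * R) |
                [/\ A p.1, I p.2.1, I p.2.2 & `|p.2.2 - p.2.1| <= h]]].

End OnRectangle.

Definition right_half (t0 t1 : R) : set R := `[t1 - (t1 - t0) / 2, t1].

Definition Gamma (I' : set R) (g : R -> R -> R) (a : R) : set (R * R * R) :=
  [set (X, g a (norm2 X)) | X in [set X : R * R | I' (norm2 X)]].

Definition sup_overlap (I' : set R) (g : R -> R -> R) (a abar delta : R) :
  \bar R :=
  ereal_sup [set volume (translate (nbhd (Gamma I' g a) delta) tau `&`
                         nbhd (Gamma I' g abar) delta)
            | tau in [set: R * R * R]].

End Defs.

(* Main.v *)
Require Import Defs.
From mathcomp Require Import measurable_realfun ring lra.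
Set Implicit Arguments.
Unset Strict Implicit.
Unset Printing Implicit Defensive.
Import Order.TTheory GRing.Theory Num.Theory.
Import numFieldNormedType.Exports.
Local Open Scope classical_set_scope.
Local Open Scope ring_scope.

(** After integrating out the vertical coordinate, a translate
    [(X0, s0)] costs at most [delta] times the area of the planar set where
    [g abar |X| - s0 - g a |X - X0| = O(delta)], plus two boundary annuli of
    area [O(delta)].  Write [b = |X0|], [r = |X|], [rho = |X - X0|].

    The plane is cut into eight octants, centred at [0] or [X0], in which polar
    coordinates [(r, s)], [s] a slope, are used.  If [b] is small compared to
    [D = |abar - a|], the function increases radially at rate [D].  Otherwise
    one fixes [r] and varies [s]; the only loss is near the ray through the two
    centres, where [rho^2 - (r - b)^2] behaves like [b s^2].  There the slopes
    fill an interval of length at most [delta / sqrt (b (delta + F r))], where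
    [F r = g abar r - s0 - g a |r - b|] and [F r >= - O(delta)] (for [g_t > 0]).

    The determinant condition says exactly that [F' / (g_t abar - g_t a)(r - b)]
    is monotone, so by the cinematic bound [F] (hyperbolic case) or [- F]
    (elliptic case) is quasiconvex and [D]-convex near its minimum.  Then
    [1 / sqrt (delta + F)] integrates to [O(1 / sqrt D)] in the elliptic case and
    [O(|log delta| / sqrt D)] in the hyperbolic case. *)

Notation lambda := (@lebesgue_measure _).
Notation lambda2 := (product_measure1 (@lebesgue_measure _) (@lebesgue_measure _)).

Section MeasureTools.
Context {R : realType}.
Implicit Types (E P W : set (R * R)) (A B : set R).

Lemma le_integral_ge0 d (T : measurableType d) (mu : {measure set T -> \bar R})
    (f g : T -> \bar R) :
  (forall x, 0 <= f x)%E -> (forall x, f x <= g x)%E ->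
  (\int[mu]_x f x <= \int[mu]_x g x)%E.
Proof.
move=> f0 fg; have g0 x : (0 <= g x)%E by exact: le_trans (f0 x) (fg x).
rewrite !ge0_integralE//; apply: ereal_sup_le => _ [h hf <-]; exists h => // x.
by apply: le_trans (hf x) _; rewrite !patch_setT.
Qed.

Lemma le_lambda A B : A `<=` B -> (lambda A <= lambda B)%E.
Proof. by move=> AB; apply: le_outer_measure. Qed.

Lemma lambda_segment (a b : R) : a <= b -> lambda `[a, b] = (b - a)%:E.
Proof.
rewrite le_eqVlt => /predU1P[->|ab].
  by rewrite set_itv1 lebesgue_measure_set1 subrr.
by rewrite lebesgue_measure_itv /= lte_fin ab EFinB.
Qed.

Lemma lambda_diam A (d : R) :
  0 <= d -> (forall x y, A x -> A y -> x <= y -> y - x <= d) ->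
  (lambda A <= (2 * d)%:E)%E.
Proof.
move=> d0 Ad; have [->|/set0P[x Ax]] := eqVneq A set0.
  by rewrite measure0 lee_fin mulr_ge0.
have := @le_lambda A `[x - d, x + d].
rewrite lambda_segment; last by lra.
have -> : x + d - (x - d) = 2 * d by ring.
apply => y Ay /=; rewrite in_itv/=.
by case: (leP x y) => [xy|/ltW xy]; [have := Ad _ _ Ax Ay xy|have := Ad _ _ Ay Ax xy]; lra.
Qed.

Lemma lambda_affine (k c : R) A : k != 0 -> measurable A ->
  lambda A = (`|k|%:E * lambda ((fun x => (k * x + c)%R) @^-1` A))%E.
Proof.
move=> k0 mA.
pose f := (fun x : R => k * x + c).
have mf : measurable_fun [set: measurableTypeR R] (f : _ -> measurableTypeR R).
  by apply: measurable_funD => //; apply: measurable_funM.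
have k_ge0 : 0 <= `|k| by [].
pose nu := @pushforward _ _ (measurableTypeR R) (measurableTypeR R) R lambda f.
pose mu := mscale (NngNum k_ge0) nu : {measure set (measurableTypeR R) -> \bar R}.
transitivity (mu mf A); last by [].
apply: (@lebesgue_measure_unique R (mu mf)) => // _ /ocitvP[->|[[a b] /= ab ->]].
  by rewrite !measure0.
rewrite /mscale /= /pushforward.
have eqf x y : (k * x + c <= y) = (if 0 < k then x <= (y - c) / k else (y - c) / k <= x).
  case: ltgtP k0 => // kp _.
    by rewrite ler_pdivlMr// mulrC lerBrDr.
  by rewrite ler_ndivrMr// mulrC lerBrDr.
have eqfl x y : (y < k * x + c) = (if 0 < k then (y - c) / k < x else x < (y - c) / k).
  by rewrite ltNge eqf; case: ifP => _; rewrite -ltNge.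
have len : lambda `]a, b] = (b - a)%:E.
  by rewrite lebesgue_measure_itv /= lte_fin ab EFinB.
have -> : lambda `]a, b] = (b - a)%:E by exact: len.
case: ltgtP (k0) eqf eqfl => // kp _ eqf eqfl.
  have -> : f @^-1` `]a, b]%classic = `](a - c) / k, (b - c) / k]%classic.
    apply/seteqP; split => x /=; rewrite !in_itv/= eqf eqfl //.
  have kab : (a - c) / k < (b - c) / k by rewrite ltr_pM2r ?invr_gt0//; lra.
  rewrite lebesgue_measure_itv /= lte_fin kab -EFinD -EFinM gtr0_norm//.
  by congr EFin; field.
have -> : f @^-1` `]a, b]%classic = `[(b - c) / k, (a - c) / k[%classic.
  apply/seteqP; split => x /=; by rewrite !in_itv/= eqf eqfl andbC.
have kab : (b - c) / k < (a - c) / k by rewrite ltr_nM2r ?invr_lt0//; lra.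
rewrite lebesgue_measure_itv /= lte_fin kab -EFinD -EFinM ltr0_norm//.
by congr EFin; field.
Qed.


Lemma measurable_preimage2 E (f g : R * R -> R) :
  measurable E -> measurable_fun [set: R * R] f -> measurable_fun [set: R * R] g ->
  measurable [set p | E (f p, g p)].
Proof.
move=> mE mf mg.
have := measurable_fun_pair mf mg measurableT mE.
by rewrite setTI.
Qed.

Lemma lambda2_fiber E (k c : R -> R) (K : R) :
  measurable E -> measurable_fun [set: R] k -> measurable_fun [set: R] c ->
  (forall p, E p -> k p.1 != 0 /\ `|k p.1| <= K) -> 0 <= K ->
  (lambda2 E <= K%:E * lambda2 [set p | E (p.1, k p.1 * p.2 + c p.1)%R])%E.
Proof.
move=> mE mk mc Ek K0.
set E' := [set p | _].
have mE' : measurable E'.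
  apply: (measurable_preimage2 mE) => //.
  apply: measurable_funD; last exact: measurableT_comp mc measurable_fst.
  apply: measurable_funM; first exact: measurableT_comp mk measurable_fst.
  exact: measurable_snd.
rewrite /product_measure1 -ge0_integralZl//; last exact: measurable_fun_xsection.
apply: le_integral_ge0 => x //=.
have [->|/set0P[y xy]] := eqVneq (xsection E x) set0.
  by rewrite measure0 mule_ge0.
move: xy; rewrite /xsection/= inE => /Ek /= [k0 kK].
rewrite (lambda_affine (c x) k0); last exact: measurable_xsection.
rewrite (_ : _ @^-1` _ = xsection E' x).
  by rewrite lee_wpmul2r// lee_fin.
by apply/seteqP; split => z /=; rewrite /xsection /= !inE.
Qed.

Lemma lambda2_swap E : measurable E -> lambda2 E = lambda2 [set p | E (p.2, p.1)].
Proof.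
move=> mE.
transitivity (product_measure2 (@lebesgue_measure R) (@lebesgue_measure R) E).
  by apply: product_measure_unique => //= A B mA mB; rewrite product_measure2E.
apply: eq_integral => x _ /=; congr lebesgue_measure.
Qed.

Lemma lambda2_fiber_snd E (k c : R -> R) (K : R) :
  measurable E -> measurable_fun [set: R] k -> measurable_fun [set: R] c ->
  (forall p, E p -> k p.2 != 0 /\ `|k p.2| <= K) -> 0 <= K ->
  (lambda2 E <= K%:E * lambda2 [set p | E (k p.2 * p.1 + c p.2, p.2)%R])%E.
Proof.
move=> mE mk mc Ek K0.
have mE1 : measurable [set p | E (p.2, p.1)].
  exact: (measurable_preimage2 mE measurable_snd measurable_fst).
rewrite lambda2_swap//.
apply: le_trans (lambda2_fiber mE1 mk mc _ K0) _; first by move=> p /Ek.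
rewrite lambda2_swap//.
apply: (measurable_preimage2 mE _ measurable_fst).
apply: measurable_funD; last exact: measurableT_comp mc measurable_fst.
apply: measurable_funM; first exact: measurableT_comp mk measurable_fst.
exact: measurable_snd.
Qed.

Lemma lambda2_linear E (c1 c2 p q p' q' : R) : measurable E ->
  `|p * q' - p' * q| = 1 ->
  (lambda2 E <=
   lambda2 [set z | E (c1 + p * z.1 + p' * z.2, c2 + q * z.1 + q' * z.2)%R])%E.
Proof.
wlog p0 : E c1 c2 p q p' q' / p != 0 => [wl mE det|mE det].
  have [pE|] := eqVneq p 0; last by move=> p0; exact: wl.
  have q0 : q != 0.
    by apply/eqP => qE; move: det; rewrite pE qE mul0r mulr0 subrr normr0 => /eqP; rewrite eq_sym oner_eq0.
  rewrite lambda2_swap//.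
  apply: (le_trans (wl _ c2 c1 q p q' p' q0 _ _)) => //.
    exact: (measurable_preimage2 mE measurable_snd measurable_fst).
  by rewrite -det -normrN; congr `|_|; ring.
pose D := p * q' - p' * q.
have D0 : D != 0 by rewrite -normr_gt0 /D det.
pose E1 := [set z : R * R | E (z.1, (D / p) * z.2 + (c2 + (q / p) * (z.1 - c1)))%R].
have mE1 : measurable E1.
  apply: (measurable_preimage2 mE) => //.
  apply: measurable_funD; first by apply: measurable_funM => //; exact: measurable_snd.
  apply: measurable_funD => //; apply: measurable_funM => //.
  apply: measurable_funB => //; exact: measurable_fst.
have h1 : (lambda2 E <= `|D / p|%:E * lambda2 E1)%E.
  apply: (@lambda2_fiber E (fun=> D / p) (fun x => c2 + (q / p) * (x - c1))) => //.
    apply: measurable_funD => //; apply: measurable_funM => //.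
    exact: measurable_funB.
  by move=> _ _; rewrite mulf_neq0 ?invr_eq0.
have h2 : (lambda2 E1 <= `|p|%:E * lambda2 [set z | E1 (p * z.1 + (c1 + p' * z.2), z.2)%R])%E.
  apply: (@lambda2_fiber_snd E1 (fun=> p) (fun y => c1 + p' * y)) => //.
  by apply: measurable_funD => //; apply: measurable_funM.
apply: (le_trans h1); apply: le_trans (lee_wpmul2l _ h2) _; first by rewrite lee_fin.
rewrite muleA -EFinM -normrM divfK// /D det mul1e.
rewrite le_eqVlt; apply/orP; left; apply/eqP; congr (lambda2 _).
apply/seteqP; split => z; rewrite /E1 /=; congr E; congr pair; rewrite /D; try ring; field; exact: p0.
Qed.

End MeasureTools.

Section Sections.
Context {R : realType}.
Implicit Types (E P W : set (R * R)) (A B : set R).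

Lemma sqrt_one_add_sqr_continuous : continuous (fun s : R => Num.sqrt (1 + s ^+ 2)).
Proof.
move=> x; have := @continuous_comp _ _ _ (fun x : R => 1 + x ^+ 2) (@Num.sqrt R) x.
apply; last exact: sqrt_continuous.
by apply: continuousD; [exact: cst_continuous|exact: exprn_continuous].
Qed.

Lemma lambda2_polar W (c1 c2 p q p' q' K : R) : measurable W ->
  `|p * q' - p' * q| = 1 ->
  (forall x y, W (c1 + p * x + p' * y, c2 + q * x + q' * y) -> 0 < x <= K) ->
  0 <= K ->
  (lambda2 W <= K%:E * lambda2 [set z |
     let x := (z.1 / Num.sqrt (1 + z.2 ^+ 2))%R in
     W (c1 + p * x + p' * (x * z.2), c2 + q * x + q' * (x * z.2))%R])%E.
Proof.
move=> mW det WK K0.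
pose E := [set z : R * R | W (c1 + p * z.1 + p' * z.2, c2 + q * z.1 + q' * z.2)].
have mlin (a b e : R) : measurable_fun [set: R * R] (fun z : R * R => a + b * z.1 + e * z.2).
  apply: measurable_funD; last by apply: measurable_funM => //; exact: measurable_snd.
  by apply: measurable_funD => //; apply: measurable_funM => //; exact: measurable_fst.
have mE : measurable E by exact: (measurable_preimage2 mW).
pose E1 := [set z : R * R | E (z.1, z.1 * z.2 + 0)].
have mE1 : measurable E1.
  apply: (measurable_preimage2 mE measurable_fst).
  apply: measurable_funD => //; apply: measurable_funM; [exact: measurable_fst|exact: measurable_snd].
have h1 : (lambda2 E <= K%:E * lambda2 E1)%E.
  apply: (@lambda2_fiber R E id (fun=> 0) K) => // z /WK /andP[z0 zK].
  by rewrite gtr0_norm// gt_eqF.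
pose k s : R := (Num.sqrt (1 + s ^+ 2))^-1.
have h2 : (lambda2 E1 <= 1%:E * lambda2 [set z | E1 (k z.2 * z.1 + 0, z.2)%R])%E.
  apply: (@lambda2_fiber_snd R E1 k (fun=> 0) 1) => //.
    apply: continuous_measurable_fun => x; apply: cvgV.
      by rewrite gt_eqF// sqrtr_gt0; have := sqr_ge0 x; lra.
    by exact: sqrt_one_add_sqr_continuous.
  move=> z _; have q1 : 1 <= Num.sqrt (1 + z.2 ^+ 2).
    by rewrite -[leLHS]sqrtr1 ler_sqrt ?lerDl ?sqr_ge0//; have := sqr_ge0 z.2; lra.
  have q0 : 0 < Num.sqrt (1 + z.2 ^+ 2) by lra.
  by rewrite gt_eqF ?invr_gt0//; split => //; rewrite gtr0_norm ?invr_gt0// invf_le1.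
apply: (le_trans (lambda2_linear c1 c2 mW det)); apply: (le_trans h1).
apply: lee_wpmul2l; first by rewrite lee_fin.
apply: (le_trans h2); rewrite mul1e le_eqVlt; apply/orP; left; apply/eqP; congr (lambda2 _).
apply/seteqP; split => z; rewrite /E1 /E /k /=; rewrite !addr0 [_^-1 * _]mulrC //.
Qed.

Lemma lambda2_le_primitive P (u v : R) (N Phi : R -> R) : u <= v ->
  (forall z, P z -> u <= z.1 <= v) ->
  (forall x, u <= x <= v -> (lambda (xsection P x) <= (N x)%:E)%E) ->
  (forall x, u <= x <= v -> is_derive x 1 Phi (N x)) ->
  (forall x, u <= x <= v -> {for x, continuous N}) ->
  (lambda2 P <= (Phi v - Phi u)%:E)%E.
Proof.
move=> uv Puv PN dPhi cN.
have le1 : (lambda2 P <= \int[lambda]_(x in `[u, v]) (N x)%:E)%E.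
  rewrite [leRHS]integral_mkcond; apply: le_integral_ge0 => x //=.
  rewrite patchE; case: ifPn => [|/negP xuv].
    by rewrite inE/= in_itv/=; exact: PN.
  rewrite (_ : xsection P x = set0) ?measure0//.
  apply/seteqP; split => // y; rewrite /xsection/= inE => /Puv /= xuv'.
  by apply: xuv; rewrite inE/= in_itv.
apply: (le_trans le1).
move: uv; rewrite le_eqVlt => /predU1P[uv|uv].
  by rewrite uv set_itv1 integral_set1 subrr.
rewrite (@continuous_FTC2 _ N Phi)//.
- apply: continuous_in_subspaceT => x; rewrite inE/= in_itv/=; exact: cN.
- have cPhi x : u <= x <= v -> {for x, continuous Phi}.
    by move=> /dPhi [dx _]; apply: differentiable_continuous; exact/derivable1_diffP.
  split.
  + by move=> x; rewrite in_itv/= => /andP[/ltW ux /ltW xv]; have [] := dPhi x; rewrite ?ux.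
  + by apply: cvg_at_right_filter; apply: cPhi; rewrite lexx ltW.
  + by apply: cvg_at_left_filter; apply: cPhi; rewrite lexx ltW.
- move=> x; rewrite in_itv/= => /andP[/ltW ux /ltW xv].
  by rewrite derive1E; apply: derive_val; apply: dPhi; rewrite ux.
Qed.

Lemma lambda2_le_const P (u v n : R) : u <= v ->
  (forall z, P z -> u <= z.1 <= v) ->
  (forall x, u <= x <= v -> (lambda (xsection P x) <= n%:E)%E) ->
  (lambda2 P <= (n * (v - u))%:E)%E.
Proof.
move=> uv Puv Pn; rewrite mulrBr.
apply: (@lambda2_le_primitive P u v (fun=> n) (fun x => n * x)) => // x _.
- by apply: is_derive_eq; rewrite /GRing.scale/= ?mulr1.
- exact: cst_continuous.
Qed.

Lemma volume_le (S : set (R * R * R)) W (h : R) : measurable W -> 0 <= h ->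
  (forall p, S p -> W p.1) ->
  (forall X, W X -> (lambda (xsection S X) <= h%:E)%E) ->
  (volume S <= h%:E * lambda2 W)%E.
Proof.
move=> mW h0 SW Sh.
have -> : (h%:E * lambda2 W = \int[lambda2]_X (h * \1_W X)%:E)%E.
  under eq_integral do rewrite EFinM.
  rewrite ge0_integralZl//.
    by rewrite integral_indic// setIT.
  by apply/measurable_EFinP; exact: measurable_indic.
have -> : volume S = (\int[lambda2]_X lambda (xsection S X))%E by [].
apply: le_integral_ge0 => X; first exact: measure_ge0.
rewrite indicE; case: (boolP (X \in W)) => [|XW].
  by rewrite inE mulr1; exact: Sh.
rewrite mulr0 (_ : xsection S X = set0) ?measure0//.
apply/seteqP; split => // z; rewrite /xsection/= inE => /SW /= WX.
by move: XW; rewrite notin_setE.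
Qed.

End Sections.

Section Slopes.
Context {R : realType}.

Definition slope_on (a b : R) (f u : R -> R) : Prop :=
  (exists L, forall x y, a <= x <= b -> a <= y <= b -> `|f y - f x| <= L * `|y - x|)
  /\ forall x, a < x < b -> is_derive x 1 f (u x).

Lemma lipschitz_within_continuous (a b L : R) (f : R -> R) :
  (forall x y, a <= x <= b -> a <= y <= b -> `|f y - f x| <= L * `|y - x|) ->
  {within `[a, b], continuous f}.
Proof.
move=> fL; apply/subspace_continuousP => x; rewrite /= in_itv/= => xab.
have L0 : 0 < Num.max L 0 + 1 by rewrite ltr_wpDl// le_max lexx orbT.
apply/cvgrPdist_le => e e0.
rewrite near_withinE; near=> y; rewrite /= in_itv/= => yab.
apply: le_trans (fL _ _ yab xab) _.
apply: (@le_trans _ _ ((Num.max L 0 + 1) * `|x - y|)).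
  by rewrite ler_wpM2r// (@le_trans _ _ (Num.max L 0)) ?le_max ?lexx// lerDl.
rewrite -ler_pdivlMl// mulrC; near: y; apply: cvgr_dist_le; first exact: cvg_id.
by rewrite divr_gt0.
Unshelve. all: by end_near. Qed.

Lemma slope_continuous a b f u : slope_on a b f u -> {within `[a, b], continuous f}.
Proof. by move=> [[L fL] _]; exact: lipschitz_within_continuous fL. Qed.

Lemma slopeW a b a' b' f u : a <= a' -> b' <= b -> slope_on a b f u -> slope_on a' b' f u.
Proof.
move=> aa bb [[L fL] df]; split.
  by exists L => x y hx hy; apply: fL; lra.
by move=> x hx; apply: df; lra.
Qed.

Lemma slope_mvt a b f u x y : slope_on a b f u -> a <= x -> x < y -> y <= b ->
  exists2 c, x < c < y & f y - f x = u c * (y - x).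
Proof.
move=> fu ax xy yb; have := slopeW ax yb fu => fxy.
have [c] := @MVT R f u x y xy (fun z hz => fxy.2 z hz) (slope_continuous fxy).
by rewrite in_itv/= => hc e; exists c.
Qed.

Lemma slope_affine a b x0 x1 (k c : R) f u : slope_on a b f u -> k != 0 ->
  (forall x, x0 <= x <= x1 -> a <= k * x + c <= b) ->
  slope_on x0 x1 (fun x => f (k * x + c)) (fun x => k * u (k * x + c)).
Proof.
move=> [[L fL] df] k0 h; split.
  exists (L * `|k|) => x y hx hy; apply: le_trans (fL _ _ (h _ hx) (h _ hy)) _.
  by rewrite -mulrA -normrM le_eqVlt; apply/orP; left; apply/eqP; congr (_ * `|_|); ring.
move=> x hx; have d1 : is_derive (k * x + c) 1 f (u (k * x + c)).
  apply: df.
  have h0 := h x0 ltac:(lra); have h1 := h x1 ltac:(lra).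
  by case: (ltgtP k 0) k0 => // kn _; nra.
have d2 : is_derive x 1 (fun x : R => k * x + c) k.
  by apply: is_derive_eq; rewrite addr0 /GRing.scale/= mulr1.
have := @is_derive1_comp _ f (fun x : R => k * x + c) x (u (k * x + c)) k d1 d2.
by rewrite mulrC.
Qed.

Lemma slopeB a b f u g v : slope_on a b f u -> slope_on a b g v ->
  slope_on a b (fun x => f x - g x) (fun x => u x - v x).
Proof.
move=> [[L fL] df] [[K gK] dg]; split.
  exists (L + K) => x y hx hy; rewrite mulrDl (_ : _ - _ = (f y - f x) - (g y - g x)); last by ring.
  by apply: le_trans (ler_normB _ _) _; apply: lerD; [exact: fL|exact: gK].
by move=> x hx; apply: is_deriveB; [exact: df|exact: dg].
Qed.

Lemma slope_cst a b (c : R) : slope_on a b (fun=> c) (fun=> 0).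
Proof. by split; [exists 0 => x y _ _; rewrite subrr normr0 mul0r|move=> x _; exact: is_derive_cst]. Qed.

Lemma slopeN a b f u : slope_on a b f u -> slope_on a b (fun x => - f x) (fun x => - u x).
Proof.
move=> fu; have := slopeB (slope_cst a b 0) fu.
by congr slope_on; apply/funext => x; rewrite sub0r.
Qed.

Lemma slope_sqr a b (c k : R) :
  slope_on a b (fun x => k * (x - c) ^+ 2) (fun x => 2 * k * (x - c)).
Proof.
split; last first.
  by move=> x _; apply: is_derive_eq; rewrite /GRing.scale/=; ring.
exists (`|k| * (2 * (`|a| + `|b| + `|c|))) => x y hx hy.
rewrite (_ : _ - _ = k * ((x + y - 2 * c) * (y - x))); last by ring.
rewrite 2!normrM mulrA ler_wpM2r// ler_wpM2l//.
have xn : `|x| <= `|a| + `|b|.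
  by rewrite ler_norml; have := ler_norm a; have := ler_norm (- a); have := ler_norm b;
    have := ler_norm (- b); rewrite !normrN; lra.
have yn : `|y| <= `|a| + `|b|.
  by rewrite ler_norml; have := ler_norm a; have := ler_norm (- a); have := ler_norm b;
    have := ler_norm (- b); rewrite !normrN; lra.
by apply: le_trans (ler_normB _ _) _; have := ler_normD x y; rewrite normrM gtr0_norm//; lra.
Qed.

Lemma slope_le a b f u x y : slope_on a b f u -> (forall z, a < z < b -> 0 <= u z) ->
  a <= x -> x <= y -> y <= b -> f x <= f y.
Proof.
move=> fu u0 ax; rewrite le_eqVlt => /predU1P[->//|xy] yb.
have [c cxy e] := slope_mvt fu ax xy yb.
by rewrite -subr_ge0 e mulr_ge0 ?u0 //; lra.
Qed.

Lemma convex_comb_in (t0 t1 x y s : R) : t0 <= x <= t1 -> t0 <= y <= t1 ->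
  0 <= s <= 1 -> t0 <= (y - x) * s + x <= t1.
Proof. by move=> ? ? ?; apply/andP; split; nra. Qed.

Lemma convex_comb_norm (b x y c : R) : `|x| <= b -> `|y| <= b -> 0 <= c <= 1 ->
  `|(1 - c) * x + c * y| <= b.
Proof.
by rewrite !ler_norml => /andP[? ?] /andP[? ?] ?; apply/andP; split; nra.
Qed.

Lemma other_radius_dist (b w x y : R) : 0 <= b -> -1 <= w <= 1 -> 0 <= x -> 0 <= y ->
  y ^+ 2 = x ^+ 2 + b ^+ 2 - 2 * b * x * w -> `|x - y| <= b.
Proof.
move=> b0 wb x0 y0 e1.
have wl : 0 <= b * x * (1 - w) by rewrite !mulr_ge0; lra.
have wr : 0 <= b * x * (1 + w) by rewrite !mulr_ge0; lra.
by rewrite ler_norml; apply/andP; split; rewrite leNgt; apply/negP => h; nra.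
Qed.

Lemma other_radius_increment (b w r r' rho rho' : R) :
  -1 <= w <= 1 -> 1 <= rho -> 1 <= rho' -> r <= r' ->
  `|r - rho| <= b -> `|r' - rho'| <= b ->
  rho ^+ 2 = r ^+ 2 + b ^+ 2 - 2 * b * r * w ->
  rho' ^+ 2 = r' ^+ 2 + b ^+ 2 - 2 * b * r' * w ->
  `|(rho' - rho) - (r' - r)| <= 2 * b * (r' - r).
Proof.
move=> wb r1 r1' rr rb rb' E E'.
have e1 : ((rho' - rho) - (r' - r)) * (rho + rho')
    = (r' - r) * ((r' - rho') + (r - rho) - 2 * b * w).
  clear - E E'; nra.
have le4 : `|(r' - rho') + (r - rho) - 2 * b * w| <= 4 * b.
  clear - rb rb' wb; move: rb rb'; rewrite !ler_norml => /andP[h1 h2] /andP[h3 h4].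
  by apply/andP; split; nra.
have s0 : 0 <= rho + rho' by lra.
have d0 : 0 <= r' - r by lra.
have : `|(rho' - rho) - (r' - r)| * (rho + rho') <= (r' - r) * (4 * b).
  by rewrite -[X in _ * X](ger0_norm s0) -normrM e1 normrM (ger0_norm d0) ler_wpM2l.
have := normr_ge0 ((rho' - rho) - (r' - r)); set n := `|_|.
clear - r1 r1'; nra.
Qed.

(* Along [r + s (r' - r)] the other radius moves along a segment of nearly the
   same length, so the mean value theorem sees [u1 - u2] up to [3 M b]. *)
Lemma radial_gap (t0 t1 M gap b w s0 e r r' rho rho' : R) (f1 f2 u1 u2 : R -> R) :
  1 <= t0 -> t1 <= 2 -> slope_on t0 t1 f1 u1 -> slope_on t0 t1 f2 u2 ->
  (forall x, t0 <= x <= t1 -> `|u2 x| <= M) ->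
  (forall x y, t0 <= x <= t1 -> t0 <= y <= t1 -> `|u2 x - u2 y| <= M * `|x - y|) ->
  (forall x, t0 <= x <= t1 -> gap <= `|u1 x - u2 x|) ->
  0 <= b -> b < 1 / 2 -> 6 * M * b <= gap -> -1 <= w <= 1 ->
  t0 <= r <= t1 -> t0 <= r' <= t1 -> t0 <= rho <= t1 -> t0 <= rho' <= t1 ->
  rho ^+ 2 = r ^+ 2 + b ^+ 2 - 2 * b * r * w ->
  rho' ^+ 2 = r' ^+ 2 + b ^+ 2 - 2 * b * r' * w ->
  `|f1 r - s0 - f2 rho| <= e -> `|f1 r' - s0 - f2 rho'| <= e ->
  r <= r' -> gap * (r' - r) <= 4 * e.
Proof.
move=> t01 t12 s1 s2 uM uL ugap b0 bh Mb wb hr hr' hrho hrho' erho erho' he he'.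
rewrite le_eqVlt => /predU1P[->|rr'].
  by rewrite subrr mulr0; have := normr_ge0 (f1 r' - s0 - f2 rho'); lra.
pose d := r' - r; pose k := rho' - rho.
have d0 : 0 < d by rewrite /d subr_gt0.
have t00 : 0 <= t0 by exact: le_trans t01.
have [/andP[r1 _] /andP[r1' _] /andP[p1 _] /andP[p1' _]] := And4 hr hr' hrho hrho'.
have rb := other_radius_dist b0 wb (le_trans t00 r1) (le_trans t00 p1) erho.
have rb' := other_radius_dist b0 wb (le_trans t00 r1') (le_trans t00 p1') erho'.
have kd : `|k - d| <= 2 * b * d.
  exact: (other_radius_increment wb (le_trans t01 p1) (le_trans t01 p1') (ltW rr') rb rb').
have k0 : k != 0.
  apply/eqP => kE; move: kd; rewrite kE sub0r normrN gtr0_norm//.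
  by clear - d0 bh; nra.
have sPhi := slopeB
  (slope_affine (x0 := 0) (x1 := 1) (k := d) (c := r) s1 (lt0r_neq0 d0)
     (fun s => convex_comb_in hr hr'))
  (slope_affine (x0 := 0) (x1 := 1) (k := k) (c := rho) s2 k0
     (fun s => convex_comb_in hrho hrho')).
have [c c01] := slope_mvt sPhi (lexx 0) ltr01 (lexx 1).
have c01' : 0 <= c <= 1 by case/andP: c01 => /ltW -> /ltW ->.
rewrite !mulr1 !mulr0 !add0r subr0 mulr1.
set x := d * c + r; set y := k * c + rho => eqPhi.
have hx : t0 <= x <= t1 by exact: convex_comb_in.
have hy : t0 <= y <= t1 by exact: convex_comb_in.
have xy : `|x - y| <= b.
  rewrite (_ : x - y = (1 - c) * (r - rho) + c * (r' - rho')).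
    exact: convex_comb_norm.
  by rewrite /x /y /d /k; clear; ring.
have M0 : 0 <= M by apply: le_trans (uM _ hr).
have up : `|d * u1 x - k * u2 y| <= 2 * e.
  rewrite -eqPhi /d /k !subrK.
  rewrite (_ : _ - _ = (f1 r' - s0 - f2 rho') - (f1 r - s0 - f2 rho)); last by clear; ring.
  by rewrite mulr2n mulrDl mul1r (le_trans (ler_normB _ _))// lerD.
have dec : d * (u1 x - u2 x) = (d * u1 x - k * u2 y) - d * (u2 x - u2 y) + (k - d) * u2 y.
  by clear; ring.
have low : d * `|u1 x - u2 x| <= 2 * e + d * (M * b) + 2 * b * d * M.
  rewrite -{1}(gtr0_norm d0) -normrM dec.
  apply: le_trans (ler_normD _ _) _; apply: lerD.
    apply: le_trans (ler_normB _ _) _; apply: lerD => //.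
    rewrite normrM (gtr0_norm d0) ler_wpM2l ?(ltW d0)//.
    by apply: le_trans (uL _ _ hx hy) _; rewrite ler_wpM2l.
  by rewrite normrM ler_pM ?uM.
have := ugap _ hx; rewrite -/d; move: low; set n := `|u1 x - u2 x|.
by clear - d0 Mb; nra.
Qed.

End Slopes.

Section Quasiconvex.
Context {R : realType}.

Definition strongly_quasiconvex (a b c T : R) (f : R -> R) : Prop :=
  [/\ a <= c <= b,
      forall x y, c <= x -> x <= y -> y <= b ->
        T / 2 * ((y - c) ^+ 2 - (x - c) ^+ 2) <= f y - f x &
      forall x y, a <= x -> x <= y -> y <= c ->
        T / 2 * ((c - x) ^+ 2 - (c - y) ^+ 2) <= f x - f y].

(* Past a zero, [u] cannot leave the region above the line of slope [T]:
   on leaving it [u] would lie in [(-T, T)], where it grows with slope [T]. *)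
Lemma slope_growth (a b T x y : R) (u v : R -> R) :
  slope_on a b u v -> b - a <= 1 -> 0 < T ->
  (forall z, a < z < b -> `|u z| < T -> T <= v z) ->
  a <= x -> x <= y -> y <= b -> 0 <= u x -> T * (y - x) <= u y.
Proof.
move=> su ab T0 uv ax xy yb ux.
rewrite leNgt; apply/negP => uy.
pose S := [set z | x <= z <= y /\ T * (z - x) <= u z].
have Sx : S x by split; [rewrite lexx|rewrite subrr mulr0].
have Sub : ubound S y by move=> z [/andP[]].
have hS : has_sup S by split; [exists x|exists y].
pose z0 := sup S.
have xz0 : x <= z0 by apply: ub_le_sup => //; exists y.
have z0y : z0 <= y by apply: ge_sup => //; exists x.
have [[L uL] du] := su.
pose K := Num.max L 0 + 1.
have K0 : 0 < K by rewrite /K ltr_wpDl// le_max lexx orbT.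
have {}uL z z' : a <= z <= b -> a <= z' <= b -> `|u z' - u z| <= K * `|z' - z|.
  move=> hz hz'; apply: le_trans (uL _ _ hz hz') _; rewrite ler_wpM2r//.
  by rewrite /K (@le_trans _ _ (Num.max L 0)) ?le_max ?lexx// lerDl.
have z0S : T * (z0 - x) <= u z0.
  rewrite leNgt; apply/negP => h.
  pose e := (T * (z0 - x) - u z0) / (K + T).
  have KT : 0 < K + T by rewrite addr_gt0.
  have e0 : 0 < e by rewrite divr_gt0// subr_gt0.
  have [z [hz Sz] ez] := sup_adherent e0 hS.
  have zz0 : z <= z0 by apply: ub_le_sup => //; exists y.
  have := uL z0 z ltac:(lra) ltac:(lra).
  rewrite (ler0_norm (_ : z - z0 <= 0)); last by lra.
  have ezz : (K + T) * (z0 - z) < T * (z0 - x) - u z0.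
    rewrite mulrC -ltr_pdivlMr//; rewrite -/z0 in ez; rewrite -/e; lra.
  rewrite ler_norml => /andP[_ h2]; clear - h2 ezz Sz; lra.
have z0y' : z0 < y by rewrite lt_neqAle z0y andbT; apply/eqP => zE; move: uy; rewrite ltNge -zE z0S.
have aft z : z0 < z -> z <= y -> u z < T * (z - x).
  move=> z0z zy; rewrite ltNge; apply/negP => h.
  have : z <= z0 by apply: ub_le_sup; [exists y|split; rewrite ?(le_trans xz0 (ltW z0z))].
  by rewrite leNgt z0z.
pose y' := Num.min y (z0 + T / (2 * K)).
have TK : 0 < T / (2 * K) by rewrite divr_gt0// mulr_gt0.
have y'1 : z0 < y' by rewrite /y' lt_min z0y' /= ltrDl.
have y'2 : y' <= y by rewrite /y' ge_min lexx.
have y'3 : y' <= z0 + T / (2 * K) by rewrite /y' ge_min lexx orbT.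
have [c /andP[c1 c2] e] := slope_mvt su (le_trans ax xz0) y'1 (le_trans y'2 yb).
have uc : `|u c| < T.
  have := aft c c1 ltac:(lra).
  have := uL z0 c ltac:(lra) ltac:(lra).
  rewrite (gtr0_norm (_ : 0 < c - z0)); last by lra.
  have : K * (c - z0) < T.
    have : c - z0 < T / K.
      have : T / K = 2 * (T / (2 * K)) by field; rewrite gt_eqF.
      lra.
    by rewrite ltr_pdivlMr// mulrC.
  rewrite ler_norml ltr_norml => h /andP[h1 h2] h3; apply/andP; split; nra.
have vc : T <= v c by apply: uv => //; lra.
have := aft y' y'1 y'2; nra.
Qed.

Lemma quasiconvex_right (a b c T : R) (f u v : R -> R) :
  slope_on a b f u -> slope_on a b u v -> b - a <= 1 -> 0 < T ->
  (forall z, a < z < b -> `|u z| < T -> T <= v z) ->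
  a <= c -> c <= b -> (forall z, a <= z <= b -> f c <= f z) ->
  forall x y, c <= x -> x <= y -> y <= b ->
    T / 2 * ((y - c) ^+ 2 - (x - c) ^+ 2) <= f y - f x.
Proof.
move=> sf su ab T0 uv ac cb fc x y cx xy yb.
have ub z : c < z -> z <= b -> T * (z - c) <= u z.
  move=> cz zb; apply/ler_addgt0Pr => e e0.
  pose h := Num.min ((z - c) / 2) (e / T).
  have eT : 0 < e / T by rewrite divr_gt0.
  have h0 : 0 < h by rewrite /h lt_min eT andbT; lra.
  have h1 : h <= (z - c) / 2 by rewrite /h ge_min lexx.
  have h2 : h * T <= e by rewrite -ler_pdivlMr// /h ge_min lexx orbT.
  have ch : c < c + h by lra.
  have chb : c + h <= b by lra.
  have [xi xih e1] := slope_mvt sf ac ch chb.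
  have uxi : 0 <= u xi.
    have := fc (c + h) ltac:(lra); rewrite -subr_ge0 e1 (_ : c + h - c = h); last by ring.
    by rewrite pmulr_lge0.
  have := @slope_growth a b T xi z u v su ab T0 uv ltac:(lra) ltac:(lra) zb uxi.
  nra.
have sg := slopeB (slopeW ac (lexx b) sf) (slope_sqr c b c (T / 2)).
have h z : c < z < b -> 0 <= u z - 2 * (T / 2) * (z - c).
  by move=> /andP[cz /ltW zb]; have := ub z cz zb; lra.
by have := slope_le sg h cx xy yb; lra.
Qed.

Lemma strongly_quasiconvex_of_slopes (a b T : R) (f u v : R -> R) :
  slope_on a b f u -> slope_on a b u v -> a <= b -> b - a <= 1 -> 0 < T ->
  (forall z, a < z < b -> `|u z| < T -> T <= v z) ->
  exists c, strongly_quasiconvex a b c T f.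
Proof.
move=> sf su ab ab1 T0 uv.
have [c] := EVT_min ab (slope_continuous sf); rewrite in_itv/= => cab fc.
have {}fc z : a <= z <= b -> f c <= f z by move=> h; apply: fc; rewrite in_itv.
have /andP[ac cb] := cab.
exists c; split => //; first exact: (quasiconvex_right sf su).
have n0 : (-1 : R) != 0 by rewrite oppr_eq0 oner_eq0.
have hr z : - b <= z <= - a -> a <= -1 * z + 0 <= b by lra.
have sf' := slope_affine sf n0 hr.
have su' := slopeN (slope_affine su n0 hr).
have uE : (fun x => - u (-1 * x + 0)) = (fun x => -1 * u (-1 * x + 0)).
  by apply/funext => x; ring.
rewrite uE in su'.
move=> x y ax xy yc.
have := @quasiconvex_right (- b) (- a) (- c) T _ _ _ sf' su' _ T0 _ _ _ _ (- y) (- x).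
rewrite !mulN1r !opprK !addr0; move=> h.
have -> : c - x = - x + c by ring. have -> : c - y = - y + c by ring.
apply: h; try lra.
  move=> z hz; rewrite mulN1r normrN => /uv h; have := h ltac:(lra); lra.
by move=> z hz; apply: fc; lra.
Qed.

End Quasiconvex.

Section Angular.
Context {R : realType}.

Lemma sqrt_one_add_sqrP (s : R) : 0 <= s <= 1 ->
  let q := Num.sqrt (1 + s ^+ 2) in [/\ 1 <= q, q <= 2 & q ^+ 2 = 1 + s ^+ 2].
Proof.
move=> hs q; have s2 : 0 <= 1 + s ^+ 2 by nra.
have q2 : q ^+ 2 = 1 + s ^+ 2 by rewrite sqr_sqrtr.
have q0 : 0 <= q by exact: sqrtr_ge0.
by split => //; rewrite leNgt; apply/negP => h; nra.
Qed.

Lemma inv_sqrt_gap (s s' : R) : 0 <= s -> s <= s' -> s' <= 1 ->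
  (s' ^+ 2 - s ^+ 2) / 16 <=
    (Num.sqrt (1 + s ^+ 2))^-1 - (Num.sqrt (1 + s' ^+ 2))^-1.
Proof.
move=> s0 ss s1.
have [q1 q2 qE] := sqrt_one_add_sqrP (s := s) ltac:(lra).
have [q1' q2' qE'] := sqrt_one_add_sqrP (s := s') ltac:(lra).
move: q1 q2 qE q1' q2' qE'; set q := Num.sqrt _; set q' := Num.sqrt _ => q1 q2 qE q1' q2' qE'.
have -> : s' ^+ 2 - s ^+ 2 = (q' - q) * (q' + q) by nra.
have -> : q^-1 - q'^-1 = (q' - q) / (q * q').
  by field; rewrite !gt_eqF//; lra.
have qq : q <= q' by rewrite leNgt; apply/negP => h; nra.
rewrite ler_pdivlMr; last by nra.
have qq1 : q * q' <= 4 by nra.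
have : (q' + q) * (q * q') <= 16 by nra.
nra.
Qed.

Lemma inv_sqrt_ge (s : R) : 0 <= s <= 1 ->
  1 - s ^+ 2 / 2 <= (Num.sqrt (1 + s ^+ 2))^-1 <= 1.
Proof.
move=> hs; have [q1 q2 qE] := sqrt_one_add_sqrP hs.
move: q1 q2 qE; set q := Num.sqrt _ => q1 q2 qE.
apply/andP; split; last by rewrite invf_le1 //; lra.
rewrite -[q^-1]div1r ler_pdivlMr; last lra.
have -> : s ^+ 2 = q ^+ 2 - 1 by lra.
nra.
Qed.

Lemma div_sqrt_gap (s s' : R) : 0 <= s -> s <= s' -> s' <= 1 ->
  (s' - s) / 8 <= s' / Num.sqrt (1 + s' ^+ 2) - s / Num.sqrt (1 + s ^+ 2).
Proof.
move=> s0 ss s1.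
have [q1 q2 qE] := sqrt_one_add_sqrP (s := s) ltac:(lra).
have [q1' q2' qE'] := sqrt_one_add_sqrP (s := s') ltac:(lra).
move: q1 q2 qE q1' q2' qE'; set q := Num.sqrt _; set q' := Num.sqrt _ => q1 q2 qE q1' q2' qE'.
have -> : s' / q' - s / q = (s' * q - s * q') / (q * q').
  by field; rewrite !gt_eqF//; lra.
have e1 : (s' * q - s * q') * (s' * q + s * q') = (s' - s) * (s' + s).
  transitivity (s' ^+ 2 * q ^+ 2 - s ^+ 2 * q' ^+ 2); first by ring.
  by rewrite qE qE'; ring.
rewrite ler_pdivlMr; last by nra.
have X2 : (s' - s) / 2 <= s' * q - s * q'.
  have [sE|sn] := eqVneq s' s.
    by have -> : q' = q by [rewrite /q' /q sE]; rewrite sE !subrr mul0r.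
  have s'0 : s < s' by rewrite lt_neqAle eq_sym sn.
  have Y1 : 0 < s' * q + s * q' by nra.
  have Y2 : s' * q + s * q' <= 2 * (s' + s) by nra.
  rewrite leNgt; apply/negP => h.
  have : (s' * q - s * q') * (s' * q + s * q') < (s' - s) / 2 * (s' * q + s * q').
    by rewrite ltr_pM2r.
  nra.
have qq1 : q * q' <= 4 by nra.
nra.
Qed.

Lemma other_radius_gap (t0 t1 m s0 e b r w w' rho rho' : R) (f1 f2 u2 : R -> R) :
  1 <= t0 -> t1 <= 2 -> 0 < m -> slope_on t0 t1 f2 u2 ->
  (forall x, t0 <= x <= t1 -> m <= u2 x) ->
  0 <= b -> t0 <= r <= t1 -> t0 <= rho <= t1 -> t0 <= rho' <= t1 ->
  rho ^+ 2 = r ^+ 2 + b ^+ 2 - 2 * b * r * w ->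
  rho' ^+ 2 = r ^+ 2 + b ^+ 2 - 2 * b * r * w' ->
  `|f1 r - s0 - f2 rho| <= e -> `|f1 r - s0 - f2 rho'| <= e ->
  m * b * (w' - w) <= 4 * e.
Proof.
move=> t01 t12 m0 sf um b0 /andP[r1 r2] /andP[p1 p2] /andP[p1' p2'] E E' he he'.
have e0 : 0 <= e by apply: le_trans he.
have mb0 : 0 <= m * b by apply: mulr_ge0; [exact: ltW|].
have [ww|ww] := leP w' w.
  have : 0 <= m * b * (w - w') by rewrite mulr_ge0// subr_ge0.
  clear - e0; lra.
have bw : 0 <= b * r * (w' - w).
  by rewrite !mulr_ge0 ?subr_ge0 ?(ltW ww)//; clear - t01 r1; lra.
have rho0 : 1 <= rho by exact: le_trans p1.
have rho0' : 1 <= rho' by exact: le_trans p1'.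
have rr : rho' <= rho.
  by rewrite leNgt; apply/negP => h; clear - bw E E' h rho0 rho0'; nra.
have h1 : m * (rho - rho') <= 2 * e.
  move: rr; rewrite le_eqVlt => /predU1P[->|rr].
    by rewrite subrr mulr0; clear - e0; lra.
  have [c /andP[c1 c2] ec] := slope_mvt sf p1' rr p2.
  have mc : m <= u2 c by apply: um; rewrite (le_trans p1' (ltW c1)) (le_trans (ltW c2)).
  have : m * (rho - rho') <= u2 c * (rho - rho') by rewrite ler_wpM2r// subr_ge0 ltW.
  rewrite -ec; move: he he'; rewrite !ler_norml => /andP[? ?] /andP[? ?].
  by clear m0 mb0 bw E E' c1 c2 mc t01 t12 r1 r2 p1 p2 p1' p2'; lra.
have h2 : m * (rho - rho') * (rho + rho') <= 2 * e * 4.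
  have q0 : 0 <= rho + rho' by clear - rho0 rho0'; lra.
  have q4 : rho + rho' <= 4 by clear - p2 p2' t12; lra.
  by apply: ler_pM => //; apply: mulr_ge0; [exact: ltW|rewrite subr_ge0].
have h3 : m * (rho - rho') * (rho + rho') = 2 * (m * b * (w' - w) * r).
  by transitivity (m * (rho ^+ 2 - rho' ^+ 2)); [ring|rewrite E E'; ring].
have : 0 <= m * b * (w' - w) * (r - 1).
  by rewrite !mulr_ge0 ?subr_ge0 ?(ltW ww) ?(ltW m0)//; exact: le_trans r1.
clear - h2 h3; lra.
Qed.

Lemma collinear_radius_gap (x r b s w rho : R) :
  0 <= b -> 1 <= r -> r <= 2 -> 1 <= x -> 1 <= rho ->
  1 - s ^+ 2 / 2 <= w -> w <= 1 -> x ^+ 2 = (r - b) ^+ 2 ->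
  rho ^+ 2 = r ^+ 2 + b ^+ 2 - 2 * b * r * w ->
  x <= rho /\ rho - x <= b * s ^+ 2.
Proof.
move=> b0 r1 r2 x1 rho1 ws w1 xE E.
have br0 : 0 <= b * r by apply: mulr_ge0 => //; apply: le_trans r1.
have e1 : (rho - x) * (rho + x) = 2 * (b * r * (1 - w)).
  by transitivity (rho ^+ 2 - x ^+ 2); [ring|rewrite E xE; ring].
have bw : 0 <= b * r * (1 - w) by apply: mulr_ge0; [|rewrite subr_ge0].
have xr : x <= rho.
  by rewrite leNgt; apply/negP => h; clear - h e1 bw x1 rho1; nra.
split=> //.
have h1 : 0 <= b * r * (s ^+ 2 / 2 - (1 - w)).
  by apply: mulr_ge0 => //; clear - ws; lra.
have h2 : 0 <= b * s ^+ 2 * (2 - r).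
  by apply: mulr_ge0; [rewrite mulr_ge0 ?sqr_ge0|rewrite subr_ge0].
have h3 : 0 <= (rho - x) * (rho + x - 2).
  by apply: mulr_ge0; [rewrite subr_ge0|clear - x1 rho1; lra].
clear - h1 h2 h3 e1; lra.
Qed.

Lemma width_defect_product (m M b s s' w w' e F : R) :
  0 < m -> 0 < M -> 0 <= b -> 0 <= s -> s <= s' -> 0 <= e ->
  (s' ^+ 2 - s ^+ 2) / 16 <= w - w' -> m * b * (w - w') <= 4 * e ->
  F <= e + M * (b * s ^+ 2) ->
  b * (s' - s) ^+ 2 * (F + 2 * e) <= (192 / m + 1024 * M / m ^+ 2) * e ^+ 2.
Proof.
move=> m0 M0 b0 s0 ss e0 wgap gap hF.
set d := s' - s; have d0 : 0 <= d by rewrite /d subr_ge0.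
have mb0 : 0 <= m * b by apply: mulr_ge0; [exact: ltW|].
have prod : m * b * (d * (s' + s)) <= 64 * e.
  have := ler_wpM2l mb0 wgap; rewrite /d; clear - gap; lra.
have dd : m * b * d ^+ 2 <= 64 * e.
  have h : m * b * d ^+ 2 <= m * b * (d * (s' + s)).
    by rewrite ler_wpM2l// expr2 ler_wpM2l// /d; clear - s0; lra.
  exact: le_trans h prod.
have ds : m * (b * (d * s)) <= 32 * e.
  have : m * b * (d * (2 * s)) <= m * b * (d * (s' + s)).
    by rewrite !ler_wpM2l//; clear - ss; lra.
  clear - prod; lra.
have ds0 : 0 <= m * (b * (d * s)) by rewrite !mulr_ge0// ltW.
have h1 : b * d ^+ 2 * (3 * e) <= 192 / m * e ^+ 2.
  have -> : b * d ^+ 2 * (3 * e) = m * b * d ^+ 2 * (3 * e / m).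
    by clear - m0; field; rewrite gt_eqF.
  have -> : 192 / m * e ^+ 2 = 64 * e * (3 * e / m) by clear - m0; field; rewrite gt_eqF.
  by apply: ler_wpM2r dd; apply: divr_ge0; [rewrite mulr_ge0|exact: ltW].
have h2 : b * d ^+ 2 * (M * (b * s ^+ 2)) <= 1024 * M / m ^+ 2 * e ^+ 2.
  have -> : b * d ^+ 2 * (M * (b * s ^+ 2)) = (m * (b * (d * s))) ^+ 2 * (M / m ^+ 2).
    by clear - m0; field; rewrite gt_eqF.
  have -> : 1024 * M / m ^+ 2 * e ^+ 2 = (32 * e) ^+ 2 * (M / m ^+ 2).
    by clear - m0; field; rewrite gt_eqF.
  apply: ler_wpM2r; first by apply: divr_ge0; [exact: ltW|exact: sqr_ge0].
  by apply: lerXn2r ds; rewrite nnegrE// mulr_ge0.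
have h3 : b * d ^+ 2 * (F + 2 * e) <= b * d ^+ 2 * (3 * e + M * (b * s ^+ 2)).
  by rewrite ler_wpM2l ?mulr_ge0 ?sqr_ge0//; clear - hF; lra.
clear - h1 h2 h3; lra.
Qed.

(* [F = f1 r - s0 - f2 |r - b|] is the defect at the end of the circle where the
   two radii are collinear; it controls the angular width [s' - s]. *)
Lemma collinear_defect (t0 t1 m M s0 e b r s s' x rho rho' : R) (f1 f2 u2 : R -> R) :
  1 <= t0 -> t1 <= 2 -> 0 < m -> slope_on t0 t1 f2 u2 ->
  (forall y, t0 <= y <= t1 -> m <= u2 y <= M) ->
  0 <= b -> t0 <= r <= t1 -> t0 <= rho <= t1 -> t0 <= rho' <= t1 ->
  0 <= s -> s <= s' -> s' <= 1 -> t0 <= x -> x ^+ 2 = (r - b) ^+ 2 ->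
  rho ^+ 2 = r ^+ 2 + b ^+ 2 - 2 * b * r * (Num.sqrt (1 + s ^+ 2))^-1 ->
  rho' ^+ 2 = r ^+ 2 + b ^+ 2 - 2 * b * r * (Num.sqrt (1 + s' ^+ 2))^-1 ->
  `|f1 r - s0 - f2 rho| <= e -> `|f1 r - s0 - f2 rho'| <= e ->
  [/\ x <= t1, - e <= f1 r - s0 - f2 x &
    b * (s' - s) ^+ 2 * (f1 r - s0 - f2 x + 2 * e)
      <= (192 / m + 1024 * M / m ^+ 2) * e ^+ 2].
Proof.
move=> t01 t12 m0 sf umM b0 hr hrho hrho' s00 ss s1 tx xE E E' he he'.
have um y : t0 <= y <= t1 -> m <= u2 y by move=> /umM /andP[].
have e0 : 0 <= e by apply: le_trans he.
have M0 : 0 < M by have /umM/andP[h1 h2] := hr; exact: lt_le_trans (le_trans h1 h2).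
have wgap := inv_sqrt_gap s00 ss s1.
have gap := other_radius_gap t01 t12 m0 sf um b0 hr hrho' hrho E' E he' he.
have s01 : 0 <= s <= 1 by rewrite s00 (le_trans ss).
have /andP[v1 v2] := inv_sqrt_ge s01.
have /andP[r1 r2] := hr; have /andP[p1 p2] := hrho.
have [xr rx] := collinear_radius_gap b0 (le_trans t01 r1) (le_trans r2 t12)
  (le_trans t01 tx) (le_trans t01 p1) v1 v2 xE E.
have [d1 d2] : 0 <= f2 rho - f2 x /\ f2 rho - f2 x <= M * (rho - x).
  move: xr; rewrite le_eqVlt => /predU1P[->|xr]; first by rewrite !subrr mulr0.
  have [c /andP[c1 c2] ->] := slope_mvt sf tx xr p2.
  have /umM /andP[h1 h2] : t0 <= c <= t1.
    by rewrite (le_trans tx (ltW c1)) (le_trans (ltW c2) p2).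
  have rx0 : 0 <= rho - x by rewrite subr_ge0 ltW.
  by split; [apply: mulr_ge0 => //; exact: le_trans (ltW m0) h1|exact: ler_wpM2r].
move: he; rewrite ler_norml => /andP[he1 he2].
split; [exact: le_trans xr p2|clear - he1 d1; lra|].
apply: (width_defect_product m0 M0 b0 s00 ss e0 wgap gap).
have := ler_wpM2l (ltW M0) rx; clear - he2 d2; lra.
Qed.

End Angular.

Section Strips.
Context {R : realType}.
Implicit Types P : set (R * R).

Lemma lambda_xsection_le P (r D : R) : 0 <= D ->
  (forall s s', P (r, s) -> P (r, s') -> s <= s' -> s' - s <= D) ->
  (lambda (xsection P r) <= (2 * D)%:E)%E.
Proof.
move=> D0 PD; apply: lambda_diam => // s s'; rewrite /xsection/= !inE.
exact: PD.
Qed.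

Lemma derive_sqrt_affine (k c x : R) : 0 < k * x + c ->
  is_derive x 1 (fun x => Num.sqrt (k * x + c)) (k / (2 * Num.sqrt (k * x + c))).
Proof.
move=> h; have d1 := is_derive1_sqrt h.
have d2 : is_derive x 1 (fun x : R => k * x + c) k.
  by apply: is_derive_eq; rewrite addr0 /GRing.scale/= mulr1.
have := @is_derive1_comp R Num.sqrt (fun x => k * x + c) x _ _ d1 d2.
by rewrite mulrC.
Qed.

Lemma derive_ln_affine (k c x : R) : 0 < k * x + c ->
  is_derive x 1 (fun x => ln (k * x + c)) (k / (k * x + c)).
Proof.
move=> h; have d1 := is_derive1_ln h.
have d2 : is_derive x 1 (fun x : R => k * x + c) k.
  by apply: is_derive_eq; rewrite addr0 /GRing.scale/= mulr1.
have := @is_derive1_comp R (@ln R) (fun x => k * x + c) x _ _ d1 d2.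
by rewrite mulrC.
Qed.

Lemma continuous_affine (k c : R) : continuous (fun x : R => k * x + c).
Proof.
move=> x; apply: continuousD; last exact: cst_continuous.
by apply: continuousM; [exact: cst_continuous|exact: cvg_id].
Qed.

Lemma continuous_inv_sqrt_affine (A k c x : R) : 0 < k * x + c ->
  {for x, continuous (fun x => A / Num.sqrt (k * x + c))}.
Proof.
move=> h; apply: continuousM; first exact: cst_continuous.
apply: cvgV; first by rewrite gt_eqF// sqrtr_gt0.
have := @continuous_comp _ _ _ (fun x : R => k * x + c) (@Num.sqrt R) x.
by apply; [exact: continuous_affine|exact: sqrt_continuous].
Qed.

Lemma continuous_inv_affine (A k c x : R) : 0 < k * x + c ->
  {for x, continuous (fun x => A / (k * x + c))}.
Proof.
move=> h; apply: continuousM; first exact: cst_continuous.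
by apply: cvgV; [rewrite gt_eqF|exact: continuous_affine].
Qed.

Lemma le_sqrt_of_sqr (d x : R) : 0 <= d -> d ^+ 2 <= x -> d <= Num.sqrt x.
Proof. by move=> d0 dx; rewrite -(ger0_norm d0) -sqrtr_sqr ler_wsqrtr. Qed.

Lemma sqrtrD_le (x y : R) : 0 <= x -> 0 <= y ->
  Num.sqrt (x + y) <= Num.sqrt x + Num.sqrt y.
Proof.
move=> x0 y0; have xs := sqrtr_ge0 x; have ys := sqrtr_ge0 y.
rewrite -[leRHS]ger0_norm ?addr_ge0// -sqrtr_sqr ler_wsqrtr//.
rewrite sqrrD !sqr_sqrtr//.
have : 0 <= Num.sqrt x * Num.sqrt y by rewrite mulr_ge0.
by rewrite -mulr_natr; lra.
Qed.

Lemma sqr_gap_below (T c q r r1 : R) : 0 <= T -> c <= r -> r <= r1 -> r1 <= q ->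
  T / 2 * ((q - c) * (q - r)) - T * (q - c) * (q - r1)
    <= T / 2 * ((r1 - c) ^+ 2 - (r - c) ^+ 2).
Proof.
move=> T0 cr rr rq.
have [h1 h2 h3] : [/\ 0 <= r - c, 0 <= r1 - r & 0 <= q - r1] by rewrite !subr_ge0.
have h4 : 0 <= r1 - c by rewrite subr_ge0 (le_trans cr).
have k1 : 0 <= T * ((q - r1) * (q - r1)) by rewrite !mulr_ge0.
have k2 : 0 <= T * ((q - r1) * (r1 - c)) by rewrite !mulr_ge0.
have k3 : 0 <= T * ((r1 - r) * (r - c)) by rewrite !mulr_ge0.
have k4 : 0 <= T * ((q - r1) * (r - c)) by rewrite !mulr_ge0.
clear - k1 k2 k3 k4; lra.
Qed.

Lemma sqr_gap_above (T c q r r1 : R) : 0 <= T -> c <= r1 -> r1 <= r ->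
  T / 2 * (r - q) ^+ 2 - T * (r - q) * (r1 - q)
    <= T / 2 * ((r - c) ^+ 2 - (r1 - c) ^+ 2).
Proof.
move=> T0 cr rr.
have [h1 h2] : 0 <= r1 - c /\ 0 <= r - r1 by rewrite !subr_ge0.
have k1 : 0 <= T * ((r - r1) * (r1 - c)) by rewrite !mulr_ge0.
have k2 : 0 <= T * ((r1 - q) * (r1 - q)) by rewrite mulr_ge0 // -expr2 sqr_ge0.
clear - k1 k2; lra.
Qed.

(* Here [e - f r] vanishes at most linearly in the distance to the right end
   [q] of the strip, and at rate at least [T (q - c)], so the integral of
   [1 / sqrt ((q - c) (q - r))] over [c, q] is bounded uniformly. *)
Lemma strip_below_right P (b c T beta e C0 : R) (f : R -> R) :
  0 < T -> 0 < beta -> 0 < e -> 0 <= C0 ->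
  (forall x y, c <= x -> x <= y -> y <= b ->
     T / 2 * ((y - c) ^+ 2 - (x - c) ^+ 2) <= f y - f x) ->
  (forall z, P z -> c <= z.1 <= b /\ f z.1 <= e) ->
  (forall r s s', P (r, s) -> P (r, s') -> s <= s' ->
     beta * (s' - s) ^+ 2 * (2 * e - f r) <= C0 * e ^+ 2) ->
  (lambda2 P <= (4 * Num.sqrt (2 * C0 / (beta * T)) * e)%:E)%E.
Proof.
move=> T0 be0 e0 C00 fT Pf Pd.
have rhs0 : 0 <= 4 * Num.sqrt (2 * C0 / (beta * T)) * e by rewrite !mulr_ge0 ?sqrtr_ge0 ?ltW.
pose S := [set r | exists s, P (r, s)].
have [SE|/set0P[r0 Sr0]] := eqVneq S set0.
  have -> : P = set0.
    apply/seteqP; split => // -[r s] Prs; have : S r by exists s.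
    by rewrite SE.
  by rewrite measure0 lee_fin.
have Sb r : S r -> c <= r <= b /\ f r <= e by move=> [s /Pf].
have hS : has_sup S by split; [exists r0|by exists b => r /Sb [/andP[]]].
pose q := sup S.
have Sq r : S r -> r <= q by move=> Sr; apply: ub_le_sup => //; exact: hS.2.
have cq : c <= q by have [/andP[h _] _] := Sb _ Sr0; exact: le_trans h (Sq _ Sr0).
pose L := q - c.
have decay r : S r -> e + T / 2 * (L * (q - r)) <= 2 * e - f r.
  move=> Sr; have [/andP[cr rb] fre] := Sb _ Sr; have rq := Sq _ Sr.
  move: (cq); rewrite le_eqVlt => /predU1P[cq0|cq1].
    by rewrite /L cq0 subrr mul0r mulr0; clear - fre; lra.
  have L0 : 0 < L by rewrite subr_gt0.
  have TL : 0 < T * L by rewrite mulr_gt0.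
  have TL2 : T / 2 * (L * (q - r)) = T * L * (q - r) / 2 by ring.
  rewrite -lerBrDl; apply/ler_addgt0Pr => h h0.
  have e1 : 0 < h / (T * L) by rewrite divr_gt0.
  have [r1 Sr1 r1q] := sup_adherent e1 hS; rewrite -/q in r1q.
  have [/andP[cr1 r1b] fr1e] := Sb _ Sr1; have r1q' := Sq _ Sr1.
  have close : T * L * (q - r1) <= h.
    by rewrite mulrC -ler_pdivlMr// lerBlDl -lerBlDr ltW.
  have [r1r|rr1] := leP r1 r.
    have h1 : T * L * (q - r) <= T * L * (q - r1) by rewrite ler_wpM2l ?(ltW TL) ?lerD2l ?lerN2.
    have h2 : 0 <= T * L * (q - r) by rewrite mulr_ge0 ?(ltW TL) ?subr_ge0.
    rewrite TL2; clear - h1 h2 close fre; lra.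
  have h1 := fT r r1 cr (ltW rr1) r1b.
  have h2 := sqr_gap_below (ltW T0) cr (ltW rr1) r1q'.
  rewrite -/L in h2; clear - h1 h2 close fr1e; lra.
have Pcq z : P z -> c <= z.1 <= q.
  case: z => r s Prs; have Sr : S r by exists s.
  by have [/andP[h _] _] := Sb _ Sr; rewrite /= h Sq.
have Pw r s s' : P (r, s) -> P (r, s') -> s <= s' ->
    s' - s <= Num.sqrt (C0 * e ^+ 2 / (beta * (e + T / 2 * (L * (q - r))))).
  move=> Ps Ps' ss; have Sr : S r by exists s.
  have rq := Sq _ Sr; have dr := decay _ Sr.
  have w0 : 0 < beta * (e + T / 2 * (L * (q - r))).
    by rewrite mulr_gt0// ltr_wpDr// !mulr_ge0 ?subr_ge0// ltW.
  apply: le_sqrt_of_sqr; first by rewrite subr_ge0.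
  rewrite ler_pdivlMr//; apply: le_trans (Pd _ _ _ Ps Ps' ss).
  rewrite mulrCA mulrA; apply: ler_wpM2l dr.
  by rewrite mulr_ge0 ?sqr_ge0// ltW.
move: (cq); rewrite le_eqVlt => /predU1P[cq0|cq1].
  have := @lambda2_le_const R P c q (2 * Num.sqrt (C0 * e ^+ 2 / (beta * e))) cq Pcq.
  rewrite {2}cq0 subrr mulr0 => h; apply: (le_trans (h _)); last by rewrite lee_fin.
  move=> r hr; apply: lambda_xsection_le; first exact: sqrtr_ge0.
  by move=> s s' Ps Ps' ss; have := Pw _ _ _ Ps Ps' ss; rewrite /L cq0 subrr mul0r mulr0 addr0.
have L0 : 0 < L by rewrite subr_gt0.
have TL : 0 < T * L by rewrite mulr_gt0.
pose A := Num.sqrt (2 * C0 / (beta * (T * L))) * e.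
pose ep := 2 * e / (T * L).
have ep0 : 0 < ep by rewrite divr_gt0// mulr_gt0.
have pos x : c <= x <= q -> 0 < -1 * x + (q + ep).
  by move=> /andP[_ hx]; clear - hx ep0; lra.
have := @lambda2_le_primitive R P c q (fun r => 2 * A / Num.sqrt (-1 * r + (q + ep)))
  (fun r => - 4 * A * Num.sqrt (-1 * r + (q + ep))) cq Pcq.
move=> h; apply: (le_trans (h _ _ _)).
- move=> r hr; rewrite -mulrA; apply: lambda_xsection_le.
    by rewrite divr_ge0 ?sqrtr_ge0// mulr_ge0 ?sqrtr_ge0// ltW.
  move=> s s' Ps Ps' ss; apply: (le_trans (Pw _ _ _ Ps Ps' ss)).
  have p0 := pos _ hr.
  rewrite -[leRHS]ger0_norm; last by rewrite divr_ge0 ?sqrtr_ge0// mulr_ge0 ?sqrtr_ge0// ltW.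
  rewrite -sqrtr_sqr ler_wsqrtr// exprMn exprVn sqr_sqrtr; last exact: ltW.
  rewrite exprMn sqr_sqrtr; last by rewrite divr_ge0 ?mulr_ge0// ltW// mulr_gt0.
  have w1 : e + T / 2 * (L * (q - r)) = (T * L) / 2 * (-1 * r + (q + ep)).
    by rewrite /ep; clear - L0 T0; clearbody L; field; rewrite (lt0r_neq0 L0) (lt0r_neq0 T0).
  rewrite w1 le_eqVlt; apply/orP; left; apply/eqP.
  clear - L0 T0 be0 p0; clearbody L; set p := _ + _ in p0 *; clearbody p; field.
  by rewrite (lt0r_neq0 L0) (lt0r_neq0 T0) (lt0r_neq0 be0) (lt0r_neq0 p0).
- move=> r /pos p0.
  apply: is_derive_eq (is_deriveZ (- 4 * A) (derive_sqrt_affine p0)) _.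
  rewrite /GRing.scale /=; move: p0; rewrite -sqrtr_gt0; set p := Num.sqrt _ => p0.
  by clear - p0; clearbody p A; field; rewrite gt_eqF.
- by move=> r /pos p0; exact: continuous_inv_sqrt_affine.
rewrite lee_fin.
have -> : -1 * q + (q + ep) = ep by clearbody ep; ring.
have -> : -1 * c + (q + ep) = L + ep by rewrite /L; clearbody ep; ring.
have AL : A * Num.sqrt L = Num.sqrt (2 * C0 / (beta * T)) * e.
  rewrite /A mulrAC -sqrtrM; last by rewrite divr_ge0 ?mulr_ge0// ltW// mulr_gt0.
  congr (Num.sqrt _ * _); clear - L0 T0 be0; clearbody L; field.
  by rewrite (lt0r_neq0 L0) (lt0r_neq0 T0) (lt0r_neq0 be0).
have A0 : 0 <= A by rewrite mulr_ge0 ?sqrtr_ge0// ltW.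
have := ler_wpM2l A0 (sqrtrD_le (ltW L0) (ltW ep0)).
rewrite mulrDr AL; set B := Num.sqrt (2 * C0 / (beta * T)) * e.
rewrite (_ : 4 * _ * e = 4 * B); last by rewrite /B mulrA.
by clear; lra.
Qed.

(* Here [e + f] is bounded below by [e + T (r - q)^2 / 2], with [q] the left end
   of the strip, whence the logarithm. *)
Lemma strip_above_right P (b c T beta e C0 : R) (f : R -> R) :
  0 < T -> 0 < beta -> 0 < e -> 0 <= C0 -> b - c <= 1 ->
  (forall x y, c <= x -> x <= y -> y <= b ->
     T / 2 * ((y - c) ^+ 2 - (x - c) ^+ 2) <= f y - f x) ->
  (forall z, P z -> c <= z.1 <= b /\ - e <= f z.1) ->
  (forall r s s', P (r, s) -> P (r, s') -> s <= s' ->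
     beta * (s' - s) ^+ 2 * (f r + 2 * e) <= C0 * e ^+ 2) ->
  (lambda2 P <= (4 * Num.sqrt (C0 / (beta * T)) * e
                 * ln (1 + Num.sqrt (T / (2 * e))))%:E)%E.
Proof.
move=> T0 be0 e0 C00 bc1 fT Pf Pd.
have sTe : 0 <= Num.sqrt (T / (2 * e)) by exact: sqrtr_ge0.
have rhs0 : 0 <= 4 * Num.sqrt (C0 / (beta * T)) * e * ln (1 + Num.sqrt (T / (2 * e))).
  apply: mulr_ge0; last by rewrite ln_ge0 ?lerDl.
  by rewrite !mulr_ge0 ?sqrtr_ge0 ?ltW.
pose S := [set r | exists s, P (r, s)].
have [SE|/set0P[r0 Sr0]] := eqVneq S set0.
  have -> : P = set0.
    apply/seteqP; split => // -[r s] Prs; have : S r by exists s.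
    by rewrite SE.
  by rewrite measure0 lee_fin.
have Sb r : S r -> c <= r <= b /\ - e <= f r by move=> [s /Pf].
have hS : has_inf S by split; [exists r0|by exists c => r /Sb [/andP[]]].
pose q := inf S.
have Sq r : S r -> q <= r by move=> Sr; apply: ge_inf => //; exact: hS.2.
have cq : c <= q by by apply: lb_le_inf; [exists r0|move=> r /Sb [/andP[]]].
have qb : q <= b by have [/andP[_ h] _] := Sb _ Sr0; exact: le_trans (Sq _ Sr0) h.
have growth r : S r -> e + T / 2 * (r - q) ^+ 2 <= f r + 2 * e.
  move=> Sr; have [/andP[cr rb] fre] := Sb _ Sr; have rq := Sq _ Sr.
  move: (rq); rewrite le_eqVlt => /predU1P[->|rq1].
    by rewrite subrr expr0n mulr0; clear - fre; lra.
  have Tr : 0 < T * (r - q) by rewrite mulr_gt0// subr_gt0.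
  rewrite -lerBrDl; apply/ler_addgt0Pr => h h0.
  have e1 : 0 < h / (T * (r - q)) by rewrite divr_gt0.
  have [r1 Sr1 r1q] := inf_adherent e1 hS; rewrite -/q in r1q.
  have [/andP[cr1 r1b] fr1e] := Sb _ Sr1.
  have close : T * (r - q) * (r1 - q) <= h.
    by rewrite mulrC -ler_pdivlMr// lerBlDl ltW.
  have [rr1|r1r] := leP r r1.
    have h1 : T * (r - q) * (r - q) <= T * (r - q) * (r1 - q).
      by rewrite ler_wpM2l ?(ltW Tr) ?lerD2r.
    have h2 : 0 <= T * (r - q) * (r - q) by rewrite mulr_ge0 ?(ltW Tr) ?subr_ge0.
    clear - h1 h2 close fre; lra.
  have h1 := fT r1 r cr1 (ltW r1r) rb.
  have h2 := sqr_gap_above q (ltW T0) cr1 (ltW r1r).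
  clear - h1 h2 close fr1e; lra.
have Pqb z : P z -> q <= z.1 <= b.
  case: z => r s Prs; have Sr : S r by exists s.
  by have [/andP[_ h] _] := Sb _ Sr; rewrite /= h Sq.
pose se := Num.sqrt e; pose sT := Num.sqrt (T / 2).
have se0 : 0 < se by rewrite sqrtr_gt0.
have sT0 : 0 < sT by rewrite sqrtr_gt0 divr_gt0.
have seE : se ^+ 2 = e by rewrite sqr_sqrtr// ltW.
have sTE : sT ^+ 2 = T / 2 by rewrite sqr_sqrtr// ltW// divr_gt0.
have pos x : q <= x <= b -> 0 < sT * x + (se - sT * q).
  move=> /andP[qx _]; have : 0 <= sT * (x - q) by rewrite mulr_ge0 ?(ltW sT0)// subr_ge0.
  by clear - se0; lra.
pose A := Num.sqrt (2 * C0 / beta) * e.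
have A0 : 0 <= A by rewrite mulr_ge0 ?sqrtr_ge0// ltW.
have A2 : A ^+ 2 = 2 * C0 / beta * e ^+ 2.
  by rewrite exprMn sqr_sqrtr// divr_ge0 ?mulr_ge0// ltW.
have := @lambda2_le_primitive R P q b (fun r => 2 * A / (sT * r + (se - sT * q)))
  (fun r => 2 * A / sT * ln (sT * r + (se - sT * q))) qb Pqb.
move=> h; apply: (le_trans (h _ _ _)).
- move=> r hr; rewrite -mulrA; have p0 := pos _ hr; apply: lambda_xsection_le.
    by rewrite divr_ge0// ltW.
  move=> s s' Ps Ps' ss; have Sr : S r by exists s.
  rewrite ler_pdivlMr// -(ler_pXn2r (ltn0Sn 1)) ?nnegrE//; last first.
    by apply: mulr_ge0; [rewrite subr_ge0|exact: ltW].
  rewrite A2 exprMn.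
  have g := growth _ Sr; have d := Pd _ _ _ Ps Ps' ss.
  have X2 : (sT * r + (se - sT * q)) ^+ 2 <= 2 * (f r + 2 * e).
    have : (sT * r + (se - sT * q)) ^+ 2 <= 2 * (se ^+ 2 + sT ^+ 2 * (r - q) ^+ 2).
      by have := sqr_ge0 (se - sT * (r - q)); clear; lra.
    rewrite seE sTE; clear - g; lra.
  rewrite (_ : 2 * C0 / beta * e ^+ 2 = 2 * (C0 * e ^+ 2) / beta); last by rewrite mulrAC [2 * (C0 * _)]mulrA.
  rewrite ler_pdivlMr//.
  have : (s' - s) ^+ 2 * beta * (sT * r + (se - sT * q)) ^+ 2 <= (s' - s) ^+ 2 * beta * (2 * (f r + 2 * e)).
    by rewrite ler_wpM2l// mulr_ge0 ?sqr_ge0// ltW.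
  clear - d; lra.
- move=> r /pos p0.
  apply: is_derive_eq (is_deriveZ (2 * A / sT) (derive_ln_affine p0)) _.
  rewrite /GRing.scale /=; clear - sT0 p0; set p := _ + _ in p0 *; clearbody p sT A; field.
  by rewrite (lt0r_neq0 sT0) (lt0r_neq0 p0).
- by move=> r /pos p0; exact: continuous_inv_affine.
rewrite lee_fin.
have -> : sT * q + (se - sT * q) = se by rewrite addrCA subrr addr0.
have AT : 2 * A / sT = 4 * Num.sqrt (C0 / (beta * T)) * e.
  have CbT : 0 <= C0 / (beta * T) by rewrite divr_ge0// ltW// mulr_gt0.
  have -> : A = 2 * Num.sqrt (C0 / (beta * T)) * sT * e.
    apply/eqP; rewrite -(eqrXn2 (ltn0Sn 1))//; last first.
      by rewrite !mulr_ge0 ?sqrtr_ge0// ltW.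
    rewrite A2 !exprMn sTE sqr_sqrtr//; apply/eqP.
    clear - T0 be0; field.
    by rewrite (lt0r_neq0 T0) (lt0r_neq0 be0).
  by clear - sT0; clearbody sT; field; rewrite (lt0r_neq0 sT0).
rewrite -mulrBr AT; apply: ler_wpM2l; first by rewrite !mulr_ge0 ?sqrtr_ge0 ?ltW.
have pb : 0 < sT * b + (se - sT * q) by apply: pos; rewrite qb lexx.
rewrite -ln_div ?posrE// ler_ln ?posrE; [|by rewrite divr_gt0|exact: ltr_wpDr].
rewrite ler_pdivrMr// mulrDl mul1r.
have -> : Num.sqrt (T / (2 * e)) * se = sT.
  rewrite /se /sT -sqrtrM ?divr_ge0 ?mulr_ge0 ?ltW//; congr Num.sqrt.
  by clear - e0; field; rewrite (lt0r_neq0 e0).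
have : sT * (b - q) <= sT * 1.
  by apply: ler_wpM2l (ltW sT0) _ _ _; apply: le_trans bc1; rewrite lerD2l lerN2.
by clear; lra.
Qed.

End Strips.

Section Cores.
Context {R : realType}.
Implicit Types P Q : set (R * R).

Lemma lambda2U P Q : measurable P -> measurable Q ->
  (lambda2 (P `|` Q) <= lambda2 P + lambda2 Q)%E.
Proof.
move=> mP mQ.
pose mu : {measure set (measurableTypeR R * measurableTypeR R) -> \bar R} := lambda2.
exact: (@measureU2 _ _ _ mu).
Qed.

Lemma le_lambda2 P Q : P `<=` Q -> (lambda2 P <= lambda2 Q)%E.
Proof.
move=> PQ; apply: le_integral_ge0 => x; first exact: measure_ge0.
by apply: le_lambda => y; rewrite /xsection/= !inE; exact: PQ.
Qed.

Lemma lambda2_fold P (c X : R) : measurable P -> 0 <= X ->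
  (lambda2 [set z | P z /\ (c <= z.1)%R] <= X%:E)%E ->
  (lambda2 [set z | P ((- z.1)%R, z.2) /\ (- c <= z.1)%R] <= X%:E)%E ->
  (lambda2 P <= (2 * X)%:E)%E.
Proof.
move=> mP X0 h1 h2.
have mge (k : R -> R) (d : R) : measurable_fun setT k ->
    measurable [set z : R * R | d <= k z.1].
  move=> mk; have := measurableT_comp mk (@measurable_fst _ _ R R).
  move=> /(_ measurableT `[d, +oo[%classic (measurable_itv _)).
  by congr measurable; apply/seteqP; split => z; rewrite /= in_itv/= andbT => // -[].
have mR : measurable (P `&` [set z | c <= z.1]) by apply: measurableI => //; exact: (mge id).
have mL : measurable (P `&` [set z | - c <= - z.1]).
  by apply: measurableI => //; apply: (mge (fun x => - x)); exact: measurable_funN.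
have -> : P = (P `&` [set z | c <= z.1]) `|` (P `&` [set z | - c <= - z.1]).
  apply/seteqP; split => [z Pz|z [[]|[]]//].
  by case: (lerP c z.1) => h; [left|right; split => //=; rewrite lerN2 ltW].
apply: le_trans (lambda2U mR mL) _.
rewrite mulr2n mulrDl mul1r EFinD; apply: leeD; first exact: h1.
have := @lambda2_fiber_snd R _ (fun=> -1) (fun=> 0) 1 mL.
move=> h; apply: (le_trans (h _ _ _ _)) => //.
  by move=> _ _; rewrite normrN1 lexx oppr_eq0 oner_eq0.
rewrite mul1e; apply: le_trans h2; rewrite le_eqVlt; apply/orP; left; apply/eqP.
congr (lambda2 _); apply/seteqP; split => z /=; by rewrite mulN1r addr0 opprK.
Qed.

Definition strip_bound (ell : bool) (C0 beta T e : R) : R :=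
  if ell then 8 * Num.sqrt (2 * C0 / (beta * T)) * e
  else 8 * Num.sqrt (C0 / (beta * T)) * e * ln (1 + Num.sqrt (T / (2 * e))).

Lemma strip_bound_ge0 ell (C0 beta T e : R) : 0 <= e -> 0 <= strip_bound ell C0 beta T e.
Proof.
move=> e0; rewrite /strip_bound; case: ell; first by rewrite !mulr_ge0 ?sqrtr_ge0.
by rewrite !mulr_ge0 ?sqrtr_ge0// ln_ge0 ?lerDl ?sqrtr_ge0.
Qed.

Lemma strip_le ell P (a b c T beta e C0 : R) (F : R -> R) : measurable P ->
  0 < T -> 0 < beta -> 0 < e -> 0 <= C0 -> b - a <= 1 ->
  strongly_quasiconvex a b c T (fun r => if ell then - F r else F r) ->
  (forall z, P z -> a <= z.1 <= b /\ - e <= F z.1) ->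
  (forall r s s', P (r, s) -> P (r, s') -> s <= s' ->
     beta * (s' - s) ^+ 2 * (F r + 2 * e) <= C0 * e ^+ 2) ->
  (lambda2 P <= (strip_bound ell C0 beta T e)%:E)%E.
Proof.
move=> mP T0 be0 e0 C00 ab1 [cab hr hl] PF Pd.
have hl' x y : - c <= x -> x <= y -> y <= - a ->
   T / 2 * ((y - - c) ^+ 2 - (x - - c) ^+ 2) <=
   (if ell then - F (- y) else F (- y)) - (if ell then - F (- x) else F (- x)).
  move=> cx xy ya; have := hl (- y) (- x) ltac:(lra) ltac:(lra) ltac:(lra).
  by rewrite !opprK [c + y]addrC [c + x]addrC.
case: ell hr hl hl' => hr hl hl'.
- have -> : strip_bound true C0 beta T e = 2 * (4 * Num.sqrt (2 * C0 / (beta * T)) * e).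
    by rewrite /strip_bound; ring.
  apply: (@lambda2_fold P c) => //; first by rewrite !mulr_ge0 ?sqrtr_ge0 ?ltW.
    apply: (@strip_below_right R _ b c T beta e C0 (fun r => - F r)) => //.
      by move=> z [/PF [h1 h2] h3]; split; lra.
    by move=> r s s' [Ps _] [Ps' _] ss; have := Pd _ _ _ Ps Ps' ss; rewrite opprK [2 * e + _]addrC.
  apply: (@strip_below_right R _ (- a) (- c) T beta e C0 (fun r => - F (- r))) => //.
    by move=> z [/PF [/= h1 h2] h3]; split; lra.
  by move=> r s s' [Ps _] [Ps' _] ss; have := Pd _ _ _ Ps Ps' ss; rewrite opprK [2 * e + _]addrC.
- have -> : strip_bound false C0 beta T e = 2 * (4 * Num.sqrt (C0 / (beta * T)) * e
      * ln (1 + Num.sqrt (T / (2 * e)))) by rewrite /strip_bound; ring.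
  apply: (@lambda2_fold P c) => //.
    apply: mulr_ge0; last by rewrite ln_ge0 ?lerDl ?sqrtr_ge0.
    by rewrite !mulr_ge0 ?sqrtr_ge0 ?ltW.
    apply: (@strip_above_right R _ b c T beta e C0 F) => //; first lra.
      by move=> z [/PF [h1 h2] h3]; split; lra.
    by move=> r s s' [Ps _] [Ps' _] ss; exact: Pd.
  apply: (@strip_above_right R _ (- a) (- c) T beta e C0 (fun r => F (- r))) => //; first lra.
    by move=> z [/PF [/= h1 h2] h3]; split; lra.
  by move=> r s s' [Ps _] [Ps' _] ss; exact: (Pd _ _ _ Ps Ps').
Qed.

Record curved_pair (ell : bool) (t0 t1 M m lam kap D : R)
    (f1 u1 v1 f2 u2 v2 : R -> R) : Prop := {
  cp_slope1 : slope_on t0 t1 f1 u1;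
  cp_slope1' : slope_on t0 t1 u1 v1;
  cp_slope2 : slope_on t0 t1 f2 u2;
  cp_slope2' : slope_on t0 t1 u2 v2;
  cp_bound1 : forall x, t0 <= x <= t1 -> m <= u1 x <= M;
  cp_bound2 : forall x, t0 <= x <= t1 -> m <= u2 x <= M;
  cp_lip2 : forall x y, t0 <= x <= t1 -> t0 <= y <= t1 ->
    `|u2 x - u2 y| <= M * `|x - y|;
  cp_sep : forall x, t0 <= x <= t1 -> lam * D <= `|u1 x - u2 x|;
  cp_gap : forall x, t0 <= x <= t1 -> `|v1 x - v2 x| <= M * D;
  cp_curv : forall x y, t0 <= x <= t1 -> t0 <= y <= t1 ->
    kap * (D + `|x - y|) <= `|u1 x - u2 y| + `|v1 x - v2 y|;
  cp_sign : forall x y, t0 <= x -> x < y -> y <= t1 ->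
    0 < (if ell then 1 else -1) *
      (((u1 y - u2 x) * (v1 x - v2 x) - (v1 y - v2 x) * (u1 x - u2 x))
       * (u1 x - u2 x)) }.

(* The sign condition says that [(u1 r - u2 (r - b)) / (u1 - u2)(r - b)] is
   monotone in [r]; the cinematic bound then makes the defect convex (or
   concave) wherever its slope is small. *)
Lemma outer_defect_quasiconvex ell (t0 t1 M m lam kap D b s0 T a : R)
    (f1 u1 v1 f2 u2 v2 : R -> R) :
  curved_pair ell t0 t1 M m lam kap D f1 u1 v1 f2 u2 v2 ->
  1 <= t0 -> t1 <= 2 -> 0 < lam -> 0 < D -> 0 < b -> 0 < T -> 0 < kap -> 0 < M ->
  T * (2 * lam + M) <= kap * lam * D ->
  t0 <= a -> t0 + b <= a -> a <= t1 ->
  exists c, strongly_quasiconvex a t1 c T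
    (fun r => if ell then - (f1 r - s0 - f2 (r - b)) else f1 r - s0 - f2 (r - b)).
Proof.
move=> cp t01 t12 lam0 D0 b0 T0 kap0 M0 TM ta tba at1.
have n1 : (1 : R) != 0 by exact: oner_neq0.
have rng x : a <= x <= t1 -> t0 <= 1 * x + - b <= t1 by move=> ?; lra.
have sF : slope_on a t1 (fun r => f1 r - s0 - f2 (r - b)) (fun r => u1 r - u2 (r - b)).
  have := slopeB (slopeB (slopeW ta (lexx _) (cp_slope1 cp)) (slope_cst a t1 s0))
     (slope_affine (cp_slope2 cp) n1 rng).
  by congr slope_on; apply/funext => x; rewrite ?mul1r ?subr0.
have sU : slope_on a t1 (fun r => u1 r - u2 (r - b)) (fun r => v1 r - v2 (r - b)).
  have := slopeB (slopeW ta (lexx _) (cp_slope1' cp)) (slope_affine (cp_slope2' cp) n1 rng).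
  by congr slope_on; apply/funext => x; rewrite ?mul1r.
have key (sg : R) z : sg = 1 \/ sg = -1 ->
    0 < sg * (((u1 z - u2 (z - b)) * (v1 (z - b) - v2 (z - b))
         - (v1 z - v2 (z - b)) * (u1 (z - b) - u2 (z - b)))
         * (u1 (z - b) - u2 (z - b))) ->
    t0 <= z - b <= t1 -> t0 <= z <= t1 ->
    `|u1 z - u2 (z - b)| < T -> T <= - sg * (v1 z - v2 (z - b)).
  move=> hsg hs hx hz hT.
  have sep := cp_sep cp hx; have gap := cp_gap cp hx.
  have curv := cp_curv cp hz hx.
  have : kap * D <= kap * (D + `|z - (z - b)|) by rewrite ler_wpM2l ?(ltW kap0)// lerDl.
  move: hs sep gap curv hT.
  set U := u1 z - u2 (z - b); set V := v1 z - v2 (z - b).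
  set du := u1 _ - u2 _; set dv := v1 _ - v2 _ => hs sep gap curv hT kD.
  have kDT : 2 * T <= kap * D.
    have : 0 <= T * M by rewrite mulr_ge0 ?ltW.
    have : 2 * lam * T + T * M <= kap * D * lam by move: TM; clear; lra.
    move=> h1 h2; have : lam * (2 * T) <= lam * (kap * D) by clear - h1 h2; lra.
    by rewrite ler_pM2l.
  have V1 : kap * D - T <= `|V| by clear - curv hT kD; lra.
  have sV : `|V| = `|- sg * V|.
    by case: hsg => ->; rewrite ?opprK ?mul1r ?mulN1r ?normrN.
  rewrite leNgt; apply/negP => hV.
  have Vn : - sg * V <= - (kap * D - T).
    by move: V1; rewrite sV; clear - hV kDT; case: (ger0P (- sg * V)) => ? ?; lra.
  have du0 : 0 < `|du| by exact: lt_le_trans (mulr_gt0 lam0 D0) sep.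
  have lower : (- sg * V) * `|du| ^+ 2 > - (T * (M * D) * `|du|).
    have -> : `|du| ^+ 2 = du * du by rewrite real_normK ?num_real// expr2.
    have : - sg * (U * dv * du) >= - (T * (M * D) * `|du|).
      have : `|- sg * (U * dv * du)| <= T * (M * D) * `|du|.
        have -> : `|- sg * (U * dv * du)| = `|U| * `|dv| * `|du|.
          by case: hsg => ->; rewrite !normrM ?opprK ?normrN ?normr1 ?mul1r.
        by rewrite ler_wpM2r// ler_pM// ltW.
      by rewrite ler_norml => /andP[].
    by move: hs; rewrite mulrBl mulrBr; clear; lra.
  have : (- sg * V) * `|du| > - (T * (M * D)).
    by rewrite -(ltr_pM2r du0); move: lower; clear; lra.
  have : (- sg * V) * `|du| <= - (kap * D - T) * (lam * D).
    have kD0 : 0 <= kap * D - T by clear - kDT T0; lra.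
    have : (kap * D - T) * (lam * D) <= (kap * D - T) * `|du| by rewrite ler_wpM2l.
    have : (- sg * V + (kap * D - T)) * `|du| <= 0.
      by rewrite pmulr_lle0//; clear - Vn; lra.
    by clear; lra.
  have : T * (2 * lam + M) * D <= kap * lam * D * D by rewrite ler_wpM2r// ltW.
  have : 0 < T * lam * D by rewrite !mulr_gt0.
  by clear; lra.
case: ell cp key => cp key.
- apply: strongly_quasiconvex_of_slopes (slopeN sF) (slopeN sU) at1 _ T0 _; first lra.
  move=> z hz; rewrite normrN => hT.
  have := key 1 z (or_introl erefl) (cp_sign cp _ _ _) _ _ hT.
  by rewrite mulN1r; apply; clear - hz ta tba b0; lra.
- apply: strongly_quasiconvex_of_slopes sF sU at1 _ T0 _; first lra.
  move=> z hz hT.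
  have := key (-1) z (or_intror erefl) (cp_sign cp _ _ _) _ _ hT.
  by rewrite opprK mul1r; apply; clear - hz ta tba b0; lra.
Qed.

Lemma inner_defect_quasiconvex ell (t0 t1 M m lam kap D b s0 T a a' : R)
    (f1 u1 v1 f2 u2 v2 : R -> R) :
  curved_pair ell t0 t1 M m lam kap D f1 u1 v1 f2 u2 v2 ->
  1 <= t0 -> t1 <= 2 -> 0 < T -> T <= 2 * m ->
  t0 <= a -> b - t1 <= a -> a <= a' -> a' <= t1 -> a' <= b - t0 ->
  exists c, strongly_quasiconvex a a' c T
    (fun r => if ell then - (f1 r - s0 - f2 (b - r)) else f1 r - s0 - f2 (b - r)).
Proof.
move=> cp t01 t12 T0 Tm ta bta aa at1 abt0.
have n1 : (-1 : R) != 0 by rewrite oppr_eq0 oner_neq0.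
have rng x : a <= x <= a' -> t0 <= -1 * x + b <= t1 by move=> ?; lra.
have sF : slope_on a a' (fun r => f1 r - s0 - f2 (b - r)) (fun r => u1 r + u2 (b - r)).
  have := slopeB (slopeB (slopeW ta at1 (cp_slope1 cp)) (slope_cst a a' s0))
     (slope_affine (cp_slope2 cp) n1 rng).
  by congr slope_on; apply/funext => x; rewrite ?mulN1r ?subr0 ?opprK ?[- x + b]addrC.
have sU : slope_on a a' (fun r => u1 r + u2 (b - r)) (fun r => v1 r - v2 (b - r)).
  have := slopeB (slopeW ta at1 (cp_slope1' cp)) (slopeN (slope_affine (cp_slope2' cp) n1 rng)).
  by congr slope_on; apply/funext => x; rewrite ?mulN1r ?opprK ?[- x + b]addrC.
have big z : a < z < a' -> T <= u1 z + u2 (b - z).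
  move=> hz; have /andP[h1 _] := cp_bound1 cp (x := z) ltac:(lra).
  by have /andP[h2 _] := cp_bound2 cp (x := b - z) ltac:(lra); lra.
case: ell cp => cp.
- apply: (strongly_quasiconvex_of_slopes (slopeN sF) (slopeN sU) aa _ T0 _); first lra.
  by move=> z /big h; rewrite normrN ger0_norm; [move=> ?|]; lra.
- apply: (strongly_quasiconvex_of_slopes sF sU aa _ T0 _); first lra.
  by move=> z /big h; rewrite ger0_norm; [move=> ?|]; lra.
Qed.

End Cores.

Section Octants.
Context {R : realType}.
Implicit Types P Q : set (R * R).

Definition octant_incidence (p t1 b s0 e : R) (w f1 f2 : R -> R) (z : R * R) : Prop :=
  [/\ p <= z.1 <= t1, 0 <= z.2 <= 1 &
    exists rho, [/\ p <= rho <= t1,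
      rho ^+ 2 = z.1 ^+ 2 + b ^+ 2 - 2 * b * z.1 * w z.2 &
      `|f1 z.1 - s0 - f2 rho| <= e]].

Lemma measurable_fst_preimage (A : set R) : measurable A ->
  measurable [set z : R * R | A z.1].
Proof. by move=> mA; have := @measurable_fst _ _ R R measurableT A mA; rewrite setTI. Qed.

Lemma lambda2_empty P : (forall z, P z -> False) -> (lambda2 P <= 0%:E)%E.
Proof.
move=> P0; have -> : P = set0 by apply/seteqP; split => // z /P0.
by rewrite measure0.
Qed.

Lemma octant_radial_bound (t0 t1 M gap p b s0 e : R) (w f1 u1 f2 u2 : R -> R) P :
  1 <= t0 -> t1 <= 2 -> t0 <= p <= t1 ->
  slope_on t0 t1 f1 u1 -> slope_on t0 t1 f2 u2 ->
  (forall x, t0 <= x <= t1 -> `|u2 x| <= M) ->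
  (forall x y, t0 <= x <= t1 -> t0 <= y <= t1 -> `|u2 x - u2 y| <= M * `|x - y|) ->
  (forall x, t0 <= x <= t1 -> gap <= `|u1 x - u2 x|) ->
  0 <= b -> b < 1 / 2 -> 6 * M * b <= gap -> 0 < gap -> 0 <= e ->
  (forall s, 0 <= s <= 1 -> -1 <= w s <= 1) ->
  measurable P ->
  (forall z, P z -> octant_incidence p t1 b s0 e w f1 f2 z) ->
  (lambda2 P <= (8 * e / gap)%:E)%E.
Proof.
move=> t01 t12 hp sf1 sf2 uM uL ugap b0 bh Mb gap0 e0 hw mP PI.
rewrite lambda2_swap//.
have -> : 8 * e / gap = 2 * (4 * e / gap) * (1 - 0) by field; rewrite gt_eqF.
apply: lambda2_le_const => //; first by move=> z /PI [_ /= h _].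
move=> s hs; apply: lambda_diam; first by rewrite divr_ge0 ?mulr_ge0// ltW.
move=> r r'; rewrite /xsection/= !inE => /PI [/= hr _ [rho [hrho E he]]].
move=> /PI [/= hr' _ [rho' [hrho' E' he']]] rr.
rewrite ler_pdivlMr// mulrC.
have pI y : p <= y <= t1 -> t0 <= y <= t1.
  by move=> /andP[h ->]; rewrite (le_trans (andP hp).1).
exact: (radial_gap t01 t12 sf1 sf2 uM uL ugap b0 bh Mb (hw _ hs) (pI _ hr) (pI _ hr')
  (pI _ hrho) (pI _ hrho') E E' he he' rr).
Qed.

Lemma octant_angular_bound (t0 t1 m p b s0 e : R) (sg : R) (f1 f2 u2 : R -> R) P :
  1 <= t0 -> t1 <= 2 -> t0 <= p <= t1 -> 0 < m -> slope_on t0 t1 f2 u2 ->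
  (forall x, t0 <= x <= t1 -> m <= u2 x) -> 0 < b -> 0 <= e -> sg = 1 \/ sg = -1 ->
  (forall z, P z ->
    octant_incidence p t1 b s0 e (fun s => sg * (s / Num.sqrt (1 + s ^+ 2))) f1 f2 z) ->
  (lambda2 P <= (64 * e / (m * b))%:E)%E.
Proof.
move=> t01 t12 hp m0 sf um b0 e0 hsg PI.
have mb : 0 < m * b by rewrite mulr_gt0.
apply: (@le_trans _ _ (2 * (32 * e / (m * b)) * (t1 - p))%:E); last first.
  have -> : 64 * e / (m * b) = 2 * (32 * e / (m * b)) * 1.
    by field; rewrite (lt0r_neq0 m0) (lt0r_neq0 b0).
  rewrite lee_fin ler_wpM2l//; last lra.
  by rewrite mulr_ge0// divr_ge0 ?mulr_ge0// ltW.
apply: lambda2_le_const; [lra|by move=> z /PI []|].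
move=> r hr; apply: lambda_xsection_le; first by rewrite divr_ge0 ?mulr_ge0// ltW.
move=> s s' /PI [/= _ hs [rho [hrho E he]]] /PI [/= _ hs' [rho' [hrho' E' he']]] ss.
have gap := div_sqrt_gap (s := s) (s' := s') ltac:(lra) ss ltac:(lra).
rewrite ler_pdivlMr//.
have pI y : p <= y <= t1 -> t0 <= y <= t1.
  by move=> /andP[h ->]; rewrite (le_trans (andP hp).1).
have rI := pI _ hr; have rhoI := pI _ hrho; have rhoI' := pI _ hrho'.
have g1 := other_radius_gap t01 t12 m0 sf um (ltW b0) rI rhoI rhoI' E E' he he'.
have g2 := other_radius_gap t01 t12 m0 sf um (ltW b0) rI rhoI' rhoI E' E he' he.
have g3 := ler_wpM2l (ltW mb) gap.
by move: g1 g2; case: hsg => ->; lra.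
Qed.

Lemma sqr_le_of_norm (x y : R) : - y <= x -> x <= y -> x ^+ 2 <= y ^+ 2.
Proof. nra. Qed.

(* Away from the collinear end, [s] is bounded below by [(p - t0) / 4]. *)
Lemma transverse_width (t0 p t1 m b r s s' rho e : R) :
  0 < m -> 0 < b -> 1 <= t0 -> t1 <= 2 -> t0 <= p -> t0 <= r <= t1 ->
  p <= rho -> rho <= t1 -> 0 <= s -> s <= s' -> s' <= 1 ->
  (r - b) ^+ 2 <= t0 ^+ 2 ->
  rho ^+ 2 = r ^+ 2 + b ^+ 2 - 2 * b * r * (Num.sqrt (1 + s ^+ 2))^-1 ->
  m * b * ((Num.sqrt (1 + s ^+ 2))^-1 - (Num.sqrt (1 + s' ^+ 2))^-1) <= 4 * e ->
  (s' - s) * (m * b * (p - t0)) <= 128 * e.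
Proof.
move=> m0 b0 t01 t12 tp /andP[r1 r2] prho rhot s0 ss s1 rb.
have s1' : s <= 1 by exact: le_trans s1.
have g2 := inv_sqrt_gap s0 ss s1.
have hs : 0 <= s <= 1 by rewrite s0.
have /andP[] := inv_sqrt_ge hs.
move: g2; set w := (Num.sqrt (1 + s ^+ 2))^-1; set w' := (Num.sqrt (1 + s' ^+ 2))^-1.
clearbody w w' => g2 w1 w2 E g1.
have br : 0 < b * r by rewrite mulr_gt0//; lra.
have bw : 0 <= b * r * (1 - w) by apply: mulr_ge0; lra.
have b4 : b <= 4 by clear g1 g2 rb; rewrite leNgt; apply/negP => h; nra.
have s4 : p - t0 <= 4 * s.
  have h1 : 0 <= b * r * (s ^+ 2 / 2 - (1 - w)) by apply: mulr_ge0; lra.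
  have h2 : 0 <= b * s ^+ 2 * (2 - r) by rewrite !mulr_ge0 ?sqr_ge0 ?(ltW b0)//; lra.
  have h3 : p ^+ 2 <= rho ^+ 2 by rewrite ler_sqr ?nnegrE//; lra.
  have h4 : 2 * (p - t0) <= p ^+ 2 - t0 ^+ 2 by clear - t01 tp; nra.
  have h5 : p - t0 <= b * s ^+ 2 by clear - h1 h2 h3 h4 rb E; lra.
  have h6 : 0 <= (4 - b) * s by apply: mulr_ge0; lra.
  have h7 : 0 <= b * (s * (1 - s)) by rewrite !mulr_ge0 ?(ltW b0)//; lra.
  clear - h5 h6 h7; lra.
have mb : 0 < m * b by rewrite mulr_gt0.
have g3 := ler_wpM2l (ltW mb) g2.
have k1 : 0 <= m * b * (s' - s) * (4 * s - (p - t0)) by rewrite !mulr_ge0 ?(ltW m0) ?(ltW b0) ?subr_ge0.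
have k2 : 0 <= m * b * (s' - s) * (s' - s) by rewrite !mulr_ge0 ?(ltW m0) ?(ltW b0) ?subr_ge0.
clear - k1 k2 g1 g3; lra.
Qed.

Lemma octant_curved_bound ell (t0 t1 M m lam kap D p b s0 e T : R)
    (f1 u1 v1 f2 u2 v2 : R -> R) P :
  curved_pair ell t0 t1 M m lam kap D f1 u1 v1 f2 u2 v2 ->
  1 <= t0 -> t1 <= 2 -> t0 < p -> p <= t1 -> 0 < lam -> 0 < D -> 0 < b -> 0 < T ->
  0 < kap -> 0 < m -> T * (2 * lam + M) <= kap * lam * D -> T <= 2 * m -> 0 < e ->
  measurable P ->
  (forall z, P z ->
    octant_incidence p t1 b s0 e (fun s => (Num.sqrt (1 + s ^+ 2))^-1) f1 f2 z) ->
  (lambda2 P <= (2 * strip_bound ell (192 / m + 1024 * M / m ^+ 2) b T e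
                 + 256 * e / (m * b * (p - t0)))%:E)%E.
Proof.
move=> cp t01 t12 tp pt lam0 D0 b0 T0 kap0 m0 TM Tm e0 mP PI.
have umM := cp_bound2 cp.
have um y : t0 <= y <= t1 -> m <= u2 y by move=> /umM /andP[].
have M0 : 0 < M by have := umM p ltac:(lra); lra.
set C0 := 192 / m + _.
have C00 : 0 <= C0.
  have i1 : 0 < m^-1 by rewrite invr_gt0.
  have i2 : 0 < M / m ^+ 2 by rewrite divr_gt0// exprn_gt0.
  rewrite /C0 -[1024 * M / _]mulrA; lra.
have sb0 : 0 <= strip_bound ell C0 b T e by apply: strip_bound_ge0; exact: ltW.
have sf2 := cp_slope2 cp.
pose P1 := P `&` [set z | `[b + t0, +oo[%classic z.1].
pose P2 := P `&` [set z | `]-oo, b - t0]%classic z.1].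
pose P3 := P `&` [set z | `]b - t0, b + t0[%classic z.1].
have mP1 : measurable P1 by apply: measurableI => //; exact: measurable_fst_preimage.
have mP2 : measurable P2 by apply: measurableI => //; exact: measurable_fst_preimage.
have mP3 : measurable P3 by apply: measurableI => //; exact: measurable_fst_preimage.
have cover : P `<=` P1 `|` (P2 `|` P3).
  move=> z Pz; rewrite /P1 /P2 /P3 /= !in_itv /= andbT.
  have [h1|h1] := leP (b + t0) z.1; first by left.
  by right; have [h2|h2] := leP z.1 (b - t0); [left|right].
have defect r s s' x : P (r, s) -> P (r, s') -> s <= s' -> t0 <= x ->
    x ^+ 2 = (r - b) ^+ 2 ->
    [/\ x <= t1, - e <= f1 r - s0 - f2 x &
      b * (s' - s) ^+ 2 * (f1 r - s0 - f2 x + 2 * e) <= C0 * e ^+ 2].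
  move=> /PI [/= /andP[r1 r2] /andP[hs _] [rho [/andP[p1 p2] E he]]].
  move=> /PI [/= _ /andP[_ hs'] [rho' [/andP[p1' p2'] E' he']]] ss tx xE.
  have pI y : p <= y -> y <= t1 -> t0 <= y <= t1 by move=> h ->; rewrite (le_trans (ltW tp)).
  exact: (collinear_defect t01 t12 m0 sf2 umM (ltW b0) (pI _ r1 r2) (pI _ p1 p2)
    (pI _ p1' p2') hs ss hs' tx xE E E' he he').
clearbody C0.
have b1 : (lambda2 P1 <= (strip_bound ell C0 b T e)%:E)%E.
  pose a := Num.max p (b + t0).
  have a1 : p <= a by rewrite le_max lexx.
  have a2 : b + t0 <= a by rewrite le_max lexx orbT.
  have P1a r s : P1 (r, s) -> [/\ a <= r, r <= t1, t0 <= r - b & P (r, s)].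
    move=> [Prs]; rewrite /= in_itv/= andbT => h; have [/= hr _ _] := PI _ Prs.
    by split => //; [rewrite /a ge_max h andbT|..]; clear - hr h; lra.
  have [at1|at1] := leP a t1; last first.
    apply: le_trans (lambda2_empty _) _; last by rewrite lee_fin.
    by move=> [r s] /P1a [] *; lra.
  have a3 : t0 <= a by lra.
  have a4 : t0 + b <= a by lra.
  have [c qc] := outer_defect_quasiconvex s0 cp t01 t12 lam0 D0 b0 T0 kap0 M0 TM a3 a4 at1.
  apply: (strip_le mP1 T0 b0 e0 C00 _ qc) => //; first lra.
    move=> [r s] /P1a [h1 h2 h3 Prs]; split => /=; first by rewrite h1.
    by have [] := defect r s s (r - b) Prs Prs (lexx _) h3 erefl.
  move=> r s s' /P1a [h1 h2 h3 Prs] /P1a [_ _ _ Prs'] ss.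
  by have [] := defect r s s' (r - b) Prs Prs' ss h3 erefl.
have b2 : (lambda2 P2 <= (strip_bound ell C0 b T e)%:E)%E.
  pose a := Num.max p (b - t1); pose a' := Num.min t1 (b - t0).
  have a1 : p <= a by rewrite le_max lexx.
  have a2 : b - t1 <= a by rewrite le_max lexx orbT.
  have a3 : a' <= t1 by rewrite ge_min lexx.
  have a4 : a' <= b - t0 by rewrite ge_min lexx orbT.
  have sq r : (b - r) ^+ 2 = (r - b) ^+ 2 by ring.
  have P2a r s : P2 (r, s) -> [/\ a <= r, r <= a', t0 <= b - r & P (r, s)].
    move=> [Prs]; rewrite /= in_itv/= => h; have [/= hr _ _] := PI _ Prs.
    have [h' _ _] := defect r s s (b - r) Prs Prs (lexx _) ltac:(lra) (sq r).
    split => //; [rewrite /a ge_max|rewrite /a' le_min|]; clear - hr h h'; lra.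
  have [aa|aa] := leP a a'; last first.
    apply: le_trans (lambda2_empty _) _; last by rewrite lee_fin.
    by move=> [r s] /P2a [] *; lra.
  have a5 : t0 <= a by lra.
  have [c qc] := inner_defect_quasiconvex s0 cp t01 t12 T0 Tm a5 a2 aa a3 a4.
  apply: (strip_le mP2 T0 b0 e0 C00 _ qc) => //; first lra.
    move=> [r s] /P2a [h1 h2 h3 Prs]; split => /=; first by rewrite h1.
    by have [] := defect r s s (b - r) Prs Prs (lexx _) h3 (sq r).
  move=> r s s' /P2a [h1 h2 h3 Prs] /P2a [_ _ _ Prs'] ss.
  by have [] := defect r s s' (b - r) Prs Prs' ss h3 (sq r).
have b3 : (lambda2 P3 <= (256 * e / (m * b * (p - t0)))%:E)%E.
  have mb : 0 < m * b by rewrite mulr_gt0.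
  have mbp : 0 < m * b * (p - t0) by rewrite mulr_gt0// subr_gt0.
  have E0 : 0 <= 128 * e / (m * b * (p - t0)).
    by apply: divr_ge0; [rewrite mulr_ge0 // ltW|exact: ltW].
  apply: (@le_trans _ _ (2 * (128 * e / (m * b * (p - t0))) * (t1 - p))%:E); last first.
    have -> : 256 * e / (m * b * (p - t0)) = 2 * (128 * e / (m * b * (p - t0))) * 1.
      by field; rewrite (lt0r_neq0 m0) (lt0r_neq0 b0) gt_eqF// subr_gt0.
    by rewrite lee_fin; apply: ler_wpM2l; [exact: mulr_ge0|clear - t12 t01 tp; lra].
  apply: lambda2_le_const => //; first by move=> z [/PI []].
  move=> r hr; apply: lambda_xsection_le => //.
  move=> s s' [/PI [/= _ hs [rho [hrho E he]]]]; rewrite in_itv/= => hb.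
  move=> [/PI [/= _ hs' [rho' [hrho' E' he']]]] _ ss.
  have pI y : p <= y <= t1 -> t0 <= y <= t1 by move=> /andP[h ->]; rewrite (le_trans (ltW tp)).
  have rI := pI _ hr; have rhoI := pI _ hrho; have rhoI' := pI _ hrho'.
  have rb : (r - b) ^+ 2 <= t0 ^+ 2 by clear - hb; apply: sqr_le_of_norm; lra.
  have g1 := other_radius_gap t01 t12 m0 sf2 um (ltW b0) rI rhoI' rhoI E' E he' he.
  have /andP[s0' _] := hs; have /andP[_ s1'] := hs'.
  rewrite ler_pdivlMr//.
  exact: (transverse_width m0 b0 t01 t12 (ltW tp) rI (andP hrho).1 (andP rhoI).2 s0' ss s1' rb E g1).
apply: (le_trans (le_lambda2 cover)).
apply: (le_trans (lambda2U mP1 (measurableU _ _ mP2 mP3))).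
set sb := strip_bound _ _ _ _ _ in b1 b2 *; set tr := _ / (m * b * _) in b3 *.
have -> : 2 * sb + tr = sb + (sb + tr) by clear; ring.
rewrite EFinD; apply: leeD; first exact: b1.
apply: (le_trans (lambda2U mP2 mP3)).
by rewrite EFinD; apply: leeD; [exact: b2|exact: b3].
Qed.

End Octants.

Section Uniform.
Context {R : realType}.
Implicit Types P Q : set (R * R).

Definition octant_cosine (w : R -> R) : Prop :=
  w = (fun s => (Num.sqrt (1 + s ^+ 2))^-1) \/
  exists2 sg, sg = 1 \/ sg = -1 & w = (fun s => sg * (s / Num.sqrt (1 + s ^+ 2))).

Definition log_loss (ell : bool) (delta : R) : R := if ell then 1 else `|ln delta|.

Definition max_scale (ell : bool) : R := if ell then 1 else 1 / 2.

Lemma octant_cosine_bound w s : octant_cosine w -> 0 <= s <= 1 -> -1 <= w s <= 1.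
Proof.
move=> hw hs; have [q1 q2 qE] := sqrt_one_add_sqrP hs.
have /andP[i1 i2] := inv_sqrt_ge hs.
case: hw => [->|[sg hsg ->]]; first by apply/andP; split; nra.
have sq : 0 <= s / Num.sqrt (1 + s ^+ 2) <= 1.
  apply/andP; split; first by apply: divr_ge0; lra.
  by rewrite ler_pdivrMr; lra.
by case: hsg => ->; lra.
Qed.

Lemma log_loss_lower ell : exists2 c : R, 0 < c &
  forall delta, 0 < delta < max_scale ell -> 1 <= c * log_loss ell delta.
Proof.
have ln2 : 0 < ln 2 :> R by rewrite ln_gt0// ltr1n.
case: ell; first by exists 1 => //= delta _; rewrite /log_loss mul1r.
exists (ln 2)^-1 => [|delta /andP[d0 d1]]; first by rewrite invr_gt0.
rewrite /max_scale in d1.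
rewrite /log_loss mulrC ler_pdivlMr// mul1r ltr0_norm; last by rewrite ln_lt0//; lra.
rewrite -lnV ?posrE// ler_ln ?posrE ?invr_gt0//.
by rewrite -[leLHS]invrK lef_pV2 ?posrE ?invr_gt0//; lra.
Qed.

Lemma strip_bound_le ell (C0 m S : R) : 0 <= C0 -> 0 < m -> 0 < S -> exists2 c : R, 0 <= c &
  forall D b T K delta, 0 < D -> S * (D * D) <= b * T -> 0 < b -> 0 < T -> T <= 2 * m ->
    1 <= K -> 0 < delta < max_scale ell ->
    strip_bound ell C0 b T (K * delta) <= c * K * (delta / D * log_loss ell delta).
Proof.
move=> C00 m0 S0.
have sqrtS (C D b T : R) : 0 <= C -> 0 < D -> S * (D * D) <= b * T -> 0 < b -> 0 < T ->
    Num.sqrt (C / (b * T)) <= Num.sqrt (C / S) / D.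
  move=> CC0 D0 h b0 T0; have D2 : 0 < D * D by rewrite mulr_gt0.
  rewrite -[leRHS]ger0_norm; last by rewrite divr_ge0 ?sqrtr_ge0// ltW.
  rewrite -sqrtr_sqr ler_wsqrtr// exprMn exprVn sqr_sqrtr; last by rewrite divr_ge0// ltW.
  rewrite -mulrA -invfM ler_wpM2l// lef_pV2 ?posrE ?mulr_gt0//.
case: ell.
- exists (8 * Num.sqrt (2 * C0 / S)); first by rewrite mulr_ge0 ?sqrtr_ge0.
  move=> D b T K delta D0 h b0 T0 Tm K1 /andP[d0 _].
  rewrite /strip_bound /log_loss.
  have := sqrtS (2 * C0) D b T ltac:(lra) D0 h b0 T0.
  have Kd : 0 <= 8 * (K * delta) by rewrite !mulr_ge0; lra.
  move=> /(ler_wpM2l Kd).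
  by rewrite mulr1; lra.
have ln2 : 0 < ln 2 :> R by rewrite ln_gt0// ltr1n.
have [c c0 hc] := log_loss_lower false.
have lm : 0 <= ln (2 + m) by rewrite ln_ge0//; lra.
exists (8 * Num.sqrt (C0 / S) * (c * ln (2 + m) + 1)).
  by rewrite !mulr_ge0 ?sqrtr_ge0// addr_ge0// mulr_ge0// ltW.
move=> D b T K delta D0 h b0 T0 Tm K1 /andP[d0 d1].
have L1 := hc delta; rewrite d0 d1 in L1; have {}L1 := L1 isT.
rewrite /max_scale in d1.
rewrite /strip_bound; set L := log_loss false delta in L1 *.
have lnd : ln (1 + Num.sqrt (T / (2 * (K * delta)))) <= (c * ln (2 + m) + 1) * L.
  have Kd : delta <= K * delta by nra.
  have h1 : 1 + Num.sqrt (T / (2 * (K * delta))) <= (2 + m) / delta.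
    have x0 : 0 <= T / (2 * (K * delta)) by apply: divr_ge0; lra.
    have x1 : T / (2 * (K * delta)) <= m / delta.
      rewrite ler_pdivrMr; last lra.
      have : m * delta <= m * (K * delta) by rewrite ler_wpM2l// ltW.
      move=> hm; have -> : m / delta * (2 * (K * delta)) = 2 * m * K by field; rewrite gt_eqF.
      nra.
    have sq1 : Num.sqrt (T / (2 * (K * delta))) <= 1 + T / (2 * (K * delta)).
      rewrite -[leRHS]ger0_norm; last lra.
      by rewrite -sqrtr_sqr ler_wsqrtr//; nra.
    have id2 : 2 <= 2 / delta by rewrite ler_pdivlMr//; lra.
    rewrite [leRHS]mulrDl.
    apply: (@le_trans _ _ (2 + T / (2 * (K * delta)))); last exact: lerD.
    by move: sq1; set y := Num.sqrt _; set x := _ / _; lra.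
  have pos1 : 0 < 1 + Num.sqrt (T / (2 * (K * delta))).
    by have := sqrtr_ge0 (T / (2 * (K * delta))); lra.
  have pos2 : 0 < (2 + m) / delta by rewrite divr_gt0//; lra.
  apply: (@le_trans _ _ (ln ((2 + m) / delta))); first by rewrite ler_ln ?posrE.
  rewrite ln_div ?posrE//; last lra.
  have -> : - ln delta = L.
    by rewrite /L /log_loss ltr0_norm// ln_lt0//; lra.
  have : ln (2 + m) * 1 <= ln (2 + m) * (c * L) by rewrite ler_wpM2l.
  lra.
have sb := sqrtS C0 D b T C00 D0 h b0 T0.
have ln0 : 0 <= ln (1 + Num.sqrt (T / (2 * (K * delta)))).
  by rewrite ln_ge0// lerDl sqrtr_ge0.
have prod := ler_pM (sqrtr_ge0 _) ln0 sb lnd.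
have Kd : 0 <= 8 * (K * delta) by rewrite !mulr_ge0; lra.
by have := ler_wpM2l Kd prod; lra.
Qed.

Lemma ratio_absorb (k c delta D L : R) : 0 <= k -> 0 < delta -> 0 < D -> 1 <= c * L ->
  k * (delta / D) <= c * k * (delta / D * L).
Proof.
move=> k0 d0 D0 cL.
have h : 0 <= k * (delta / D) by rewrite mulr_ge0// divr_ge0// ltW.
rewrite -[leLHS]mulr1 (_ : _ * (_ * L) = k * (delta / D) * (c * L)); last by ring.
exact: ler_wpM2l.
Qed.

Lemma inv_shift_bound (k y lam M D b delta : R) : 0 <= k -> 0 < lam -> 0 < D -> 0 < y ->
  0 < b -> 0 < delta -> lam * D < 6 * M * b ->
  k * delta / (y * b) <= k * (6 * M) / (y * lam) * (delta / D).
Proof.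
move=> k0 lam0 D0 y0 b0 d0 h.
have ib : b^-1 <= 6 * M / (lam * D).
  rewrite -[leLHS]div1r ler_pdivrMr// mulrAC ler_pdivlMr ?mulr_gt0// mul1r; exact: ltW.
have -> : k * delta / (y * b) = k * delta / y * b^-1.
  by field; rewrite (lt0r_neq0 y0) (lt0r_neq0 b0).
have -> : k * (6 * M) / (y * lam) * (delta / D) = k * delta / y * (6 * M / (lam * D)).
  by field; rewrite (lt0r_neq0 y0) (lt0r_neq0 lam0) (lt0r_neq0 D0).
by apply: ler_wpM2l ib; apply: divr_ge0; [apply: mulr_ge0 => //|]; apply: ltW.
Qed.

Lemma curved_pair_shift_le ell (t0 t1 M m lam kap D : R) f1 u1 v1 f2 u2 v2 :
  curved_pair ell t0 t1 M m lam kap D f1 u1 v1 f2 u2 v2 -> 0 < m -> t0 <= t1 ->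
  lam * D <= M.
Proof.
move=> cp m0 t01; have t0I : t0 <= t0 <= t1 by rewrite lexx.
have h3 := cp_sep cp t0I; have /andP[a1 a2] := cp_bound1 cp t0I.
have /andP[b1 b2] := cp_bound2 cp t0I; apply: (le_trans h3).
by clear h3; rewrite ler_norml; apply/andP; split; lra.
Qed.

Lemma octant_bound_small ell (t0 t1 M m lam kap D p b s0 e : R) f1 u1 v1 f2 u2 v2 w P :
  curved_pair ell t0 t1 M m lam kap D f1 u1 v1 f2 u2 v2 ->
  1 <= t0 -> t1 <= 2 -> t0 <= p -> p <= t1 -> 0 < M -> 0 < m -> 0 < lam -> 0 < D -> 0 <= b ->
  6 * M * b <= lam * D -> 0 <= e -> octant_cosine w -> measurable P ->
  (forall z, P z -> octant_incidence p t1 b s0 e w f1 f2 z) ->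
  (lambda2 P <= (8 * e / (lam * D))%:E)%E.
Proof.
move=> cp t01 t12 p0 p1 M0 m0 lam0 D0 b0 bs e0 hw mP PI.
have hp : t0 <= p <= t1 by rewrite p0.
have lamD := curved_pair_shift_le cp m0 (le_trans p0 p1).
have bh : b < 1 / 2.
  have h : M * (6 * b) <= M * 1 by clear - bs lamD; lra.
  by move: h; rewrite ler_pM2l// => h; clear - h; lra.
apply: (octant_radial_bound t01 t12 hp (cp_slope1 cp) (cp_slope2 cp) _ (cp_lip2 cp)
          (cp_sep cp) b0 bh bs _ e0 _ mP PI).
- by move=> x /(cp_bound2 cp) /andP[h1 h2]; rewrite ger0_norm// (le_trans _ h1)// ltW.
- by rewrite mulr_gt0.
- by move=> s hs1; exact: octant_cosine_bound.
Qed.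

Lemma octant_bound_curved (ell : bool) (len M m lam kap K : R) :
  0 < len -> 0 < M -> 0 < m -> 0 < lam -> 0 < kap -> 1 <= K ->
  exists2 C : R, 0 <= C & forall t0 t1 D b s0 delta f1 u1 v1 f2 u2 v2 P,
    curved_pair ell t0 t1 M m lam kap D f1 u1 v1 f2 u2 v2 ->
    1 <= t0 -> t1 <= 2 -> t1 - t0 = len -> 0 < D -> 0 < delta < max_scale ell ->
    0 < b -> lam * D < 6 * M * b -> measurable P ->
    (forall z, P z ->
       octant_incidence (t1 - len / 2) t1 b s0 (K * delta)
         (fun s => (Num.sqrt (1 + s ^+ 2))^-1) f1 f2 z) ->
    (lambda2 P <= (2 * (C * (delta / D * log_loss ell delta))
       + 256 * (K * delta) / (m * b * (len / 2)))%:E)%E.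
Proof.
move=> len0 M0 m0 lam0 kap0 K1.
set C0 := 192 / m + 1024 * M / m ^+ 2.
have C00 : 0 <= C0.
  have i1 : 0 < m^-1 by rewrite invr_gt0.
  have i2 : 0 < M / m ^+ 2 by rewrite divr_gt0// exprn_gt0.
  rewrite /C0 -[1024 * M / _]mulrA; lra.
have lM : 0 < 2 * lam + M by lra.
have [c1 [c10 c11 c12]] : exists c1 : R,
    [/\ 0 < c1, c1 * (2 * lam + M) <= kap * lam & c1 * M <= 2 * m * lam].
  exists (Num.min (kap * lam / (2 * lam + M)) (2 * m * lam / M)); split.
  - by rewrite lt_min !divr_gt0 ?mulr_gt0.
  - by rewrite -ler_pdivlMr// ge_min lexx.
  - by rewrite -ler_pdivlMr// ge_min lexx orbT.
have S0 : 0 < lam / (6 * M) * c1 by rewrite !mulr_gt0 ?invr_gt0 ?mulr_gt0.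
have [cs cs0 hs] := strip_bound_le ell C00 m0 S0.
exists (cs * K); first by rewrite mulr_ge0//; lra.
move=> t0 t1 D b s0 delta f1 u1 v1 f2 u2 v2 P cp t01 t12 tlen D0 hd b0 bl mP PI.
have tt : t0 <= t1 by clear - tlen len0; lra.
have lamD := curved_pair_shift_le cp m0 tt.
have /andP[d0 _] := hd.
have T0 : 0 < c1 * D by rewrite mulr_gt0.
have T1 : c1 * D * (2 * lam + M) <= kap * lam * D.
  by rewrite mulrAC ler_wpM2r// ltW.
have T2 : c1 * D <= 2 * m.
  have h1 := ler_wpM2r (ltW D0) c12.
  have m20 : 0 <= 2 * m by clear - m0; lra.
  have h2 := ler_wpM2l m20 lamD.
  by rewrite -(ler_pM2r M0); clear - h1 h2; lra.
have SbT : lam / (6 * M) * c1 * (D * D) <= b * (c1 * D).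
  have -> : lam / (6 * M) * c1 * (D * D) = (lam * D / (6 * M)) * (c1 * D).
    by field; rewrite (lt0r_neq0 M0).
  rewrite ler_wpM2r ?(ltW T0)// ler_pdivrMr; last by rewrite mulr_gt0.
  by clear - bl; lra.
have tp : t0 < t1 - len / 2 by clear - tlen len0; lra.
have pt : t1 - len / 2 <= t1 by clear - len0; lra.
have Kd0 : 0 < K * delta by rewrite mulr_gt0// (lt_le_trans ltr01).
have := octant_curved_bound cp t01 t12 tp pt lam0 D0 b0 T0 kap0 m0 T1 T2 Kd0 mP PI.
rewrite -/C0; have -> : t1 - len / 2 - t0 = len / 2 by rewrite -tlen; field.
move=> h; apply: (le_trans h); rewrite lee_fin lerD2r ler_pM2l//.
exact: hs.
Qed.

Lemma octant_bound (ell : bool) (len M m lam kap K : R) :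
  0 < len -> 0 < M -> 0 < m -> 0 < lam -> 0 < kap -> 1 <= K ->
  exists2 C : R, 0 <= C & forall t0 t1 D b s0 delta f1 u1 v1 f2 u2 v2 w P,
    curved_pair ell t0 t1 M m lam kap D f1 u1 v1 f2 u2 v2 ->
    1 <= t0 -> t1 <= 2 -> t1 - t0 = len -> 0 < D -> 0 < delta < max_scale ell ->
    0 <= b -> octant_cosine w -> measurable P ->
    (forall z, P z ->
       octant_incidence (t1 - len / 2) t1 b s0 (K * delta) w f1 f2 z) ->
    (lambda2 P <= (C * (delta / D * log_loss ell delta))%:E)%E.
Proof.
move=> len0 M0 m0 lam0 kap0 K1.
have [cL cL0 hL] := log_loss_lower ell.
have [c c0 hc] := octant_bound_curved ell len0 M0 m0 lam0 kap0 K1.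
have K0 : 0 < K by exact: lt_le_trans K1.
have [k1 k1E] : exists k1, k1 = 8 * K / lam by exists (8 * K / lam).
have [k2 k2E] : exists k2, k2 = 64 * K * (6 * M) / (m * lam) by eexists.
have [k3 k3E] : exists k3, k3 = 256 * K * (6 * M) / (m * (len / 2) * lam) by eexists.
have ml0 : 0 < m * lam by rewrite mulr_gt0.
have ml2 : 0 < m * (len / 2) by rewrite mulr_gt0// divr_gt0.
have KM0 : 0 < K * M by rewrite mulr_gt0.
have k10 : 0 <= k1 by rewrite k1E; apply: divr_ge0; clear - K0 lam0; lra.
have k20 : 0 <= k2 by rewrite k2E; apply: divr_ge0; clear - KM0 ml0; lra.
have k30 : 0 <= k3.
  by rewrite k3E; apply: divr_ge0; [clear - KM0; lra|rewrite mulr_ge0// ltW].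
have [q1 q2 q3] : [/\ 0 <= cL * k1, 0 <= cL * k2 & 0 <= cL * k3].
  by split; apply: mulr_ge0 => //; exact: ltW.
exists (cL * k1 + cL * k2 + cL * k3 + 2 * c).
  by clear - q1 q2 q3 c0; lra.
move=> t0 t1 D b s0 delta f1 u1 v1 f2 u2 v2 w P cp t01 t12 tlen D0 hd b0 hw mP PI.
have L1 := hL _ hd; have /andP[d0 _] := hd.
have L0 : 0 <= log_loss ell delta by rewrite /log_loss; case: (ell).
set X := delta / D * log_loss ell delta.
have X0 : 0 <= X by rewrite mulr_ge0// divr_ge0// ltW.
have tp : t0 <= t1 - len / 2 by clear - tlen len0; lra.
have pt : t1 - len / 2 <= t1 by clear - len0; lra.
have Kd0 : 0 < K * delta by rewrite mulr_gt0.
have fin B a : (lambda2 P <= B%:E)%E -> B <= a * X ->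
    a <= cL * k1 + cL * k2 + cL * k3 + 2 * c ->
    (lambda2 P <= ((cL * k1 + cL * k2 + cL * k3 + 2 * c) * X)%:E)%E.
  move=> h1 h2 h3; apply: (le_trans h1); rewrite lee_fin; apply: (le_trans h2).
  by rewrite ler_wpM2r.
have [bs|bl] := leP (6 * M * b) (lam * D).
  apply: (fin _ (cL * k1) (octant_bound_small cp t01 t12 tp pt M0 m0 lam0 D0 b0 bs (ltW Kd0) hw mP PI)).
    have -> : 8 * (K * delta) / (lam * D) = k1 * (delta / D).
      by rewrite k1E; field; rewrite (lt0r_neq0 lam0) (lt0r_neq0 D0).
    exact: ratio_absorb.
  by clear - q1 q2 q3 c0; lra.
have b0' : 0 < b.
  have h : 0 < 6 * M * b by exact: lt_trans (mulr_gt0 lam0 D0) bl.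
  by move: h; rewrite pmulr_rgt0// mulr_gt0.
case: hw PI => [->|[sg hsg ->]] PI.
  apply: (fin _ (cL * k3 + 2 * c) (hc _ _ _ _ _ _ _ _ _ _ _ _ _ cp t01 t12 tlen D0 hd b0' bl mP PI)).
    have h := inv_shift_bound (k := 256 * K) ltac:(clear - K0; lra) lam0 D0 ml2 b0' d0 bl.
    rewrite -k3E in h.
    have h' := ratio_absorb k30 d0 D0 L1.
    have -> : 256 * (K * delta) / (m * b * (len / 2)) = 256 * K * delta / (m * (len / 2) * b).
      by field; rewrite (lt0r_neq0 m0) (lt0r_neq0 b0') (lt0r_neq0 len0).
    by move: h h'; rewrite -/X; clearbody X; clear => h h'; lra.
  by clear - q1 q2 q3 c0; lra.
have um y : t0 <= y <= t1 -> m <= u2 y by move=> /(cp_bound2 cp) /andP[].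
have hp : t0 <= t1 - len / 2 <= t1 by rewrite tp.
apply: (fin _ (cL * k2) (octant_angular_bound t01 t12 hp m0 (cp_slope2 cp) um b0' (ltW Kd0) hsg PI)).
  have h := inv_shift_bound (k := 64 * K) ltac:(clear - K0; lra) lam0 D0 m0 b0' d0 bl.
  rewrite -k2E in h.
  have h' := ratio_absorb k20 d0 D0 L1.
  have -> : 64 * (K * delta) / (m * b) = 64 * K * delta / (m * b) by rewrite mulrA.
  exact: le_trans h h'.
by clear - q1 q2 q3 c0; lra.
Qed.

End Uniform.

Section Planar.
Context {R : realType}.
Implicit Types P W : set (R * R).

Definition octant (c1 c2 p q eps : R) : set (R * R) :=
  [set X | 0 <= eps * (p * (X.2 - c2) - q * (X.1 - c1))
             <= p * (X.1 - c1) + q * (X.2 - c2) /\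
           0 < p * (X.1 - c1) + q * (X.2 - c2)].

Lemma measurable_linear_form (a b c1 c2 : R) :
  measurable_fun [set: R * R] (fun X : R * R => a * (X.1 - c1) + b * (X.2 - c2)).
Proof.
apply: measurable_funD; apply: measurable_funM => //; apply: measurable_funB => //.
Qed.

Lemma measurable_le_set (f g : R * R -> R) : measurable_fun [set: R * R] f ->
  measurable_fun [set: R * R] g -> measurable [set X | f X <= g X].
Proof.
move=> mf mg; have := measurable_fun_ler mf mg measurableT (I : measurable [set true]).
by rewrite setTI; congr measurable; apply/seteqP; split.
Qed.

Lemma measurable_lt_set (f g : R * R -> R) : measurable_fun [set: R * R] f ->
  measurable_fun [set: R * R] g -> measurable [set X | f X < g X].
Proof.
move=> mf mg; have := measurable_fun_ltr mf mg measurableT (I : measurable [set true]).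
by rewrite setTI; congr measurable; apply/seteqP; split.
Qed.

Lemma measurable_octant c1 c2 p q eps : measurable (octant c1 c2 p q eps).
Proof.
pose g X : R := eps * p * (X.2 - c2) + - (eps * q) * (X.1 - c1).
pose f (X : R * R) : R := p * (X.1 - c1) + q * (X.2 - c2).
have mf : measurable_fun [set: R * R] f by exact: measurable_linear_form.
have mg : measurable_fun [set: R * R] g.
  have := measurable_linear_form (- (eps * q)) (eps * p) c1 c2.
  by congr measurable_fun; apply/funext => X; rewrite /g addrC.
have -> : octant c1 c2 p q eps =
    ([set X | 0 <= g X] `&` [set X | g X <= f X]) `&` [set X | 0 < f X].
  have gE X : eps * (p * (X.2 - c2) - q * (X.1 - c1)) = g X by rewrite /g; ring.
  apply/seteqP; split => X; rewrite /octant /= gE.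
    by move=> [/andP[h1 h2] h3].
  by move=> [[h1 h2] h3]; split => //; apply/andP.
apply: measurableI; [apply: measurableI|].
- exact: (measurable_le_set (f := fun=> 0)).
- exact: measurable_le_set.
- exact: (measurable_lt_set (f := fun=> 0)).
Qed.

Definition octant_point (c1 c2 p q eps : R) (z : R * R) : R * R :=
  let x := z.1 / Num.sqrt (1 + z.2 ^+ 2) in
  (c1 + p * x - eps * q * (x * z.2), c2 + q * x + eps * p * (x * z.2)).

Lemma octant_polar W (c1 c2 p q eps K : R) : measurable W ->
  p ^+ 2 + q ^+ 2 = 1 -> eps = 1 \/ eps = -1 -> 0 <= K ->
  (forall X, W X -> (X.1 - c1) ^+ 2 + (X.2 - c2) ^+ 2 <= K ^+ 2) ->
  exists P, [/\ measurable P,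
    forall z, P z -> [/\ 0 <= z.2 <= 1, 0 < z.1 & W (octant_point c1 c2 p q eps z)] &
    (lambda2 (W `&` octant c1 c2 p q eps) <= K%:E * lambda2 P)%E].
Proof.
move=> mW pq heps K0 WK.
have eps2 : eps * eps = 1 by case: heps => ->; rewrite ?mulrNN mulr1.
pose E := W `&` octant c1 c2 p q eps.
have mE : measurable E by apply: measurableI => //; exact: measurable_octant.
have coordx x y : p * (c1 + p * x + - (eps * q) * y - c1) + q * (c2 + q * x + eps * p * y - c2) = x.
  by transitivity ((p ^+ 2 + q ^+ 2) * x); [ring|rewrite pq mul1r].
have coordy x y : eps * (p * (c2 + q * x + eps * p * y - c2) - q * (c1 + p * x + - (eps * q) * y - c1)) = y.
  by transitivity (eps * eps * (p ^+ 2 + q ^+ 2) * y); [ring|rewrite pq eps2 !mul1r].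
exists [set z | E (octant_point c1 c2 p q eps z)]; split.
- have mx : measurable_fun [set: R * R] (fun z : R * R => z.1 / Num.sqrt (1 + z.2 ^+ 2)).
    apply: measurable_funM; first exact: measurable_fst.
    have mk : measurable_fun [set: R] (fun s : R => (Num.sqrt (1 + s ^+ 2))^-1).
      apply: continuous_measurable_fun => s; apply: cvgV; last exact: sqrt_one_add_sqr_continuous.
      by rewrite gt_eqF// sqrtr_gt0; have := sqr_ge0 s; lra.
    exact: (measurableT_comp mk measurable_snd).
  have my : measurable_fun [set: R * R] (fun z : R * R => z.1 / Num.sqrt (1 + z.2 ^+ 2) * z.2).
    by apply: measurable_funM => //; exact: measurable_snd.
  apply: (measurable_preimage2 mE).
    apply: measurable_funB; last exact: measurable_funM.
    by apply: measurable_funD => //; exact: measurable_funM.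
  apply: measurable_funD; last exact: measurable_funM.
  by apply: measurable_funD => //; exact: measurable_funM.
- move=> z; rewrite /E /octant /octant_point /=; set x := z.1 / _.
  rewrite -mulNr coordx coordy => -[Wz [/andP[h1 h2] h3]].
  have hz2 : 0 <= z.2 by rewrite -(pmulr_rge0 _ h3).
  have hz1 : z.2 <= 1 by rewrite -(ler_pM2l h3) mulr1.
  split => //; first by rewrite hz2.
  move: h3; rewrite /x; rewrite pmulr_lgt0// invr_gt0 sqrtr_gt0.
  by have := sqr_ge0 z.2; lra.
- have det : `|p * (eps * p) - - (eps * q) * q| = 1.
    have -> : p * (eps * p) - - (eps * q) * q = eps * (p ^+ 2 + q ^+ 2) by ring.
    by rewrite pq mulr1; case: heps => ->; rewrite ?normrN normr1.
  apply: (le_trans (lambda2_polar (c1 := c1) (c2 := c2) (p := p) (q := q)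
    (p' := - (eps * q)) (q' := eps * p) mE det _ K0)).
    move=> x y [Wz [/= h1 h2]]; rewrite coordx in h1 h2; rewrite coordy in h1.
    rewrite h2 /=; have := WK _ Wz => /=.
    have -> : (c1 + p * x + - (eps * q) * y - c1) ^+ 2 + (c2 + q * x + eps * p * y - c2) ^+ 2
       = (p ^+ 2 + q ^+ 2) * x ^+ 2 + eps * eps * (p ^+ 2 + q ^+ 2) * y ^+ 2 by ring.
    rewrite pq eps2 !mul1r => h.
    rewrite -[x]ger0_norm ?(ltW h2)// -[K]ger0_norm// -ler_sqr ?nnegrE// !real_normK ?num_real//.
    by have := sqr_ge0 y; lra.
  apply: lee_wpmul2l; first by rewrite lee_fin.
  by apply: le_lambda2 => z /=; rewrite /octant_point /= mulNr.
Qed.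

Lemma lambda2_cover8 W (F : bool -> bool -> bool -> set (R * R)) (X : R) :
  (forall i j k, measurable (F i j k)) ->
  (forall i j k, (lambda2 (F i j k) <= X%:E)%E) ->
  (forall z, W z -> exists i j k, F i j k z) ->
  (lambda2 W <= (8 * X)%:E)%E.
Proof.
move=> mF FX WF.
have two (G : bool -> set (R * R)) Y : (forall i, measurable (G i)) ->
    (forall i, (lambda2 (G i) <= Y%:E)%E) ->
    measurable (G true `|` G false) /\ (lambda2 (G true `|` G false) <= (2 * Y)%:E)%E.
  move=> mG GY; split; first exact: measurableU.
  apply: le_trans (lambda2U (mG _) (mG _)) _.
  by rewrite mulr2n mulrDl mul1r EFinD; apply: leeD.
pose F1 i j := F i j true `|` F i j false.
pose F2 i := F1 i true `|` F1 i false.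
have h1 i j := two (F i j) X (mF i j) (FX i j).
have h2 i := two (F1 i) (2 * X) (fun j => (h1 i j).1) (fun j => (h1 i j).2).
have [_ h3] := two F2 (2 * (2 * X)) (fun i => (h2 i).1) (fun i => (h2 i).2).
have -> : 8 * X = 2 * (2 * (2 * X)) by ring.
apply: le_trans h3; apply: le_lambda2 => z /WF[i [j [k Fz]]].
have z1 : F1 i j z by rewrite /F1; case: k Fz => ?; [left|right].
have z2 : F2 i z by rewrite /F2; case: j z1 {Fz} => ?; [left|right].
by case: i z2 {z1 Fz} => ?; [left|right].
Qed.

Definition sign_of (b : bool) : R := if b then 1 else -1.

Lemma sign_ofP b : sign_of b = 1 \/ sign_of b = -1.
Proof. by case: b; [left|right]. Qed.

Lemma octant_sign (c1 c2 p q : R) X :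
  `|p * (X.2 - c2) - q * (X.1 - c1)| <= p * (X.1 - c1) + q * (X.2 - c2) ->
  0 < p * (X.1 - c1) + q * (X.2 - c2) ->
  exists k, octant c1 c2 p q (sign_of k) X.
Proof.
move=> h1 h2; case: (leP 0 (p * (X.2 - c2) - q * (X.1 - c1))) => h.
  exists true; split => //; rewrite /sign_of mul1r h /=.
  by rewrite ger0_norm in h1.
exists false; split => //; rewrite /sign_of mulN1r.
by move: h1; rewrite ltr0_norm// => ->; rewrite andbT; lra.
Qed.

Lemma norm2_sqr (X : R * R) : norm2 X ^+ 2 = X.1 ^+ 2 + X.2 ^+ 2.
Proof. by rewrite /norm2 sqr_sqrtr// addr_ge0// sqr_ge0. Qed.

Lemma norm2_octant_point (c1 c2 p q eps : R) z : 0 <= z.1 ->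
  p ^+ 2 + q ^+ 2 = 1 -> eps = 1 \/ eps = -1 ->
  norm2 (octant_point c1 c2 p q eps z - (c1, c2)) = z.1.
Proof.
move=> z0 pq heps.
have eps2 : eps * eps = 1 by case: heps => ->; rewrite ?mulrNN mulr1.
have s0 : 0 < 1 + z.2 ^+ 2 by have := sqr_ge0 z.2; lra.
rewrite -[RHS]ger0_norm// -sqrtr_sqr /norm2 /octant_point /=; congr Num.sqrt.
set x := z.1 / _.
transitivity ((p ^+ 2 + q ^+ 2) * x ^+ 2 + eps * eps * (p ^+ 2 + q ^+ 2) * (x * z.2) ^+ 2); first by ring.
rewrite pq eps2 !mul1r /x !exprMn exprVn sqr_sqrtr ?(ltW s0)//.
by field; rewrite gt_eqF.
Qed.

Lemma measurable_norm2 (c : R * R) : measurable_fun [set: R * R] (fun X => norm2 (X - c)).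
Proof.
rewrite /norm2; apply: (@measurableT_comp _ _ _ _ _ _ (@Num.sqrt R)).
  by apply: continuous_measurable_fun; exact: sqrt_continuous.
apply: measurable_funD; apply: (measurable_funX 2); apply: measurable_funB => //.
Qed.

Lemma norm2_le_sqr (X : R * R) K : norm2 X <= K -> X.1 ^+ 2 + X.2 ^+ 2 <= K ^+ 2.
Proof.
move=> h; rewrite -norm2_sqr; have h0 : 0 <= norm2 X by exact: sqrtr_ge0.
by rewrite ler_sqr ?nnegrE// (le_trans h0).
Qed.

Lemma annulus_area (c : R * R) (r1 r2 : R) : 0 < r1 -> r1 <= r2 -> r2 <= 3 ->
  (lambda2 [set X | (r1 <= norm2 (X - c) <= r2)%R] <= (48 * (r2 - r1))%:E)%E.
Proof.
move=> r10 r12 r23; set W := [set X | _].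
have mN := measurable_norm2 c.
have mW : measurable W.
  have -> : W = [set X | r1 <= norm2 (X - c)] `&` [set X | norm2 (X - c) <= r2].
    by apply/seteqP; split => [X /andP[]//|X [/= h1 h2]]; rewrite /W /= h1.
  by apply: measurableI; [exact: (measurable_le_set (f := fun=> r1))|exact: (measurable_le_set (g := fun=> r2))].
pose dir (i j : bool) : R * R := if i then (sign_of j, 0) else (0, sign_of j).
have dir1 i j : (dir i j).1 ^+ 2 + (dir i j).2 ^+ 2 = 1.
  by case: i; case: j; rewrite /dir /sign_of /= ?sqrrN expr1n expr0n /= ?addr0 ?add0r.
pose O i j k := octant c.1 c.2 (dir i j).1 (dir i j).2 (sign_of k).
have -> : 48 * (r2 - r1) = 8 * (3 * (2 * (r2 - r1))) by ring.
apply: (@lambda2_cover8 W (fun i j k => W `&` O i j k)).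
- by move=> i j k; apply: measurableI => //; exact: measurable_octant.
- move=> i j k.
  have W3 X : W X -> (X.1 - c.1) ^+ 2 + (X.2 - c.2) ^+ 2 <= 3 ^+ 2.
    by move=> /andP[_ h]; apply: (norm2_le_sqr (X := X - c)); exact: le_trans r23.
  have [P [mP PW hP]] := octant_polar mW (dir1 i j) (sign_ofP k) (ler0n R 3) W3.
  apply: (le_trans hP); rewrite EFinM; apply: lee_wpmul2l; first by rewrite lee_fin.
  have Pr z : P z -> r1 <= z.1 <= r2.
    move=> /PW[_ z0]; rewrite /W /= -(norm2_octant_point c.1 c.2 (ltW z0) (dir1 i j) (sign_ofP k)).
    by rewrite -surjective_pairing.
  apply: lambda2_le_const => // x hx.
  have -> : 2 = 2 * 1 :> R by ring.
  apply: lambda_xsection_le => // s s' /PW[/= hs _ _] /PW[/= hs' _ _] _.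
  by lra.
- move=> X WX.
  have Xc : 0 < (X.1 - c.1) ^+ 2 + (X.2 - c.2) ^+ 2.
    have : 0 < norm2 (X - c) by move: WX; rewrite /W /= => /andP[h _]; lra.
    by rewrite sqrtr_gt0.
  have mk i j : `|(dir i j).1 * (X.2 - c.2) - (dir i j).2 * (X.1 - c.1)|
       <= (dir i j).1 * (X.1 - c.1) + (dir i j).2 * (X.2 - c.2) ->
     0 < (dir i j).1 * (X.1 - c.1) + (dir i j).2 * (X.2 - c.2) ->
     exists i j k, (W `&` O i j k) X.
    by move=> h1 h2; have [k hk] := octant_sign h1 h2; exists i, j, k.
  move: Xc mk; set x := X.1 - c.1; set y := X.2 - c.2 => Xc mk.
  have [xy|xy] := leP `|y| `|x|.
    have x0 : x != 0.
      apply/eqP => x0; move: Xc xy; rewrite x0 normr0 normr_le0 => h /eqP y0.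
      by move: h; rewrite y0 expr0n /= addr0 ltxx.
    have [xs|xs] := ltP 0 x.
      apply: (mk true true); rewrite /= mul1r !mul0r ?subr0 ?addr0 //.
      by rewrite mul1r (le_trans xy)// gtr0_norm.
    have xs' : x < 0 by rewrite lt_neqAle x0.
    apply: (mk true false); rewrite /= !mulN1r !mul0r ?subr0 ?addr0 ?oppr_gt0 //.
    by rewrite normrN (le_trans xy)// ltr0_norm.
  have y0 : y != 0 by apply/eqP => y0; move: xy; rewrite y0 normr0 ltNge normr_ge0.
  have [ys|ys] := ltP 0 y.
    apply: (mk false true); rewrite /= !mul1r !mul0r ?sub0r ?add0r //.
    by rewrite normrN (le_trans (ltW xy))// gtr0_norm.
  have ys' : y < 0 by rewrite lt_neqAle y0.
  apply: (mk false false); rewrite /= !mulN1r !mul0r ?sub0r ?add0r ?oppr_gt0 //.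
  by rewrite opprK (le_trans (ltW xy))// ltr0_norm.
Qed.

End Planar.

Section Incidence.
Context {R : realType}.
Implicit Types P W : set (R * R).

Definition incidence (p t1 s0 e : R) (X0 : R * R) (f1 f2 : R -> R) : set (R * R) :=
  [set X | [/\ p <= norm2 X <= t1, p <= norm2 (X - X0) <= t1 &
             `|f1 (norm2 X) - s0 - f2 (norm2 (X - X0))| <= e]].

Lemma measurable_incidence (p t1 s0 e : R) X0 (f1 f2 : R -> R) :
  measurable_fun [set: R] f1 -> measurable_fun [set: R] f2 ->
  measurable (incidence p t1 s0 e X0 f1 f2).
Proof.
move=> m1 m2; have n2 := measurable_norm2 X0.
have n1 : measurable_fun [set: R * R] (@norm2 R).
  by have := measurable_norm2 (0 : R * R); congr measurable_fun; apply/funext => X; rewrite subr0.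
pose h X : R := f1 (norm2 X) - s0 - f2 (norm2 (X - X0)).
have mh : measurable_fun [set: R * R] h.
  apply: measurable_funB; last exact: (measurableT_comp m2 n2).
  by apply: measurable_funB => //; exact: (measurableT_comp m1 n1).
have mah : measurable_fun [set: R * R] (fun X => `|h X|) by exact: measurableT_comp.
have -> : incidence p t1 s0 e X0 f1 f2 =
    ([set X | p <= norm2 X] `&` [set X | norm2 X <= t1]) `&`
    (([set X | p <= norm2 (X - X0)] `&` [set X | norm2 (X - X0) <= t1]) `&` [set X | `|h X| <= e]).
  apply/seteqP; split => X /=; first by move=> [/andP[? ?] /andP[? ?] ?].
  by move=> [[h1 h2] [[h3 h4] h5]]; split => //; apply/andP.
apply: measurableI; [|apply: measurableI => //]; try apply: measurableI.
- exact: (measurable_le_set (f := fun=> p)).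
- exact: (measurable_le_set (g := fun=> t1)).
- exact: (measurable_le_set (f := fun=> p)).
- exact: (measurable_le_set (g := fun=> t1)).
- exact: (measurable_le_set (g := fun=> e)).
Qed.

Lemma unit_direction (X : R * R) : exists p q : R, p ^+ 2 + q ^+ 2 = 1 /\
  X = (norm2 X * p, norm2 X * q).
Proof.
have [n0|n0] := eqVneq (norm2 X) 0.
  exists 1, 0; rewrite expr1n expr0n addr0 n0 !mul0r; split => //.
  have : X.1 ^+ 2 + X.2 ^+ 2 = 0 by rewrite -norm2_sqr n0 expr0n.
  move/eqP; rewrite paddr_eq0 ?sqr_ge0// !sqrf_eq0 => /andP[/eqP h1 /eqP h2].
  by rewrite [X]surjective_pairing h1 h2.
exists (X.1 / norm2 X), (X.2 / norm2 X); split.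
  by rewrite !exprMn -mulrDl -norm2_sqr -exprMn divff// expr1n.
by rewrite [LHS]surjective_pairing; congr pair; field.
Qed.

Lemma incidence_area (p t1 s0 e B : R) (X0 : R * R) (f1 f2 : R -> R) :
  0 < p -> t1 <= 2 -> measurable_fun [set: R] f1 -> measurable_fun [set: R] f2 ->
  (forall w P, octant_cosine w -> measurable P ->
     (forall z, P z -> octant_incidence p t1 (norm2 X0) s0 e w f1 f2 z) ->
     (lambda2 P <= B%:E)%E) ->
  (forall w P, octant_cosine w -> measurable P ->
     (forall z, P z -> octant_incidence p t1 (norm2 X0) (- s0) e w f2 f1 z) ->
     (lambda2 P <= B%:E)%E) ->
  (lambda2 (incidence p t1 s0 e X0 f1 f2) <= (16 * B)%:E)%E.
Proof.
move=> p0 t12 m1 m2 H12 H21; set W := incidence _ _ _ _ _ _ _.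
have mW : measurable W by exact: measurable_incidence.
have [a [b [ab X0E]]] := unit_direction X0.
set n := norm2 X0 in X0E H12 H21.
pose cen (i j : bool) : R * R := if i && ~~ j then X0 else 0.
pose dir (i j : bool) : R * R :=
  if i then (sign_of j * a, sign_of j * b) else (- (sign_of j * b), sign_of j * a).
have sgn2 j : sign_of j ^+ 2 = 1 :> R by case: j; rewrite /sign_of ?sqrrN expr1n.
have dir1 i j : (dir i j).1 ^+ 2 + (dir i j).2 ^+ 2 = 1.
  by case: i; rewrite /dir /= ?sqrrN !exprMn sgn2 !mul1r // addrC.
pose O i j k := octant (cen i j).1 (cen i j).2 (dir i j).1 (dir i j).2 (sign_of k).
have -> : 16 * B = 8 * (2 * B) by ring.
apply: (@lambda2_cover8 R W (fun i j k => W `&` O i j k)).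
- by move=> i j k; apply: measurableI => //; exact: measurable_octant.
- move=> i j k.
  have W2 X : W X -> (X.1 - (cen i j).1) ^+ 2 + (X.2 - (cen i j).2) ^+ 2 <= 2 ^+ 2.
    move=> [/andP[_ h1] /andP[_ h2] _]; rewrite /cen; case: (i && ~~ j).
      by apply: (norm2_le_sqr (X := X - X0)); exact: le_trans t12.
    by rewrite !subr0; apply: norm2_le_sqr; exact: le_trans t12.
  have [P [mP PW hP]] := octant_polar mW (dir1 i j) (sign_ofP k) (ler0n R 2) W2.
  apply: (le_trans hP); rewrite EFinM; apply: lee_wpmul2l; first by rewrite lee_fin.
  have PX z : P z -> let X := octant_point (cen i j).1 (cen i j).2 (dir i j).1 (dir i j).2 (sign_of k) z in
      [/\ 0 <= z.2 <= 1, norm2 (X - cen i j) = z.1 & W X].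
    move=> /PW[h1 h2 h3]; split => //.
    by rewrite -[RHS](norm2_octant_point (cen i j).1 (cen i j).2 (ltW h2) (dir1 i j) (sign_ofP k)) -surjective_pairing.
  have q2 (s : R) : Num.sqrt (1 + s ^+ 2) ^+ 2 = 1 + s ^+ 2.
    by rewrite sqr_sqrtr//; have := sqr_ge0 s; lra.
  have qn0 (s : R) : Num.sqrt (1 + s ^+ 2) != 0.
    by rewrite gt_eqF// sqrtr_gt0; have := sqr_ge0 s; lra.
  have xq (z : R * R) : z.1 ^+ 2 = (1 + z.2 ^+ 2) * (z.1 / Num.sqrt (1 + z.2 ^+ 2)) ^+ 2.
    by rewrite exprMn exprVn q2 mulrCA divff ?mulr1// -q2 expf_neq0.
  have sk2 := sgn2 k; have sj2 := sgn2 j.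
  case: i dir1 PX {hP PW W2} => dir1 PX; last first.
    apply: (H12 (fun s => - (sign_of k * sign_of j) * (s / Num.sqrt (1 + s ^+ 2)))) => //.
      right; exists (- (sign_of k * sign_of j)) => //.
      by case: (j); case: (k); rewrite /sign_of ?mulrNN ?mulr1 ?mulrN1 ?opprK; [right|left|left|right].
    move=> z /PX[hz nX WX]; move: nX WX; set X := octant_point _ _ _ _ _ _.
    rewrite /cen /= subr0 => nX [h1 h2 h3]; rewrite nX in h1 h3.
    split => //; exists (norm2 (X - X0)); split => //.
    rewrite norm2_sqr X0E /X /octant_point /cen /dir /=.
    have := xq z; set x := z.1 / _ => ->.
    rewrite (_ : 2 * n * z.1 * _ = - 2 * n * (sign_of k * sign_of j) * (x * z.2)); last by rewrite /x; ring.
    transitivity ((a ^+ 2 + b ^+ 2) * (sign_of j ^+ 2 * x ^+ 2 + sign_of k ^+ 2 * sign_of j ^+ 2 * (x * z.2) ^+ 2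
       + n ^+ 2 + 2 * n * (sign_of k * sign_of j) * (x * z.2))); first by ring.
    by rewrite ab sk2 sj2; ring.
  case: j dir1 PX sj2 => dir1 PX sj2.
    apply: (H12 (fun s => (Num.sqrt (1 + s ^+ 2))^-1)) => //; first by left.
    move=> z /PX[hz nX WX]; move: nX WX; set X := octant_point _ _ _ _ _ _.
    rewrite /cen /= subr0 => nX [h1 h2 h3]; rewrite nX in h1 h3.
    split => //; exists (norm2 (X - X0)); split => //.
    rewrite norm2_sqr X0E /X /octant_point /cen /dir /=.
    have := xq z; set x := z.1 / _ => ->.
    rewrite (_ : 2 * n * z.1 * _ = 2 * n * x); last by rewrite /x; ring.
    rewrite !mul1r.
    transitivity ((a ^+ 2 + b ^+ 2) * (x ^+ 2 + sign_of k ^+ 2 * (x * z.2) ^+ 2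
       + n ^+ 2 - 2 * n * x)); first by ring.
    by rewrite ab sk2; ring.
  apply: (H21 (fun s => (Num.sqrt (1 + s ^+ 2))^-1)) => //; first by left.
  move=> z /PX[hz nX WX]; move: nX WX; set X := octant_point _ _ _ _ _ _.
  rewrite /cen /= => nX [h1 h2 h3]; rewrite nX in h2 h3.
  split => //; exists (norm2 X); split => //.
    rewrite norm2_sqr /X /octant_point /cen /dir /= X0E /=.
    have := xq z; set x := z.1 / _ => ->.
    rewrite (_ : 2 * n * z.1 * _ = 2 * n * x); last by rewrite /x; ring.
    transitivity ((a ^+ 2 + b ^+ 2) * (x ^+ 2 + sign_of k ^+ 2 * (x * z.2) ^+ 2
       + n ^+ 2 - 2 * n * x)); first by rewrite /sign_of; ring.
    by rewrite ab sk2; ring.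
  by rewrite opprK -normrN; congr (`|_| <= _): h3; ring.
- move=> X WX; have [/andP[nX _] /andP[nX0 _] _] := WX.
  pose al := a * X.1 + b * X.2; pose be := a * X.2 - b * X.1.
  have sqE : al ^+ 2 + be ^+ 2 = X.1 ^+ 2 + X.2 ^+ 2.
    rewrite -[RHS]mul1r -ab /al /be; ring.
  have nn : 0 < al ^+ 2 + be ^+ 2 by rewrite sqE -norm2_sqr exprn_gt0//; lra.
  have nn0 : 0 < (n - al) ^+ 2 + be ^+ 2.
    have -> : (n - al) ^+ 2 + be ^+ 2 = (X - X0).1 ^+ 2 + (X - X0).2 ^+ 2.
      transitivity (X.1 ^+ 2 + X.2 ^+ 2 - 2 * n * al + n ^+ 2 * (a ^+ 2 + b ^+ 2)).
        by rewrite ab mulr1 -sqE; ring.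
      by rewrite X0E /al /=; ring.
    by rewrite -norm2_sqr exprn_gt0//; lra.
  have pos (x y : R) : 0 < x ^+ 2 + y ^+ 2 -> `|y| <= x -> 0 < x.
    move=> h1 h2; rewrite lt_neqAle (le_trans _ h2)// andbT; apply/eqP => x0.
    move: h1 h2; rewrite -x0 normr_le0 expr0n add0r => + /eqP y0.
    by rewrite y0 expr0n /= ltxx.
  pose crs i j := (dir i j).1 * (X.2 - (cen i j).2) - (dir i j).2 * (X.1 - (cen i j).1).
  pose dot i j := (dir i j).1 * (X.1 - (cen i j).1) + (dir i j).2 * (X.2 - (cen i j).2).
  have mk i j : `|crs i j| <= dot i j -> 0 < dot i j -> exists i j k, (W `&` O i j k) X.
    by move=> h1 h2; have [k hk] := octant_sign h1 h2; exists i, j, k.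
  have [e1 e2] : crs true true = be /\ dot true true = al.
    by rewrite /crs /dot /dir /cen /sign_of /be /al /= !subr0; split; ring.
  have [e3 e4] : crs true false = - be /\ dot true false = n - al.
    rewrite /crs /dot /dir /cen /sign_of /be /al X0E /=; split; first by ring.
    by transitivity ((a ^+ 2 + b ^+ 2) * n - (a * X.1 + b * X.2)); [ring|rewrite ab mul1r].
  have [e5 e6] : crs false true = - al /\ dot false true = be.
    by rewrite /crs /dot /dir /cen /sign_of /be /al /= !subr0; split; ring.
  have [e7 e8] : crs false false = al /\ dot false false = - be.
    by rewrite /crs /dot /dir /cen /sign_of /be /al /= !subr0; split; ring.
  have [c1|c1] := leP `|be| al.
    by apply: (mk true true); rewrite ?e1 e2//; exact: pos c1.
  have [c2|c2] := leP `|be| (n - al).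
    by apply: (mk true false); rewrite ?e3 e4 ?normrN//; exact: pos c2.
  have ab' : `|al| <= `|be|.
    have n0 : 0 <= n by exact: sqrtr_ge0.
    by rewrite ler_norml; apply/andP; split; lra.
  have [bs|bs] := ltP 0 be.
    by apply: (mk false true); rewrite ?e5 e6 ?normrN// (le_trans ab')// gtr0_norm.
  have bs' : be < 0.
    rewrite lt_neqAle bs andbT; apply/eqP => b0; move: c1 ab'; rewrite b0 normr0 normr_le0 => h /eqP al0.
    by move: h; rewrite al0 ltxx.
  by apply: (mk false false); rewrite ?e7 e8 ?oppr_gt0// (le_trans ab')// ltr0_norm.
Qed.

End Incidence.

Section Volume.
Context {R : realType}.

Lemma norm2_ge0 (X : R * R) : 0 <= norm2 X.
Proof. exact: sqrtr_ge0. Qed.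

Lemma norm2_triangle (X Y : R * R) : norm2 (X + Y) <= norm2 X + norm2 Y.
Proof.
have X0 := norm2_ge0 X; have Y0 := norm2_ge0 Y.
have cs : X.1 * Y.1 + X.2 * Y.2 <= norm2 X * norm2 Y.
  rewrite leNgt; apply/negP => h.
  have : (norm2 X * norm2 Y) ^+ 2 < (X.1 * Y.1 + X.2 * Y.2) ^+ 2.
    by rewrite ltr_sqr ?nnegrE ?mulr_ge0// (le_trans _ (ltW h))// mulr_ge0.
  rewrite exprMn !norm2_sqr; have := sqr_ge0 (X.1 * Y.2 - X.2 * Y.1); nra.
rewrite -ler_sqr ?nnegrE ?norm2_ge0 ?addr_ge0//.
rewrite [leLHS]norm2_sqr [leRHS]sqrrD !norm2_sqr /= -mulr_natr; nra.
Qed.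

Lemma norm2_dist (X Y : R * R) : `|norm2 X - norm2 Y| <= norm2 (X - Y).
Proof.
have h1 := norm2_triangle (X - Y) Y; rewrite subrK in h1.
have h2 := norm2_triangle (Y - X) X; rewrite subrK in h2.
have sym : norm2 (Y - X) = norm2 (X - Y).
  by rewrite /norm2 /=; congr Num.sqrt; ring.
by rewrite ler_norml; apply/andP; split; lra.
Qed.

Lemma norm3_parts (y : R * R * R) : norm2 y.1 <= norm3 y /\ `|y.2| <= norm3 y.
Proof.
split; first by rewrite /norm2 /norm3 ler_wsqrtr// lerDl sqr_ge0.
by rewrite -sqrtr_sqr /norm3 ler_wsqrtr// lerDr addr_ge0// sqr_ge0.
Qed.

Lemma nbhd_Gamma_point (p t1 M delta : R) (g : R -> R -> R) a (f : R -> R) z :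
  (forall t, p <= t <= t1 -> g a t = f t) ->
  (forall x y, `|f x - f y| <= M * `|x - y|) -> 0 <= M ->
  nbhd (Gamma `[p, t1] g a) delta z ->
  [/\ p - delta <= norm2 z.1 <= t1 + delta, 0 <= delta &
     `|z.2 - f (norm2 z.1)| <= (1 + M) * delta].
Proof.
move=> gf fL M0 [x [X]]; rewrite /= in_itv/= => hX <- {x} [y yd <-] /=.
rewrite gf//; have [y1 y2] := norm3_parts y.
have nd : `|norm2 X - norm2 (X + y.1)| <= delta.
  apply: (le_trans (norm2_dist _ _)); rewrite opprD addrA subrr sub0r.
  have -> : norm2 (- y.1) = norm2 y.1 by rewrite /norm2 /= !sqrrN.
  by rewrite (le_trans y1)// ltW.
have d0 : 0 <= delta by exact: le_trans nd.
split => //; first by move: nd; rewrite ler_norml => /andP[? ?]; lra.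
have -> : f (norm2 X) + y.2 - f (norm2 (X + y.1)) = y.2 + (f (norm2 X) - f (norm2 (X + y.1))) by ring.
apply: (le_trans (ler_normD _ _)); rewrite mulrDl mul1r; apply: lerD.
  by rewrite (le_trans y2)// ltW.
by apply: (le_trans (fL _ _)); rewrite ler_wpM2l.
Qed.

Lemma lipschitz_measurable (f : R -> R) (M : R) :
  (forall x y, `|f x - f y| <= M * `|x - y|) -> measurable_fun [set: R] f.
Proof.
move=> fL; apply: continuous_measurable_fun => x.
have K0 : 0 < Num.max M 0 + 1 by rewrite ltr_wpDl// le_max lexx orbT.
apply/cvgrPdist_le => e e0; near=> y.
apply: (le_trans (fL x y)); apply: (@le_trans _ _ ((Num.max M 0 + 1) * `|x - y|)).
  by rewrite ler_wpM2r// (@le_trans _ _ (Num.max M 0)) ?le_max ?lexx// lerDl.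
rewrite -ler_pdivlMl// mulrC; near: y; apply: cvgr_dist_le; first exact: cvg_id.
by rewrite divr_gt0.
Unshelve. all: by end_near. Qed.

Lemma overlap_volume (p t1 M delta Bd : R) (tau : R * R * R) (g : R -> R -> R)
    (a abar : R) (f1 f2 : R -> R) :
  1 <= p -> p <= t1 -> t1 <= 2 -> 0 <= M -> 0 < delta -> delta < 1 -> 0 <= Bd ->
  (forall t, p <= t <= t1 -> g abar t = f1 t) ->
  (forall t, p <= t <= t1 -> g a t = f2 t) ->
  (forall x y, `|f1 x - f1 y| <= M * `|x - y|) ->
  (forall x y, `|f2 x - f2 y| <= M * `|x - y|) ->
  (lambda2 (incidence p t1 tau.2 (2 * (1 + M) * delta) tau.1 f1 f2) <= Bd%:E)%E ->
  (volume (translate (nbhd (Gamma `[p, t1] g a) delta) tau `&`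
           nbhd (Gamma `[p, t1] g abar) delta)
    <= (4 * (1 + M) * delta * (Bd + 384 * delta))%:E)%E.
Proof.
move=> p1 pt t12 M0 d0 d1 Bd0 gf1 gf2 L1 L2 hB.
set S := _ `&` _; set W := incidence _ _ _ _ _ _ _ in hB.
have Sz z : S z -> [/\ p - delta <= norm2 z.1 <= t1 + delta,
    p - delta <= norm2 (z.1 - tau.1) <= t1 + delta,
    `|z.2 - f1 (norm2 z.1)| <= (1 + M) * delta &
    `|z.2 - tau.2 - f2 (norm2 (z.1 - tau.1))| <= (1 + M) * delta].
  move=> [[x hx <-]] /(nbhd_Gamma_point gf1 L1 M0)[h1 _ h2].
  have [h3 _ h4] := nbhd_Gamma_point gf2 L2 M0 hx.
  have e1 : (x + tau).1 - tau.1 = x.1 by rewrite /= addrK.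
  have e2 : (x + tau).2 - tau.2 = x.2 by rewrite /= addrK.
  by rewrite e1 e2.
have mW : measurable W.
  by apply: measurable_incidence; apply: lipschitz_measurable; [exact: L1|exact: L2].
have [A AE] : exists A : bool -> bool -> set (R * R), A = fun i j =>
   [set X | (if i then t1 else p) - delta <= norm2 (X - (if j then tau.1 else 0))
       <= (if i then t1 else p) + delta] by eexists.
have mA i j : measurable (A i j).
  rewrite AE; set c := if j then _ else _; set t := if i then _ else _.
  have mN := measurable_norm2 c.
  have -> : [set X | t - delta <= norm2 (X - c) <= t + delta] =
     [set X | t - delta <= norm2 (X - c)] `&` [set X | norm2 (X - c) <= t + delta].
    by apply/seteqP; split => X /= => [/andP[]//|[-> ->]].
  by apply: measurableI; [exact: (measurable_le_set (f := fun=> t - delta))|exact: (measurable_le_set (g := fun=> t + delta))].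
have lA i j : (lambda2 (A i j) <= (96 * delta)%:E)%E.
  rewrite AE; set c := if j then _ else _; set t := if i then _ else _.
  have tb : p <= t <= t1 by rewrite /t; case: (i); rewrite ?lexx ?pt.
  have [h1 h2 h3] : [/\ 0 < t - delta, t - delta <= t + delta & t + delta <= 3].
    by clear - tb p1 t12 d0 d1; split; lra.
  have := @annulus_area R c (t - delta) (t + delta) h1 h2 h3.
  by rewrite (_ : 48 * (t + delta - (t - delta)) = 96 * delta); last by ring.
pose W' := W `|` ((A true true `|` A true false) `|` (A false true `|` A false false)).
have mW1 := measurableU _ _ (mA true true) (mA true false).
have mW2 := measurableU _ _ (mA false true) (mA false false).
have mW' : measurable W' by apply: measurableU => //; exact: measurableU.
have hW' : (lambda2 W' <= (Bd + 384 * delta)%:E)%E.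
  rewrite (_ : Bd + 384 * delta = Bd + ((96 * delta + 96 * delta) + (96 * delta + 96 * delta))); last by ring.
  apply: (le_trans (lambda2U mW (measurableU _ _ mW1 mW2))); rewrite EFinD; apply: leeD; first exact: hB.
  apply: (le_trans (lambda2U mW1 mW2)); rewrite EFinD; apply: leeD.
    by apply: (le_trans (lambda2U (mA _ _) (mA _ _))); rewrite EFinD; apply: leeD.
  by apply: (le_trans (lambda2U (mA _ _) (mA _ _))); rewrite EFinD; apply: leeD.
have hd : 0 <= (1 + M) * delta by rewrite mulr_ge0 ?addr_ge0// ltW.
have h0 : 0 <= 4 * (1 + M) * delta by rewrite -mulrA mulr_ge0.
have SW z : S z -> W' z.1.
  move=> /Sz[h1 h2 h3 h4].
  have split1 (r : R) : p - delta <= r <= t1 + delta ->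
      p <= r <= t1 \/ (exists i, (if i then t1 else p) - delta <= r <= (if i then t1 else p) + delta).
    move=> /andP[r1 r2]; have [h|h] := leP p r.
      have [h'|h'] := leP r t1; first by left.
      by right; exists true; rewrite r2 andbT; clear - h' d0; lra.
    by right; exists false; rewrite r1; clear - h d0; lra.
  have inA i j : (if i then t1 else p) - delta <= norm2 (z.1 - (if j then tau.1 else 0))
       <= (if i then t1 else p) + delta -> W' z.1.
    have -> : ((if i then t1 else p) - delta <= norm2 (z.1 - (if j then tau.1 else 0))
       <= (if i then t1 else p) + delta) = (A i j z.1) :> Prop by rewrite AE.
    by move=> h; right; case: i h; case: j => h; [left; left|left; right|right; left|right; right].
  have [k1|[i hi]] := split1 _ h1; last by apply: (inA i false); rewrite subr0.
  have [k2|[i hi]] := split1 _ h2; last exact: (inA i true).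
  left; split => //.
  have -> : f1 (norm2 z.1) - tau.2 - f2 (norm2 (z.1 - tau.1)) =
     (z.2 - tau.2 - f2 (norm2 (z.1 - tau.1))) - (z.2 - f1 (norm2 z.1)) by ring.
  by apply: (le_trans (ler_normB _ _)); clear - h3 h4; lra.
have hsec X : W' X -> (lambda (xsection S X) <= (4 * (1 + M) * delta)%:E)%E.
  move=> _; rewrite (_ : 4 * (1 + M) * delta = 2 * (2 * ((1 + M) * delta))); last by ring.
  apply: lambda_diam; first by rewrite mulr_ge0.
  move=> x y; rewrite /xsection/= !inE => /Sz[/= _ _ hx _] /Sz[/= _ _ hy _] xy.
  by move: hx hy; rewrite !ler_norml => /andP[? ?] /andP[? ?]; clear hd h0 Bd0 M0 p1 pt t12 d0 d1; lra.
apply: (le_trans (volume_le mW' h0 SW hsec)).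
by rewrite [leRHS]EFinM; apply: lee_wpmul2l; rewrite ?lee_fin.
Qed.

End Volume.

Section CurvedFamilies.
Context {R : realType}.

Definition clamp (p t1 x : R) : R := Num.max p (Num.min x t1).

Lemma clamp_in p t1 x : p <= t1 -> p <= clamp p t1 x <= t1.
Proof. by move=> pt; rewrite /clamp; case: (leP x t1) => h; [case: (leP p x)|case: (leP p t1)] => h'; lra. Qed.

Lemma clamp_id p t1 x : p <= x <= t1 -> clamp p t1 x = x.
Proof. by move=> /andP[h1 h2]; rewrite /clamp min_l// max_r. Qed.

Lemma clamp_lipschitz p t1 x y : p <= t1 -> `|clamp p t1 x - clamp p t1 y| <= `|x - y|.
Proof.
move=> pt; have h (u v : R) : u <= v -> 0 <= clamp p t1 v - clamp p t1 u <= v - u.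
  move=> uv; rewrite /clamp.
  have : 0 <= Num.min v t1 - Num.min u t1 <= v - u.
    by case: (leP u t1) => h1; case: (leP v t1) => h2; lra.
  by case: (leP p (Num.min u t1)) => h3; case: (leP p (Num.min v t1)) => h4; lra.
have [xy|/ltW xy] := leP x y; have /andP[h1 h2] := h _ _ xy.
  have c0 : clamp p t1 x - clamp p t1 y <= 0 by lra.
  have x0 : x - y <= 0 by lra.
  by rewrite (ler0_norm c0) (ler0_norm x0); lra.
have x0 : 0 <= x - y by lra.
by rewrite (ger0_norm h1) (ger0_norm x0).
Qed.

Lemma curved_overlap (ell : bool) (len M m lam kap : R) :
  0 < len -> 0 < M -> 0 < m -> 0 < lam -> 0 < kap ->
  exists C : R, forall (t0 t1 D delta : R) (g : R -> R -> R) (a abar : R),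
    1 <= t0 -> t0 < t1 -> t1 <= 2 -> t1 - t0 = len -> 0 <= D ->
    0 < delta < max_scale ell ->
    (forall b x y, b = a \/ b = abar -> t0 <= x <= t1 -> t0 <= y <= t1 ->
       `|g b x - g b y| <= M * `|x - y|) ->
    (0 < D -> exists2 sg : R, sg = 1 \/ sg = -1 & exists u1 v1 u2 v2,
       curved_pair ell t0 t1 M m lam kap D (fun t => sg * g abar t) u1 v1 (fun t => sg * g a t) u2 v2 /\
       curved_pair ell t0 t1 M m lam kap D (fun t => sg * g a t) u2 v2 (fun t => sg * g abar t) u1 v1) ->
    forall tau, (volume (translate (nbhd (Gamma (right_half t0 t1) g a) delta) tau `&`
           nbhd (Gamma (right_half t0 t1) g abar) delta)
      <= (C * (delta ^+ 2 * log_loss ell delta / (delta + D)))%:E)%E.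
Proof.
move=> len0 M0 m0 lam0 kap0.
have K1 : 1 <= 2 * (1 + M) by lra.
have [C C0 hC] := octant_bound ell len0 M0 m0 lam0 kap0 K1.
have [cL cL0 hL] := @log_loss_lower R ell.
exists (4 * (1 + M) * (864 * cL + (32 * C + 384 * (1 + M / lam) * cL))).
move=> t0 t1 D delta g a abar t01 tlt t12 tlen D0 hd gL gP tau.
have L1 := hL _ hd; have /andP[d0 dmax] := hd.
have d1 : delta < 1 by move: dmax; rewrite /max_scale; case: (ell) => // h; clear - h; lra.
have L0 : 0 <= log_loss ell delta by rewrite /log_loss; case: (ell).
set L := log_loss ell delta in L0 L1 *.
have -> : right_half t0 t1 = `[t1 - len / 2, t1]%classic by rewrite /right_half tlen.
set p := t1 - len / 2.
have p1 : 1 <= p by rewrite /p; clear - t01 tlen len0; lra.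
have pt : p <= t1 by rewrite /p; clear - len0; lra.
have pI x : p <= x <= t1 -> t0 <= x <= t1 by rewrite /p => h; clear - h tlen len0; lra.
pose f1 t := g abar (clamp p t1 t); pose f2 t := g a (clamp p t1 t).
have gf1 t : p <= t <= t1 -> g abar t = f1 t by move=> h; rewrite /f1 clamp_id.
have gf2 t : p <= t <= t1 -> g a t = f2 t by move=> h; rewrite /f2 clamp_id.
have fL b : b = a \/ b = abar -> forall x y, `|g b (clamp p t1 x) - g b (clamp p t1 y)| <= M * `|x - y|.
  move=> hb x y; apply: (le_trans (gL _ _ _ hb (pI _ (clamp_in x pt)) (pI _ (clamp_in y pt)))).
  by rewrite ler_wpM2l ?(ltW M0)// clamp_lipschitz.
have L1f := fL abar (or_intror erefl); have L2f := fL a (or_introl erefl).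
have dD : 0 < delta + D by rewrite ltr_wpDr.
have vol Bd h area := @overlap_volume R p t1 M delta Bd tau g a abar f1 f2 p1 pt t12 (ltW M0) d0 d1 h gf1 gf2 L1f L2f area.
have dL : delta <= delta * (cL * L) by rewrite ler_pMr.
have dL0 : 0 <= delta * (cL * L) by exact: le_trans (ltW d0) dL.
have M4 : 0 <= 4 * (1 + M) * delta by rewrite mulr_ge0 ?(ltW d0)//; clear - M0; lra.
have i1 : 0 < M / lam by rewrite divr_gt0.
have [Dd|Dd] := leP D delta.
  have area : (lambda2 (incidence p t1 tau.2 (2 * (1 + M) * delta) tau.1 f1 f2) <= 48%:E)%E.
    have p3 : t1 <= 3 by clear - t12; lra.
    have := annulus_area 0 (lt_le_trans ltr01 p1) pt p3.
    move=> h; apply: le_trans (le_trans h _).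
      by apply: le_lambda2 => X [hX _ _] /=; rewrite subr0.
    by rewrite lee_fin; clear - p1 t12; lra.
  apply: (le_trans (vol 48 _ area)); first by rewrite ler0n.
  rewrite lee_fin.
  have -> : 4 * (1 + M) * (864 * cL + (32 * C + 384 * (1 + M / lam) * cL)) * (delta ^+ 2 * L / (delta + D))
     = 4 * (1 + M) * delta * ((864 * cL + (32 * C + 384 * (1 + M / lam) * cL)) * (delta * L / (delta + D))) by ring.
  apply: ler_wpM2l => //.
  rewrite mulrA ler_pdivlMr//.
  have h1 : 48 + 384 * delta <= 432 by clear - d1; lra.
  have h2 : (48 + 384 * delta) * (delta + D) <= 432 * (2 * delta).
    by apply: ler_pM; [clear - d0; lra|exact: ltW|exact: h1|clear - Dd; lra].
  apply: (le_trans h2).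
  have h3 : 0 <= 32 * C * (delta * L) by rewrite !mulr_ge0 ?(ltW d0) ?ler0n.
  have h4 : 0 <= (1 + M / lam) * (delta * (cL * L)) by rewrite mulr_ge0// addr_ge0// ltW.
  by clear - h3 h4 dL; lra.
have D1 : 0 < D by exact: lt_trans Dd.
have [sg hsg [u1 [v1 [u2 [v2 [cp12 cp21]]]]]] := gP D1.
have DM : D <= M / lam.
  rewrite ler_pdivlMr// mulrC; exact: (curved_pair_shift_le cp12 m0 (ltW tlt)).
have sgn (x : R) : `|sg * x| = `|x| by case: hsg => ->; rewrite ?mul1r ?mulN1r ?normrN.
have transfer (h1 h2 : R -> R) (f f' : R -> R) s0 b w z :
    (forall t, p <= t <= t1 -> f t = h1 t) -> (forall t, p <= t <= t1 -> f' t = h2 t) ->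
    octant_incidence p t1 b s0 (2 * (1 + M) * delta) w f f' z ->
    octant_incidence p t1 b (sg * s0) (2 * (1 + M) * delta) w (fun t => sg * h1 t) (fun t => sg * h2 t) z.
  move=> e1 e2 [hz hs [rho [hrho E he]]]; split => //; exists rho; split => //.
  by rewrite -e1// -e2// -!mulrBr sgn.
pose B := C * (delta / D * L).
have B0 : 0 <= B by rewrite mulr_ge0// mulr_ge0// divr_ge0// ltW.
have area : (lambda2 (incidence p t1 tau.2 (2 * (1 + M) * delta) tau.1 f1 f2) <= (16 * B)%:E)%E.
  apply: incidence_area => //.
  - exact: lt_le_trans p1.
  - exact: lipschitz_measurable L1f.
  - exact: lipschitz_measurable L2f.
  - move=> w P hw mP PI; apply: (hC _ _ _ _ _ _ _ _ _ _ _ _ _ _ cp12 t01 t12 tlen D1 hd (norm2_ge0 _) hw mP) => z /PI.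
    by apply: transfer => t ht; [rewrite gf1|rewrite gf2].
  - move=> w P hw mP PI; apply: (hC _ _ _ _ _ _ _ _ _ _ _ _ _ _ cp21 t01 t12 tlen D1 hd (norm2_ge0 _) hw mP) => z /PI.
    by apply: transfer => t ht; [rewrite gf2|rewrite gf1].
apply: (le_trans (vol (16 * B) _ area)); first by rewrite mulr_ge0.
rewrite lee_fin.
have -> : 4 * (1 + M) * (864 * cL + (32 * C + 384 * (1 + M / lam) * cL)) * (delta ^+ 2 * L / (delta + D))
   = 4 * (1 + M) * delta * ((864 * cL + (32 * C + 384 * (1 + M / lam) * cL)) * (delta * L / (delta + D))) by ring.
apply: ler_wpM2l => //.
rewrite mulrA ler_pdivlMr// mulrDl.
have CdL : 0 <= C * (delta * L) by rewrite !mulr_ge0// ltW.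
have h1 : 16 * B * (delta + D) <= 32 * (C * (delta * L)).
  have -> : 16 * B * (delta + D) = 16 * (C * (delta * L)) * ((delta + D) / D).
    by rewrite /B; field; rewrite gt_eqF.
  have -> : 32 * (C * (delta * L)) = 16 * (C * (delta * L)) * 2 by ring.
  apply: ler_wpM2l; first by clear - CdL; lra.
  by rewrite ler_pdivrMr//; clear - Dd; lra.
have h2 : 384 * delta * (delta + D) <= 384 * (delta * (cL * L)) * (1 + M / lam).
  apply: ler_pM; [by clear - d0; lra|exact: ltW|by clear - dL; lra|by clear - d1 DM; lra].
by clear - h1 h2 dL0; lra.
Qed.

End CurvedFamilies.

Section Derivatives.
Context {R : realType}.

Lemma quotient_near (a b x : R) (f : R -> R) (e : R) : derivable_in `[a, b] f x -> 0 < e ->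
  exists2 d, 0 < d & forall y, a <= y <= b -> y != x -> `|x - y| < d ->
    `|derivative_in `[a, b] f x - quotient f x y| <= e.
Proof.
move=> df e0; have /cvgrPdist_le /(_ e e0) := df.
rewrite -/(derivative_in _ _ _) near_withinE => -[d /= d0 h].
exists d => // y yab yx xy; exact: h.
Qed.

Lemma derivative_in_interior (a b x : R) (f : R -> R) : a < x < b ->
  derivable_in `[a, b] f x -> is_derive x 1 f (derivative_in `[a, b] f x).
Proof.
move=> xab df; set l := derivative_in _ _ _.
have lim : (fun h => h^-1 *: (f (h *: (1 : R) + x) - f x)) @ 0^' --> l.
  apply/cvgrPdist_le => e e0.
  have [d d0 hd] := quotient_near df e0.
  pose r := Num.min d (Num.min (x - a) (b - x)).
  have r0 : 0 < r by rewrite /r !lt_min d0; lra.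
  exists r => //= h /=; rewrite sub0r normrN => hr h0.
  have r1 : r <= d by rewrite /r ge_min lexx.
  have r2 : r <= x - a by rewrite /r !ge_min lexx orbT.
  have r3 : r <= b - x by rewrite /r !ge_min lexx !orbT.
  have hyy : `|x - (h + x)| < d by rewrite (_ : x - (h + x) = - h) ?normrN; [lra|ring].
  have := hd (h + x) _ _ hyy.
  rewrite /quotient /GRing.scale/= mulr1 addrK mulrC; apply.
    by move: hr; rewrite ltr_norml => /andP[? ?]; lra.
  by rewrite -subr_eq0 addrK.
apply: DeriveDef; first by apply/cvg_ex; exists l.
by apply: cvg_lim.
Qed.

Lemma derivable_in_within_continuous (a b : R) (f : R -> R) :
  (forall x, a <= x <= b -> derivable_in `[a, b] f x) ->
  {within `[a, b], continuous f}.
Proof.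
move=> df; apply/subspace_continuousP => x; rewrite /= in_itv/= => xab.
apply/cvgrPdist_le => e e0.
have [d d0 hd] := quotient_near (df _ xab) ltr01.
set l := derivative_in _ _ _ in hd.
pose K := `|l| + 1.
have K0 : 0 < K by rewrite /K ltr_wpDl.
rewrite near_withinE; exists (Num.min d (e / K)) => /=.
  by rewrite lt_min d0 divr_gt0.
move=> y /=; rewrite lt_min => /andP[yd ye]; rewrite in_itv/= => yab.
have [->|yx] := eqVneq y x; first by rewrite subrr normr0 ltW.
have q := hd y yab yx yd.
have qK : `|quotient f x y| <= K.
  rewrite -[quotient f x y](subKr l); apply: (le_trans (ler_normB _ _)).
  by rewrite lerD2l.
have -> : f x - f y = quotient f x y * (x - y).
  by rewrite /quotient; field; rewrite subr_eq0.
rewrite normrM; apply: (@le_trans _ _ (K * (e / K))).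
  by apply: ler_pM => //; exact: ltW.
by rewrite mulrCA divff ?mulr1// gt_eqF.
Qed.

Lemma slope_of_derivative (a b K : R) (f : R -> R) :
  (forall x, a <= x <= b -> derivable_in `[a, b] f x) ->
  (forall x, a <= x <= b -> `|derivative_in `[a, b] f x| <= K) ->
  (forall x y, a <= x <= b -> a <= y <= b -> `|f x - f y| <= K * `|x - y|) /\
  slope_on a b f (fun x => derivative_in `[a, b] f x).
Proof.
move=> df dK.
have drv x : a < x < b -> is_derive x 1 f (derivative_in `[a, b] f x).
  move=> h; apply: derivative_in_interior => //; apply: df; lra.
have lip x y : a <= x -> x <= y -> y <= b -> `|f y - f x| <= K * `|y - x|.
  move=> ax; rewrite le_eqVlt => /predU1P[->|xy] yb; first by rewrite !subrr normr0 mulr0.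
  have cf : {within `[x, y], continuous f}.
    apply: continuous_subspaceW (derivable_in_within_continuous df).
    by move=> z; rewrite /= !in_itv/=; lra.
  have [|c] := @MVT R f (fun x => derivative_in `[a, b] f x) x y xy _ cf.
    by move=> z; rewrite in_itv/= => hz; apply: drv; lra.
  rewrite in_itv/= => hc ->; rewrite normrM ler_wpM2r// dK//; lra.
have lip2 x y : a <= x <= b -> a <= y <= b -> `|f x - f y| <= K * `|x - y|.
  move=> /andP[x1 x2] /andP[y1 y2].
  have [xy|/ltW xy] := leP x y; last exact: lip.
  by rewrite distrC [`|x - y|]distrC; exact: lip.
by split => //; split => //; exists K => x y hx hy; exact: lip2.
Qed.

Lemma slopeZ (a b sg : R) f u : sg = 1 \/ sg = -1 -> slope_on a b f u ->
  slope_on a b (fun x => sg * f x) (fun x => sg * u x).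
Proof.
case=> ->; first by congr slope_on; apply/funext => x; rewrite mul1r.
by move=> /slopeN; congr slope_on; apply/funext => x; rewrite mulN1r.
Qed.

Lemma det2 (A : 'M[R]_2) : \det A = A 0 0 * A 1 1 - A 0 1 * A 1 0.
Proof.
rewrite (expand_det_row _ 0) !big_ord_recl big_ord0 addr0 /cofactor !det_mx11 !mxE /=.
have -> : lift 0 0 = 1 :> 'I_2 by apply/val_inj.
have -> : lift 1 0 = 0 :> 'I_2 by apply/val_inj.
by rewrite expr0 expr1 mul1r mulN1r mulrN.
Qed.

Lemma curvature_detE (I : set R) g (a abar t tbar : R) :
  curvature_det I g a abar t tbar =
  (d_t I g abar tbar - d_t I g abar t) * (d_t I (d_t I g) abar t - d_t I (d_t I g) a t)
  - (d_t I g abar t - d_t I g a t) * (d_t I (d_t I g) abar tbar - d_t I (d_t I g) abar t).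
Proof. by rewrite /curvature_det det2 !mxE. Qed.

End Derivatives.

Section RectangleBounds.
Context {R : realType}.
Variables (a0 a1 t0 t1 : R) (g : R -> R -> R).
Let A : set R := `[a0, a1]%classic.
Let I : set R := `[t0, t1]%classic.
Hypotheses (a01 : a0 <= a1) (t01 : t0 < t1).

Let u := d_t I g.
Let v := d_t I (d_t I g).

Let inA a : A a <-> a0 <= a <= a1. Proof. by rewrite /A /= in_itv. Qed.
Let inI t : I t <-> t0 <= t <= t1. Proof. by rewrite /I /= in_itv. Qed.

Let Aa0 : A a0. Proof. by apply/inA; rewrite lexx. Qed.
Let It0 : I t0. Proof. by apply/inI; rewrite lexx ltW. Qed.
Let It1 : I t1. Proof. by apply/inI; rewrite lexx ltW. Qed.

Lemma norm_infty_le h a t : A a -> I t -> (`|h a t|%:E <= norm_infty A I h)%E.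
Proof. by move=> Aa It; apply: ereal_sup_ubound; exists (a, t). Qed.

Lemma norm_infty_ge0 h : (0 <= norm_infty A I h)%E.
Proof. by apply: le_trans (norm_infty_le h Aa0 It0); rewrite lee_fin. Qed.

Let pair_dist_gt0 (a t b s : R) : (a, t) <> (b, s) -> 0 < `|b - a| + `|s - t|.
Proof.
move=> ne; rewrite lt_neqAle addr_ge0// andbT eq_sym paddr_eq0// !normr_eq0 !subr_eq0.
by apply/negP => /andP[/eqP h1 /eqP h2]; apply: ne; rewrite h1 h2.
Qed.

Lemma norm_Lip_le h a t b s : A a -> I t -> A b -> I s -> (a, t) <> (b, s) ->
  ((`|h b s - h a t| / (`|b - a| + `|s - t|))%:E <= norm_Lip A I h)%E.
Proof.
by move=> Aa It Ab Is ne; apply: ereal_sup_ubound; exists ((a, t), (b, s)).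
Qed.

Lemma norm_Lip_ge0 h : (0 <= norm_Lip A I h)%E.
Proof.
have ne : (a0, t0) <> (a0, t1) by move=> [] /eqP; rewrite lt_eqF.
apply: le_trans (norm_Lip_le h Aa0 It0 Aa0 It1 ne).
by rewrite lee_fin divr_ge0// addr_ge0.
Qed.

Lemma lipschitz_of_norm h K : (norm_Lip A I h <= K%:E)%E -> 0 <= K ->
  forall a t b s, A a -> I t -> A b -> I s ->
    `|h b s - h a t| <= K * (`|b - a| + `|s - t|).
Proof.
move=> hK K0 a t b s Aa It Ab Is.
have [[-> ->]|ne] := pselect ((a, t) = (b, s)); first by rewrite !subrr normr0 addr0 mulr0.
have := le_trans (norm_Lip_le h Aa It Ab Is ne) hK.
by rewrite lee_fin ler_pdivrMr// pair_dist_gt0.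
Qed.

Lemma norm_reg_bounds : reg_finite A I g ->
  exists M : R, [/\ norm_reg A I g = M%:E, 0 <= M,
    forall a t, A a -> I t -> `|u a t| <= M,
    forall a t b s, A a -> I t -> A b -> I s ->
      `|u b s - u a t| <= M * (`|b - a| + `|s - t|) &
    forall a t b s, A a -> I t -> A b -> I s ->
      `|v b s - v a t| <= M * (`|b - a| + `|s - t|)].
Proof.
move=> [_ _ fin].
have n1 := norm_infty_ge0 u; have n2 := norm_Lip_ge0 u; have n3 := norm_Lip_ge0 v.
have reg0 : (0 <= norm_reg A I g)%E by rewrite /norm_reg !adde_ge0.
have regE : norm_reg A I g = (fine (norm_reg A I g))%:E by rewrite fineK// ge0_fin_numE.
have l1 : (norm_infty A I u <= (fine (norm_reg A I g))%:E)%E.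
  by rewrite -regE /norm_reg -addeA leeDl// adde_ge0.
have l2 : (norm_Lip A I u <= (fine (norm_reg A I g))%:E)%E.
  by rewrite -regE /norm_reg addeAC leeDr// adde_ge0.
have l3 : (norm_Lip A I v <= (fine (norm_reg A I g))%:E)%E.
  by rewrite -regE /norm_reg leeDr// adde_ge0.
have M0 : 0 <= fine (norm_reg A I g) by exact: fine_ge0.
exists (fine (norm_reg A I g)); split => //.
- by move=> a t Aa It; rewrite -lee_fin; exact: le_trans (norm_infty_le u Aa It) l1.
- exact: lipschitz_of_norm.
- exact: lipschitz_of_norm.
Qed.

Lemma kappa_bound : (0 < kappa A I g)%E -> exists2 k : R, kappa A I g = k%:E /\ 0 < k &
  forall a t b s, A a -> I t -> A b -> I s ->
    k * (`|b - a| + `|s - t|) <= `|u b s - u a t| + `|v b s - v a t|.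
Proof.
move=> k0.
have lek a t b s : A a -> I t -> A b -> I s -> (a, t) <> (b, s) ->
   (kappa A I g <= ((`|u b s - u a t| + `|v b s - v a t|) / (`|b - a| + `|s - t|))%:E)%E.
  by move=> Aa It Ab Is ne; apply: ereal_inf_lbound; exists ((a, t), (b, s)).
have ne : (a0, t0) <> (a0, t1) by move=> [] /eqP; rewrite lt_eqF.
have kE : kappa A I g = (fine (kappa A I g))%:E.
  rewrite fineK// ge0_fin_numE ?(ltW k0)//.
  by apply: le_lt_trans (lek _ _ _ _ Aa0 It0 Aa0 It1 ne) _; rewrite ltry.
exists (fine (kappa A I g)); first by split => //; rewrite -lte_fin -kE.
move=> a t b s Aa It Ab Is.
have [[-> ->]|ne'] := pselect ((a, t) = (b, s)); first by rewrite !subrr normr0 addr0 mulr0.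
by have := lek _ _ _ _ Aa It Ab Is ne'; rewrite kE lee_fin ler_pdivlMr// pair_dist_gt0.
Qed.

Lemma lambda1_bound a b : A a -> A b -> a <> b -> (0 < lambda1 A I g)%E ->
  exists2 l : R, lambda1 A I g = l%:E /\ 0 < l &
  forall a b t, A a -> A b -> I t -> l * `|b - a| <= `|u b t - u a t|.
Proof.
move=> Aa Ab ab l0.
have lel x y t : A x -> A y -> x <> y -> I t ->
    (lambda1 A I g <= (`|u y t - u x t| / `|y - x|)%:E)%E.
  move=> Ax Ay xy It; apply: le_trans.
    by apply: ereal_inf_lbound; exists t.
  by apply: ereal_inf_lbound; exists (x, y).
have lE : lambda1 A I g = (fine (lambda1 A I g))%:E.
  rewrite fineK// ge0_fin_numE ?(ltW l0)//.
  by apply: le_lt_trans (lel _ _ _ Aa Ab ab It0) _; rewrite ltry.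
exists (fine (lambda1 A I g)); first by split => //; rewrite -lte_fin -lE.
move=> x y t Ax Ay It.
have [->|xy] := pselect (x = y); first by rewrite !subrr normr0 mulr0.
have := lel _ _ _ Ax Ay xy It; rewrite lE lee_fin ler_pdivlMr// normr_gt0 subr_eq0.
by apply/eqP => h; apply: xy.
Qed.

Lemma inf_abs_d_t_bound M : (forall a t, A a -> I t -> u a t != 0) ->
  (forall a t b s, A a -> I t -> A b -> I s ->
      `|u b s - u a t| <= M * (`|b - a| + `|s - t|)) ->
  exists2 m : R, inf_abs_d_t A I g = m%:E /\ 0 < m &
  forall a t, A a -> I t -> m <= `|u a t|.
Proof.
move=> u0 uL.
have cu : {within A `*` I, continuous (fun p : R * R => `|u p.1 p.2|)}.
  apply/subspace_continuousP => -[a t] /= [Aa It].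
  have K0 : 0 < 2 * (Num.max M 0 + 1) by rewrite mulr_gt0// ltr_wpDl// le_max lexx orbT.
  apply/cvgrPdist_le => e e0; rewrite near_withinE.
  exists (ball a (e / (2 * (Num.max M 0 + 1))), ball t (e / (2 * (Num.max M 0 + 1)))) => /=.
    by split; apply: nbhsx_ballx; rewrite divr_gt0.
  move=> [b s] [/= hb hs] [/= Ab Is].
  apply: (le_trans (ler_dist_dist _ _)); rewrite distrC.
  apply: (le_trans (uL _ _ _ _ Aa It Ab Is)).
  move: hb hs; rewrite /ball/= distrC => hb; rewrite distrC => hs.
  have M1 : M <= Num.max M 0 + 1 by rewrite (@le_trans _ _ (Num.max M 0)) ?le_max ?lexx// lerDl.
  apply: (@le_trans _ _ ((Num.max M 0 + 1) * (e / (2 * (Num.max M 0 + 1)) + e / (2 * (Num.max M 0 + 1))))).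
    apply: (@le_trans _ _ ((Num.max M 0 + 1) * (`|b - a| + `|s - t|))).
      by rewrite ler_wpM2r// addr_ge0.
    rewrite ler_wpM2l; [by []|lra|]; apply: lerD; exact: ltW.
  by rewrite le_eqVlt; apply/orP; left; apply/eqP; field; apply/eqP; lra.
have ne : A `*` I !=set0 by exists (a0, t0).
have cpt : compact (A `*` I) by apply: compact_setX; exact: segment_compact.
have [[a t]] := compact_EVT_min ne cpt cu; rewrite inE => -[/= Aa It] mn.
have mn' b s : A b -> I s -> `|u a t| <= `|u b s|.
  by move=> Ab Is; apply: (mn (b, s)); rewrite inE.
exists `|u a t| => //; split; last by rewrite normr_gt0; exact: u0.
apply/eqP; rewrite eq_le; apply/andP; split.
  by apply: ereal_inf_lbound; exists (a, t).
by apply: le_ereal_inf_tmp => _ [[b s] [/= Ab Is] <-]; rewrite lee_fin; exact: mn'.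
Qed.

Let const_sign (x y K : R) (f : R -> R) :
  (forall z w, x <= z <= y -> x <= w <= y -> `|f w - f z| <= K * `|w - z|) ->
  (forall z, x <= z <= y -> f z != 0) -> x <= y -> 0 < f x * f y.
Proof.
move=> fL f0 xy; rewrite ltNge; apply/negP => h.
have [||c] := @IVT R f x y 0 xy.
- exact: lipschitz_within_continuous fL.
- by case: (ltP (f x) (f y)) => hf; apply/andP; split; nra.
- by rewrite in_itv/= => hc /eqP; apply/negP; exact: f0.
Qed.

Lemma d_t_sign M m : (forall a t, A a -> I t -> u a t != 0) -> 0 < m ->
  (forall a t b s, A a -> I t -> A b -> I s ->
      `|u b s - u a t| <= M * (`|b - a| + `|s - t|)) ->
  (forall a t, A a -> I t -> m <= `|u a t|) ->
  exists2 sg : R, sg = 1 \/ sg = -1 & forall a t, A a -> I t -> m <= sg * u a t.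
Proof.
move=> u0 m0 uL um.
have same a t : A a -> I t -> 0 < u a0 t0 * u a t.
  move=> Aa It; have /andP[ta tb] := (inI t).1 It; have /andP[aa ab] := (inA a).1 Aa.
  have h1 : 0 < u a0 t0 * u a0 t.
    apply: (@const_sign t0 t M (u a0)) => //.
      move=> z w hz hw; have := uL a0 z a0 w Aa0 _ Aa0 _; rewrite subrr normr0 add0r.
      by apply; apply/inI; lra.
    by move=> z hz; apply: u0 => //; apply/inI; lra.
  have h2 : 0 < u a0 t * u a t.
    apply: (@const_sign a0 a M (u ^~ t)) => //.
      move=> z w hz hw; have := uL z t w t _ It _ It; rewrite subrr normr0 addr0.
      by apply; apply/inA; lra.
    by move=> z hz; apply: u0 => //; apply/inA; lra.
  have h := mulr_gt0 h1 h2; rewrite [u a0 t0 * _]mulrC mulrACA in h.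
  have sq : 0 < u a0 t * u a0 t by rewrite -expr2 lt0r sqr_ge0 expf_neq0// u0.
  by rewrite -(pmulr_rgt0 _ sq).
have [p|n] := ltP 0 (u a0 t0).
  exists 1; [by left|move=> a t Aa It]; rewrite mul1r.
  by have := um _ _ Aa It; rewrite gtr0_norm// -(pmulr_rgt0 _ p); exact: same.
have {}n : u a0 t0 < 0 by rewrite lt_neqAle n andbT; exact: u0.
exists (-1); [by right|move=> a t Aa It]; rewrite mulN1r.
by have := um _ _ Aa It; rewrite ltr0_norm// -(nmulr_rgt0 _ n); exact: same.
Qed.

End RectangleBounds.

Section Overlap.
Context {R : realType}.

Definition pos_part_or_one (r : R) : R := if 0 < r then r else 1.

Lemma pos_part_or_one_gt0 r : 0 < pos_part_or_one r.
Proof. by rewrite /pos_part_or_one; case: ifP. Qed.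

Lemma pos_part_or_one_id r : 0 < r -> pos_part_or_one r = r.
Proof. by rewrite /pos_part_or_one => ->. Qed.

Let curvature_det_scale (e c u v w u' v' w' : R) :
  e * (((c * u - c * v) * (c * u' - c * v') - (c * w' - c * v') * (c * w - c * v))
       * (c * w - c * v)) * (c * v)
  = c * c * (c * c) * (e * (((u - w) * (u' - v') - (w - v) * (w' - u')) * (w - v) * v)).
Proof. by ring. Qed.

Lemma overlap_bound (ell : bool) (len : R) (reg inf_gt lam kap : \bar R) :
  exists C : R, forall (a0 a1 t0 t1 : R) (g : R -> R -> R),
    let A : set R := `[a0, a1]%classic in
    let I : set R := `[t0, t1]%classic in
    a0 <= a1 -> 1 <= t0 -> t0 < t1 -> t1 <= 2 ->
    nondegenerate A I g -> cinematic A I g ->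
    (forall a abar t tbar, A a -> A abar -> abar <> a -> I t -> I tbar -> t < tbar ->
      0 < (if ell then 1 else -1) * (curvature_det I g a abar t tbar *
        (d_t I g abar t - d_t I g a t) * d_t I g a t)) ->
    t1 - t0 = len -> norm_reg A I g = reg -> inf_abs_d_t A I g = inf_gt ->
    lambda1 A I g = lam -> kappa A I g = kap ->
    forall a abar delta : R, A a -> A abar -> 0 < delta < max_scale ell ->
      (sup_overlap (right_half t0 t1) g a abar delta <=
        (C * (delta ^+ 2 * log_loss ell delta / (delta + `|abar - a|)))%:E)%E.
Proof.
have [C hC] := curved_overlap ell (pos_part_or_one_gt0 len) (pos_part_or_one_gt0 (fine reg))
  (pos_part_or_one_gt0 (fine inf_gt)) (pos_part_or_one_gt0 (fine lam))
  (pos_part_or_one_gt0 (fine kap)).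
exists C => a0 a1 t0 t1 g A I a01 t01 tlt t12 [regf u0 lam0] [_ kap0] sgn tlen regE infE lamE kapE.
move=> a abar delta Aa Ab hd.
have [M [ME M0 uM uL vL]] := norm_reg_bounds a01 tlt regf.
have [m [mE m0] um] := inf_abs_d_t_bound a01 tlt u0 uL.
have [k [kE k0] uk] := kappa_bound a01 tlt kap0.
have [sg hsg usg] := d_t_sign a01 tlt u0 m0 uL um.
have [du dv _] := regf.
have Mp : 0 < M.
  have Ia : A a0 by rewrite /A /= in_itv/= lexx.
  have It : I t0 by rewrite /I /= in_itv/= lexx ltW.
  exact: lt_le_trans (le_trans (um _ _ Ia It) (uM _ _ Ia It)).
rewrite -kapE kE -infE mE -regE ME /= in hC.
rewrite (pos_part_or_one_id Mp) (pos_part_or_one_id m0) (pos_part_or_one_id k0) in hC.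
have len0 : 0 < len by rewrite -tlen subr_gt0.
rewrite (pos_part_or_one_id len0) in hC.
have inI t : t0 <= t <= t1 -> I t by rewrite /I /= in_itv.
have gsl b : A b -> (forall x y, t0 <= x <= t1 -> t0 <= y <= t1 ->
      `|g b x - g b y| <= M * `|x - y|) /\ slope_on t0 t1 (g b) (d_t I g b).
  move=> hb; apply: slope_of_derivative => x /inI hx; [exact: du|exact: uM].
apply: ge_ereal_sup => _ [tau _ <-].
apply: hC => //.
  by move=> b x y [->|->]; [exact: (gsl _ Aa).1|exact: (gsl _ Ab).1].
move=> D0; have neq : abar <> a by move=> e; move: D0; rewrite e subrr normr0 ltxx.
have [l [lE l0] ul] := lambda1_bound tlt Aa Ab (fun e => neq (esym e)) lam0.
have -> : pos_part_or_one (fine lam) = l by rewrite -lamE lE /= pos_part_or_one_id.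
exists sg => //.
have sgn1 (x : R) : `|sg * x| = `|x| by case: hsg => ->; rewrite ?mul1r ?mulN1r ?normrN.
have sg2 : sg * sg = 1 by case: hsg => ->; rewrite ?mulrNN mulr1.
have usl b : A b -> slope_on t0 t1 (d_t I g b) (d_t I (d_t I g) b).
  move=> hb; split.
    exists M => x y hx hy; have := uL b x b y hb (inI _ hx) hb (inI _ hy).
    by rewrite subrr normr0 add0r.
  move=> x hx; apply: derivative_in_interior => //; apply: dv => //; apply: inI.
  by case/andP: hx => /ltW -> /ltW ->.
have mk b c : A b -> A c -> b <> c ->
    curved_pair ell t0 t1 M m l k `|b - c|
      (fun t => sg * g b t) (fun t => sg * d_t I g b t) (fun t => sg * d_t I (d_t I g) b t)
      (fun t => sg * g c t) (fun t => sg * d_t I g c t) (fun t => sg * d_t I (d_t I g) c t).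
  move=> hb hc bc.
  have bnd d x : A d -> t0 <= x <= t1 -> m <= sg * d_t I g d x <= M.
    move=> hd' /inI hx; rewrite usg//=; apply: le_trans (ler_norm _) _.
    by rewrite sgn1; exact: uM.
  split.
  - exact: (slopeZ hsg (gsl _ hb).2).
  - exact: (slopeZ hsg (usl _ hb)).
  - exact: (slopeZ hsg (gsl _ hc).2).
  - exact: (slopeZ hsg (usl _ hc)).
  - by move=> x; exact: bnd.
  - by move=> x; exact: bnd.
  - move=> x y /inI hx /inI hy; rewrite -mulrBr sgn1.
    by have := uL c y c x hc hy hc hx; rewrite subrr normr0 add0r.
  - by move=> x /inI hx; rewrite -mulrBr sgn1; exact: ul.
  - move=> x /inI hx; rewrite -mulrBr sgn1.
    by have := vL c x b x hc hx hb hx; rewrite subrr normr0 addr0.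
  - move=> x y /inI hx /inI hy; rewrite -!mulrBr !sgn1.
    exact: uk.
  - move=> x y tx xy yt.
    have hx : I x by apply: inI; rewrite tx (le_trans (ltW xy)).
    have hy : I y by apply: inI; rewrite yt (le_trans tx)// ltW.
    have h := sgn c b x y hc hb bc hx hy xy; rewrite curvature_detE in h.
    have uc : 0 < sg * d_t I g c x by exact: lt_le_trans (usg _ _ hc hx).
    rewrite -(pmulr_lgt0 _ uc); move: h; set e := if ell then _ else _; set X := e * _ => h.
    have pos Y : Y = sg * sg * (sg * sg) * X -> 0 < Y by move=> ->; rewrite sg2 !mul1r.
    by apply: pos; rewrite /X (curvature_det_scale e sg).
exists (fun t => sg * d_t I g abar t), (fun t => sg * d_t I (d_t I g) abar t),
  (fun t => sg * d_t I g a t), (fun t => sg * d_t I (d_t I g) a t); split.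
  exact: mk.
by rewrite distrC; apply: mk => // e; apply: neq.
Qed.

End Overlap.

Theorem theorem1p5 (R : realType) :
  (forall (len : R) (reg inf_gt lam kap : \bar R), exists C : R,
    forall (a0 a1 t0 t1 : R) (g : R -> R -> R),
      let A : set R := `[a0, a1]%classic in
      let I : set R := `[t0, t1]%classic in
      a0 <= a1 -> 1 <= t0 -> t0 < t1 -> t1 <= 2 ->
      nondegenerate A I g -> cinematic A I g -> elliptic A I g ->
      t1 - t0 = len -> norm_reg A I g = reg -> inf_abs_d_t A I g = inf_gt ->
      lambda1 A I g = lam -> kappa A I g = kap ->
      forall a abar delta : R, A a -> A abar -> 0 < delta -> delta < 1 ->
        (sup_overlap (right_half t0 t1) g a abar delta <=
          (C * (delta ^+ 2 / (delta + `|abar - a|)))%:E)%E)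
  /\
  (forall (len : R) (reg inf_gt lam kap : \bar R) (omega : R -> \bar R),
    exists C : R,
    forall (a0 a1 t0 t1 : R) (g : R -> R -> R),
      let A : set R := `[a0, a1]%classic in
      let I : set R := `[t0, t1]%classic in
      a0 <= a1 -> 1 <= t0 -> t0 < t1 -> t1 <= 2 ->
      nondegenerate A I g -> cinematic A I g -> hyperbolic A I g ->
      has_third_derivs A I g -> third_derivs_equicontinuous A I g ->
      t1 - t0 = len -> norm_reg A I g = reg -> inf_abs_d_t A I g = inf_gt ->
      lambda1 A I g = lam -> kappa A I g = kap ->
      (forall h : R, third_derivs_modulus A I g h = omega h) ->
      forall a abar delta : R, A a -> A abar -> 0 < delta -> delta < 1 / 2 ->
        (sup_overlap (right_half t0 t1) g a abar delta <=
          (C * (delta ^+ 2 * `|ln delta| / (delta + `|abar - a|)))%:E)%E).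
Proof.
split.
- move=> len reg inf_gt lam kap; have [C hC] := overlap_bound true len reg inf_gt lam kap.
  exists C => a0 a1 t0 t1 g A I a01 t01 tlt t12 nd ci el e1 e2 e3 e4 e5 a abar delta Aa Ab d0 d1.
  have hd : 0 < delta < @max_scale R true by rewrite d0.
  have := hC a0 a1 t0 t1 g a01 t01 tlt t12 nd ci _ e1 e2 e3 e4 e5 a abar delta Aa Ab hd.
  rewrite /log_loss mulr1; apply.
  by move=> b c t s Ab' Ac ne It Is ts; rewrite mul1r; exact: el.
- move=> len reg inf_gt lam kap omega; have [C hC] := overlap_bound false len reg inf_gt lam kap.
  exists C => a0 a1 t0 t1 g A I a01 t01 tlt t12 nd ci hy _ _ e1 e2 e3 e4 e5 _ a abar delta Aa Ab d0 d1.
  have hd : 0 < delta < @max_scale R false by rewrite d0.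
  apply: (hC a0 a1 t0 t1 g a01 t01 tlt t12 nd ci _ e1 e2 e3 e4 e5 a abar delta Aa Ab hd).
  by move=> b c t s Ab' Ac ne It Is ts; rewrite mulN1r oppr_gt0; exact: hy.
Qed.
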